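(* Let $I_1, I_2\subset \mathbb{F}_p\setminus\{0\}$ be intervals of sizes $N_1,N_2$ in arbitrary position, and let $\alpha_1(x_1)$ $(x_1\in I_1)$ and $\alpha_2(x_2)$ $(x_2\in I_2)$ be arbitrary complex numbers with $|\alpha_i(x_i)|\le 1$. Then $$\max_{(a,p)=1}\left|\sum_{x_1\in I_1}\sum_{x_2\in I_2}\alpha_1(x_1)\alpha_2(x_2)e_p(ax_1^*x_2^* )\right|\ll p^{1/8}N_1^{3/4}N_2^{3/4}\left(\frac{N_1^3}{p}+1\right)^{1/16}\left(\frac{N_2^3}{p}+1\right)^{1/16}.$$
   Context: $p$ is a large prime, $\mathbb{F}_p$ is the field of residue classes modulo $p$, $x^*$ is the multiplicative inverse of $x$ modulo $p$, and $e_p(z)=e^{2\pi i z/p}$. An interval in $\mathbb{F}_p$ is a set of residue classes of consecutive integers $M+1,\dots,M+N$; its size is $N$. The maximum is over integers $a$ coprime to $p$. The notation $A\ll B$ means $|A|\le CB$ for some absolute constant $C>0$. *)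

(* Defs.v *)
From mathcomp Require Import all_boot all_order all_algebra.
From mathcomp Require Import all_classical all_reals all_analysis.
From mathcomp Require Import complex.

Set Implicit Arguments.
Unset Strict Implicit.
Unset Printing Implicit Defensive.

Import Order.TTheory GRing.Theory Num.Theory.

Local Open Scope ring_scope.
Local Open Scope complex_scope.

(* The residue class z is represented by its canonical integer in [0, p) (for p
   prime); e^(2 pi i n / p) depends only on n modulo p. *)
Definition e_p (R : realType) (p : nat) (z : 'F_p) : R[i] :=
  let t : R := 2 * pi * (z : nat)%:R / p%:R in cos t +i* sin t.

(* The residue classes of M + 1, ..., M + N. If 0 is not among them then N < p,
   so these classes are distinct and N is the cardinality of the set. *)
Definition Fp_interval (p : nat) (M : int) (N : nat) : {set 'F_p} :=
  [set ((M + (k.+1)%:Z)%:~R : 'F_p) | k : 'I_N].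

Definition bilinear_sum (R : realType) (p : nat) (I1 I2 : {set 'F_p})
    (alpha1 alpha2 : 'F_p -> R[i]) (a : int) : R[i] :=
  \sum_(x1 in I1) \sum_(x2 in I2)
    alpha1 x1 * alpha2 x2 * e_p R (a%:~R * x1^-1 * x2^-1).

(* Main.v *)
(* Two applications of the Cauchy-Schwarz inequality and Parseval's identity bound
   the eighth power of the sum by N1^4 N2^4 p E(I1) E(I2), where E(I) is the number of
   solutions of 1/x1 + 1/x2 = 1/x3 + 1/x4 in I.  It remains to prove
   E(I)^2 << N^4 (N^3/p + 1), without logarithms.

   Long intervals (N^101 > p^100): the indicator function of I is majorized by an
   average over the progressions x + y z, z < Z.  By Hoelder's inequality its
   nontrivial Fourier coefficients are controlled by a fourth moment over all pairs
   (nu, w) of sums of e_p(nu / (w + z)), which is bounded by counting the roots of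
   quadratic polynomials.

   Short intervals: write x = M + u.  For l = 1/x1 + 1/x2 <> 0 let b <= B ~ (p/N)^(1/2)
   and |a| <= p/B satisfy b (1/l - M) = a in F_p.  Then
   (b u1 - a) (b u2 - a) = a^2 + b c with c = b u1 u2 - a (u1 + u2), and the integer c
   lies in one residue class modulo p, hence takes O(N^(3/2) p^(-1/2) + 1) values.
   So it suffices that the classes of pairs with the same (l, c) have O(N^2) as the sum
   of the squares of their sizes.  Only the classes with at least five unordered pairs
   matter; such a class consists of factorizations y y' = K of one integer into factors
   that are congruent modulo b and at distance at most b N.  With z a small power of N,
   the number of (b, y, y') arising in this way is O(N^2 / z^5), apart from some with
   small b and y, and each class has O(z) elements by the divisor bound.

   To count the (b, y, y'), the common refinement of three of the factorizations is
   written as four plane vectors, all of whose determinants are nonzero multiples of b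
   with |det(P_i, P_l) p_s q_t| <= b N.  Fixing the dyadic sizes of the determinants and
   choosing the vectors one after the other gives O(N^2 / b) configurations up to
   divisor functions, with a further gain when some coordinates have a large gcd, some
   product of determinants is small, or two vectors are nearly parallel.  In the
   remaining case the five pairs force a split of one of the vectors into two large
   parts, each in a lattice modulo b, which gains again.  If b is almost as large as N,
   the divisors of y already give a saving. *)

Require Import Defs.
From mathcomp Require Import all_boot all_order all_algebra.
From mathcomp Require Import boolp.
From mathcomp Require Import zify ring lra.

Set Implicit Arguments.
Unset Strict Implicit.
Unset Printing Implicit Defensive.

Import Order.TTheory GRing.Theory Num.Theory.

Local Open Scope ring_scope.

(** * Cardinality bounds *)

(** The obstacle is the absence of logarithms. A dyadic decomposition costs powers of log N and
    every factorization costs a divisor function, so a count of the rich classes that is sharp up to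
    N^o(1) is not enough: it has to be improved by a fixed power of N. Both kinds of loss are
    measured by one number [D], a bound for the divisor function; since [2 ^ k] has more than [k]
    divisors, [D] also bounds the number of dyadic sizes. It is at most a constant times [z], a tiny
    root of N. The basic count of quadruples is N^2 / b for each modulus b, up to a power of [D]. A
    large gcd gains [G], a small product of determinants [Dd], a small mixed product of coordinates
    [D2], and a good split [g]; the treatment of each situation loses powers of the preceding
    thresholds, which is why each threshold is a power of the one before. Lines with very small b
    escape all this and are counted directly, which needs p / N to exceed a power of [D2]. Hence the
    division of the intervals at N^101 = p^100: beyond it there is no such room, but p is close
    enough to N for Fourier analysis. *)

(* A bound for the number of elements satisfying a predicate that need not be decidable. *)
Definition atmost (R : realFieldType) (T : eqType) (P : T -> Prop) (B : R) :=
  forall s : seq T, uniq s -> (forall x, x \in s -> P x) -> (size s)%:R <= B.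

Section Atmost.
Variable R : realFieldType.
Implicit Types T U : eqType.

Lemma atmost_le T (P : T -> Prop) (B B' : R) : B <= B' -> atmost P B -> atmost P B'.
Proof. by move=> hB h s us hs; exact: le_trans (h s us hs) hB. Qed.

Lemma atmost_sub T (P Q : T -> Prop) (B : R) :
  (forall x, P x -> Q x) -> atmost Q B -> atmost P B.
Proof. by move=> h hQ s us hs; apply: hQ => // x /hs/h. Qed.

Lemma atmost0 T (P : T -> Prop) (B : R) : 0 <= B -> (forall x, ~ P x) -> atmost P B.
Proof.
move=> hB h [|x s] _ hs; first by rewrite /=.
by case: (h x (hs x (mem_head _ _))).
Qed.

Lemma atmost_inj T U (P : T -> Prop) (Q : U -> Prop) (f : T -> U) (B : R) :
  (forall x, P x -> Q (f x)) ->
  (forall x y, P x -> P y -> f x = f y -> x = y) ->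
  atmost Q B -> atmost P B.
Proof.
move=> hPQ hinj hQ s us hs; rewrite -(size_map f); apply: hQ.
  rewrite map_inj_in_uniq // => x y hx hy; apply: hinj; exact: hs.
by move=> y /mapP[x /hs/hPQ hx ->].
Qed.

(** Preimages are chosen one by one along the finite list [s]; they are distinct because their
    images are. *)
Lemma atmost_surj T U (P : T -> Prop) (Q : U -> Prop) (f : U -> T) (B : R) :
  (forall x, P x -> exists2 y, Q y & f y = x) -> atmost Q B -> atmost P B.
Proof.
move=> h hQ s us hs.
have [t [ut ht et]] : exists t : seq U, [/\ uniq t, (forall y, y \in t -> Q y) & map f t = s].
  elim: s us hs => [|x s IH] /=; first by exists [::].
  move=> /andP[xs us] hs.
  have [t [ut ht et]] := IH us (fun y hy => hs y (mem_behead (s := x :: s) hy)).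
  have [y hy ey] := h x (hs x (mem_head _ _)).
  exists (y :: t); split => /=; last by rewrite ey et.
    rewrite ut andbT; apply/negP => yt.
    by move/negP: xs; apply; rewrite -et -ey; apply: map_f.
  by move=> w; rewrite inE => /orP[/eqP->|/ht].
by rewrite -et size_map; exact: hQ.
Qed.

Lemma atmost_fiber T U (P : T -> Prop) (Q : U -> Prop) (f : T -> U) (m n : R) :
  0 <= n -> (forall x, P x -> Q (f x)) -> atmost Q m ->
  (forall y, Q y -> atmost (fun x => P x /\ f x = y) n) -> atmost P (m * n).
Proof.
move=> n0 hPQ hQ hn s us hs.
have ht := hQ (undup (map f s)) (undup_uniq _).
have {}ht : (size (undup (map f s)))%:R <= m.
  by apply: ht => y; rewrite mem_undup => /mapP[x /hs/hPQ hx ->].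
apply: le_trans (ler_wpM2r n0 ht).
have -> : size s = (\sum_(y <- undup (map f s)) count (fun x => f x == y) s)%N.
  have : {subset map f s <= undup (map f s)} by move=> y; rewrite mem_undup.
  move: (undup_uniq (map f s)); move: (undup _) => t ut.
  elim: s {us hs ht} => [|x s IH] /= st; first by rewrite big1.
  rewrite big_split /= -IH; last by move=> y hy; apply: st; rewrite inE hy orbT.
  have xt : f x \in t by apply: st; rewrite mem_head.
  rewrite (bigD1_seq (f x)) //= eqxx big1 ?addn0 ?add1n //.
  by move=> y /negPf; rewrite eq_sym => ->.
rewrite natr_sum -sum1_size natr_sum mulr_suml.
rewrite big_seq [leRHS]big_seq; apply: ler_sum => y; rewrite mem_undup => /mapP[x hx ey].
rewrite mul1r -size_filter; apply: (hn y); first by rewrite ey; apply/hPQ/hs.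
  exact: filter_uniq.
by move=> w; rewrite mem_filter => /andP[/eqP-> /hs].
Qed.

Lemma atmost_pair T U (P : T -> Prop) (Q : T -> U -> Prop) (m n : R) :
  0 <= n -> atmost P m -> (forall x, P x -> atmost (Q x) n) ->
  atmost (fun w : T * U => P w.1 /\ Q w.1 w.2) (m * n).
Proof.
move=> n0 hP hQ.
apply: (atmost_fiber (f := fst) (Q := P)) => // [w []//|x hx].
apply: (atmost_inj (f := snd)) (hQ x hx); first by move=> [a b] /= [[_ h] <-].
by move=> [a b] [c d] /= [_ ->] [_ ->] ->.
Qed.

Lemma atmost_or T (P Q : T -> Prop) (m n : R) :
  atmost P m -> atmost Q n -> atmost (fun x => P x \/ Q x) (m + n).
Proof.
move=> hP hQ s us hs.
rewrite -(count_predC (fun x => `[< P x >])) natrD; apply: lerD; rewrite -size_filter.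
  by apply: hP; rewrite ?filter_uniq // => x; rewrite mem_filter => /andP[/asboolP].
apply: hQ; rewrite ?filter_uniq // => x; rewrite mem_filter => /andP[/= /asboolP h /hs].
by case.
Qed.

Lemma atmost_exists T U (P : T -> Prop) (J : U -> Prop) (Q : U -> T -> Prop) (m n : R) :
  0 <= n -> (forall x, P x -> exists2 i, J i & Q i x) -> atmost J m ->
  (forall i, J i -> atmost (Q i) n) -> atmost P (m * n).
Proof.
move=> n0 hP hJ hQ.
apply: (atmost_surj (f := snd) (Q := fun w : U * T => J w.1 /\ Q w.1 w.2)).
  by move=> x /hP[i hi hx]; exists (i, x).
exact: atmost_pair.
Qed.

Lemma atmost_seq T (t : seq T) : atmost (fun x => x \in t) ((size t)%:R : R).
Proof. by move=> s us hs; rewrite ler_nat; apply: uniq_leq_size. Qed.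

Lemma atmost_nat (n : nat) : atmost (fun k : nat => (k < n)%N) (n%:R : R).
Proof.
have := @atmost_seq nat (iota 0 n); rewrite size_iota; apply: atmost_sub => k.
by rewrite mem_iota.
Qed.

Lemma atmost_uniq T (P : T -> Prop) :
  (forall x y, P x -> P y -> x = y) -> atmost P (1 : R).
Proof.
move=> h [|x [|y s]] us hs //=.
have := h x y (hs x _) (hs y _); rewrite !inE !eqxx ?orbT => /(_ isT isT) e.
by move: us; rewrite e /= inE eqxx.
Qed.

Lemma atmost_int_window (a : int) (n : nat) :
  atmost (fun x : int => a <= x < a + n%:Z) (n%:R : R).
Proof.
apply: (atmost_inj (f := fun x : int => absz (x - a))) (@atmost_nat n).
  by move=> x; lia.
by move=> x y; lia.
Qed.

Lemma atmost_int_abs (n : nat) : atmost (fun x : int => `|x| <= n%:Z) ((n.*2.+1)%:R : R).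
Proof.
by apply: atmost_sub (@atmost_int_window (- n%:Z) n.*2.+1) => x; lia.
Qed.

End Atmost.

(** * The divisor bound *)

(** This is [e + 1 <= k * 2 ^ (e / k)] raised to the power [k]; it bounds the contribution of one
    small prime to the divisor function. *)
Lemma expn_le_exp2 (k e : nat) : (0 < k -> e.+1 ^ k <= k ^ k * 2 ^ e)%N.
Proof.
move=> k0; have he : (e.+1 <= k * 2 ^ (e %/ k))%N.
  have h1 := ltn_ceil e k0; have h2 : ((e %/ k).+1 <= 2 ^ (e %/ k))%N by apply: ltn_expl.
  by apply: leq_trans h1 _; rewrite mulnC leq_mul2l h2 orbT.
apply: leq_trans (_ : (k * 2 ^ (e %/ k)) ^ k <= _)%N; first by rewrite leq_exp2r.
rewrite expnMn leq_mul2l -expnM; apply/orP; right.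
by rewrite leq_exp2l // leq_trunc_div.
Qed.

(** A divisor [x] is determined by [gcd(x, p ^ e)], a power of [p], and by the cofactor
    [x / gcd(x, p ^ e)], which divides [m]. *)
Lemma size_divisors_pfactor (p e m : nat) : (prime p -> 0 < m ->
  size (divisors (p ^ e * m)) <= e.+1 * size (divisors m))%N.
Proof.
move=> pp m0; have pe0 : (0 < p ^ e)%N by rewrite expn_gt0 prime_gt0.
rewrite -[X in (_ <= X * _)%N](size_iota 0) -[X in (_ <= X)%N](size_allpairs (fun i y => p ^ i * y)%N).
apply: uniq_leq_size; first exact: divisors_uniq.
move=> x; rewrite -dvdn_divisors ?muln_gt0 ?pe0 // => hx.
have x0 : (0 < x)%N by apply: dvdn_gt0 hx; rewrite muln_gt0 pe0.
have /dvdn_pfactor[//|i ie ei] := dvdn_gcdr x (p ^ e).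
apply/allpairsP; exists (i, x %/ gcdn x (p ^ e))%N; split => /=.
- by rewrite -/(iota 0 e.+1) mem_iota add0n ltnS.
- rewrite -dvdn_divisors //.
  have g0 : (0 < gcdn x (p ^ e))%N by rewrite gcdn_gt0 x0.
  have cp : coprime (x %/ gcdn x (p ^ e)) (p ^ e %/ gcdn x (p ^ e)).
    rewrite /coprime -(eqn_pmul2r g0) mul1n muln_gcdl !divnK ?dvdn_gcdl ?dvdn_gcdr //.
  rewrite -(Gauss_dvdr _ cp) -(dvdn_pmul2r g0) divnK ?dvdn_gcdl //.
  by rewrite mulnAC divnK ?dvdn_gcdr.
- by rewrite -ei mulnC divnK ?dvdn_gcdl.
Qed.

(** A prime [p >= 2 ^ k] satisfies [(e + 1) ^ k <= 2 ^ (e k) <= p ^ e] and costs nothing; each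
    smaller prime costs at most a factor [k ^ k]. *)
Lemma divisor_bound (k : nat) : (0 < k)%N ->
  exists C : nat, forall n, (0 < n -> size (divisors n) ^ k <= C * n)%N.
Proof.
move=> k0; pose c := (k ^ k)%N; pose K := (2 ^ k)%N.
have c0 : (0 < c)%N by rewrite expn_gt0 k0.
(* [l] is a lower bound for the prime factors of [n]. Removing the least prime [p] raises it to
   [p + 1], so [c ^ (K - l)] pays once for every prime below [K]. *)
suff H : forall n l, (0 < n)%N -> (forall q, prime q -> q %| n -> l <= q)%N ->
    (size (divisors n) ^ k <= c ^ (K - l) * n)%N.
  by exists (c ^ (K - 0))%N => n n0; apply: H.
move=> n; elim/ltn_ind: n => n IH l n0 hl.
have [n1|n1] := leqP n 1.
  have -> : n = 1%N by lia.
  by rewrite exp1n muln1 expn_gt0 c0.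
set p := pdiv n; have pp : prime p by apply: pdiv_prime.
have [m cpm en] := pfactor_coprime pp n0.
have pn : (p %| n)%N by apply: pdiv_dvd.
have e0 : (0 < logn p n)%N by rewrite logn_gt0 mem_primes pp n0.
have m0 : (0 < m)%N by case: m en {cpm} => [|//]; lia.
move: (logn p n) en e0 => e en e0.
have mn : (m < n)%N.
  by rewrite en -[X in (X < _)%N]muln1 ltn_pmul2l // -(expn0 p) ltn_exp2l // prime_gt1.
have IHm : (size (divisors m) ^ k <= c ^ (K - p.+1) * m)%N.
  apply: IH => // q pq qm; rewrite ltn_neqAle; apply/andP; split.
    apply/eqP => epq; move: cpm; rewrite epq prime_coprime // qm //.
  apply: pdiv_min_dvd; first exact: prime_gt1.
  by rewrite en dvdn_mulr.
have lp : (l <= p)%N by apply: hl.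
have h1 : (size (divisors n) ^ k <= (e.+1 * size (divisors m)) ^ k)%N.
  rewrite leq_exp2r // en mulnC; exact: size_divisors_pfactor.
apply: leq_trans h1 _; rewrite expnMn.
apply: leq_trans (leq_mul (leqnn _) IHm) _.
have p2 : (2 <= p)%N by apply: prime_gt1.
have [pK|Kp] := ltnP p K.
  apply: leq_trans (leq_mul (expn_le_exp2 e k0) (leqnn _)) _.
  rewrite -/c.
  apply: leq_trans (_ : c ^ (K - p) * n <= _)%N; last first.
    by rewrite leq_mul2r leq_pexp2l ?orbT //; lia.
  have -> : (K - p = (K - p.+1).+1)%N by lia.
  rewrite expnS en [(m * _)%N]mulnC -!mulnA leq_mul2l; apply/orP; right.
  rewrite mulnCA leq_mul2l; apply/orP; right.
  by rewrite leq_mul2r leq_exp2r // p2 orbT.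
have -> : (K - p.+1 = 0)%N by lia.
rewrite mul1n; apply: leq_trans (_ : n <= _)%N; last first.
  by rewrite leq_pmull // expn_gt0 c0.
rewrite [X in (_ <= X)%N]en mulnC leq_mul2l; apply/orP; right.
apply: leq_trans (_ : (2 ^ e) ^ k <= _)%N; first by rewrite leq_exp2r //; apply: ltn_expl.
by rewrite -expnM mulnC expnM leq_exp2r.
Qed.

Lemma divisor_bound_root (k c : nat) : (0 < k)%N -> exists C : nat, forall z n : nat,
  (0 < n -> n <= c * z ^ k -> size (divisors n) <= C * z)%N.
Proof.
move=> k0; have [C hC] := divisor_bound k0.
exists (C * c)%N => z n n0 hn.
rewrite -(leq_exp2r _ _ k0); apply: leq_trans (hC n n0) _.
apply: leq_trans (leq_mul (leqnn C) hn) _.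
rewrite mulnA expnMn leq_mul2r; apply/orP; right.
case: (C * c)%N => // d; rewrite -[X in (X <= _)%N]expn1 leq_pexp2l //.
Qed.

Lemma atmost_divz (R : realFieldType) (x : int) : x != 0 ->
  atmost (fun d : int => (d %| x)%Z) ((size (divisors `|x|))%:R * 2 : R).
Proof.
move=> x0; apply: (atmost_fiber (f := absz) (Q := fun k => k \in divisors `|x|)) => //.
- by move=> d; rewrite -dvdn_divisors ?absz_gt0 // dvdzE.
- exact: atmost_seq.
move=> y _; apply: atmost_sub (_ : atmost (fun d : int => d \in [:: y%:Z; - y%:Z]) _).
  by move=> d [_ hd]; rewrite !inE; apply/orP; lia.
exact: (@atmost_seq R _ [:: y%:Z; - y%:Z]).
Qed.

(** * Factorizations for a large modulus *)

(** With [g = gcd(w, d)], the cofactor [w / g] is coprime to [d / g] and hence divides [e]; the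
    larger of [g] and [w / g] reaches the square root of [w]. *)
Lemma dvdz_half (w d e : int) : w != 0 -> (w %| d * e)%Z ->
  exists2 v : int, (v %| w)%Z /\ ((v %| d)%Z \/ (v %| e)%Z) & (`|w| <= `|v| ^ 2)%N.
Proof.
move=> w0 hw; set g := gcdz w d.
have gw : (g %| w)%Z by apply: dvdz_gcdl.
have g0 : g != 0 by rewrite gcdz_eq0 negb_and w0.
have ew : w = (w %/ g)%Z * g by rewrite divzK.
have he : ((w %/ g)%Z %| e)%Z.
  have cp : coprimez (w %/ g)%Z (d %/ g)%Z.
    rewrite /coprimez -(inj_eq (mulIf g0)) mul1r.
    have -> : gcdz (w %/ g)%Z (d %/ g)%Z * g = gcdz ((w %/ g)%Z * g) ((d %/ g)%Z * g).
      by rewrite -mulz_gcdl.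
    by rewrite !divzK ?dvdz_gcdr ?dvdz_gcdl.
  rewrite -(Gauss_dvdzr _ cp) -(dvdz_mul2r g0).
  by rewrite -ew mulrAC divzK ?dvdz_gcdr.
have [h|h] := leqP `|w| (`|g| ^ 2)%N.
  by exists g => //; split => //; left; apply: dvdz_gcdr.
exists (w %/ g)%Z; first by split; [rewrite [X in (_ %| X)%Z]ew dvdz_mulr|right].
move: h; rewrite {1 2}ew abszM -!mulnn ltn_mul2r => /andP[_ h].
by rewrite leq_mul2l (ltnW h) orbT.
Qed.

(** The last two relations make [d = a + u t] and [e = a' + u' t] affine in [t]. Then [d e - A t] is
    a quadratic in [t] with three zeros, so [a a' = 0], [u u' = 0] and [A = a u' + a' u]. As [A] is
    not zero, this equals [(u + u') (a + a') = b j]. *)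
Lemma affine_pair_degenerate (A b j t1 t2 t3 d1 d2 d3 e1 e2 e3 : int) :
  A != 0 -> t1 != t2 -> t1 != t3 -> t2 != t3 ->
  d1 * e1 = A * t1 -> d2 * e2 = A * t2 -> d3 * e3 = A * t3 ->
  d1 + e1 = j + b * t1 -> d2 + e2 = j + b * t2 ->
  (t2 - t3) * d1 + (t3 - t1) * d2 + (t1 - t2) * d3 = 0 ->
  (t2 - t3) * e1 + (t3 - t1) * e2 + (t1 - t2) * e3 = 0 -> A = b * j.
Proof.
move=> A0 n12 n13 n23 p1 p2 p3 s1 s2 rd re.
have inj (x y : int) : x%:~R = y%:~R :> rat -> x = y by move/intr_inj.
have tr (x y : int) : x = y -> x%:~R = y%:~R :> rat by move=> ->.
have trn (x y : int) : x != y -> x%:~R != y%:~R :> rat by rewrite eqr_int.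
apply: inj.
move: (tr _ _ p1) (tr _ _ p2) (tr _ _ p3) (tr _ _ s1) (tr _ _ s2) (tr _ _ rd) (tr _ _ re)
  (trn _ _ A0) (trn _ _ n12) (trn _ _ n13) (trn _ _ n23).
rewrite !(intrD, intrM, intrN, rmorphB, mulr0z) /= => {}p1 {}p2 {}p3 {}s1 {}s2 {}rd {}re {}A0 {}n12 {}n13 {}n23.
move: (A%:~R) (b%:~R) (j%:~R) (t1%:~R) (t2%:~R) (t3%:~R) (d1%:~R) (d2%:~R) (d3%:~R)
  (e1%:~R) (e2%:~R) (e3%:~R) p1 p2 p3 s1 s2 rd re A0 n12 n13 n23.
move=> {A b j t1 t2 t3 d1 d2 d3 e1 e2 e3 tr trn} A b j t1 t2 t3 d1 d2 d3 e1 e2 e3.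
move=> p1 p2 p3 s1 s2 rd re A0 n12 n13 n23.
have h12 : t1 - t2 != 0 by rewrite subr_eq0.
have h13 : t1 - t3 != 0 by rewrite subr_eq0.
have h23 : t2 - t3 != 0 by rewrite subr_eq0.
pose u := (d1 - d2) / (t1 - t2); pose a := d1 - u * t1.
pose u' := (e1 - e2) / (t1 - t2); pose a' := e1 - u' * t1.
have ed1 : d1 = a + u * t1 by rewrite /a; ring.
have ed2 : d2 = a + u * t2 by rewrite /a /u; field.
have ee1 : e1 = a' + u' * t1 by rewrite /a'; ring.
have ee2 : e2 = a' + u' * t2 by rewrite /a' /u'; field.
have ed3 : d3 = a + u * t3.
  apply: (mulfI h12); apply/eqP; rewrite -subr_eq0 -rd ed1 ed2; apply/eqP; ring.
have ee3 : e3 = a' + u' * t3.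
  apply: (mulfI h12); apply/eqP; rewrite -subr_eq0 -re ee1 ee2; apply/eqP; ring.
have eb : b = u + u'.
  by apply: (mulfI h12); move: s1 s2; rewrite ed1 ed2 ee1 ee2 => h1 h2; lra.
have ej : j = a + a' by have := s1; rewrite eb [in X in X -> _]ed1 ee1 => h; lra.
pose B := a * u' + a' * u - A.
have q1 : a * a' + B * t1 + u * u' * t1 ^+ 2 = 0 by rewrite /B; move: p1; rewrite ed1 ee1 => p; lra.
have q2 : a * a' + B * t2 + u * u' * t2 ^+ 2 = 0 by rewrite /B; move: p2; rewrite ed2 ee2 => p; lra.
have q3 : a * a' + B * t3 + u * u' * t3 ^+ 2 = 0 by rewrite /B; move: p3; rewrite ed3 ee3 => p; lra.
have r12 : B + u * u' * (t1 + t2) = 0.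
  by apply: (mulfI h12); rewrite mulr0; lra.
have r13 : B + u * u' * (t1 + t3) = 0.
  by apply: (mulfI h13); rewrite mulr0; lra.
have uu : u * u' = 0 by apply: (mulfI h23); rewrite mulr0; lra.
have B0 : B = 0 by move: r12; rewrite uu mul0r addr0.
have aa : a * a' = 0 by move: q1; rewrite uu B0 !mul0r !addr0.
have eA : A = a * u' + a' * u by move: B0; rewrite /B => h; lra.
rewrite eb ej eA.
move/eqP: aa; rewrite mulf_eq0 => /orP[]/eqP z0; move: eA; rewrite z0 mul0r ?add0r ?addr0 => eA.
  have u0 : u != 0 by apply: contra_neq A0 => u0; rewrite eA u0 mulr0.
  by move/eqP: uu; rewrite mulf_eq0 (negPf u0) => /eqP->; ring.
have u0 : u' != 0 by apply: contra_neq A0 => u0; rewrite eA u0 mulr0.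
by move/eqP: uu; rewrite mulf_eq0 (negPf u0) orbF => /eqP->; ring.
Qed.

(* From factorizations [y i * y' i = A * A'] with all factors congruent modulo [b]:
   [d = (A - y) / b], [e = (A - y') / b], [j = (A - A') / b]. *)
Definition three_sols (N T : nat) (w : int * int * int) : Prop :=
  let: (b, A, j) := w in [/\ A != 0, A <> b * j &
  exists d e t : 'I_3 -> int, [/\
    forall i, d i * e i = A * t i, forall i, d i + e i = j + b * t i,
    injective t, forall i, t i != 0 /\ `|t i| <= T%:Z &
    forall i, `|d i| <= N%:Z /\ `|e i| <= N%:Z]].

Section Count.
Variable R : realFieldType.

(** Three applications of [dvdz_half] give a divisor [v] of [A] with [|v| ^ 8 >= |A|] that divides
    [d i] or [e i] for each [i]. As [|A| <= N ^ 2], the quotient [A' = A / v] is at most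
    [N ^ (7/4) <= Y]. The reduced [d i] are divisors of [A' * t i], and [v] is recovered from a
    linear relation. *)
Lemma atmost_three_sols (N T Y D : nat) : (N ^ 7 <= Y ^ 4)%N ->
  (forall n, 0 < n -> n <= Y * T -> size (divisors n) <= D)%N ->
  atmost (three_sols N T)
   ((Y.*2.+1)%:R * (T.*2.+1)%:R ^+ 3 * (D%:R * 2) ^+ 3 : R).
Proof.
move=> hY hD.
pose J3 (x : int * (int * int * int) * (int * int * int)) :=
  let: (A, (t1, t2, t3), (d1, d2, d3)) := x in
  (`|A| <= Y%:Z /\ (`|t1| <= T%:Z /\ `|t2| <= T%:Z) /\ `|t3| <= T%:Z) /\
  [/\ (A * t1 != 0), (A * t2 != 0) & A * t3 != 0] /\
  ((d1 %| A * t1)%Z /\ (d2 %| A * t2)%Z) /\ (d3 %| A * t3)%Z.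
pose Q (x : int * (int * int * int) * (int * int * int)) (w : int * int * int) :=
  let: (A', (t1, t2, t3), (d1, d2, d3)) := x in let: (b, A, j) := w in
  [/\ A != 0, A <> b * j, [/\ t1 != t2, t1 != t3, t2 != t3, A' != 0 & [/\ t1 != 0, t2 != 0 & t3 != 0]] &
   exists v e1 e2 e3 : int, [/\ A = v * A', d1 * e1 = A' * t1 /\ v * d1 + e1 = j + b * t1,
      d2 * e2 = A' * t2 /\ v * d2 + e2 = j + b * t2 &
      d3 * e3 = A' * t3 /\ v * d3 + e3 = j + b * t3]].
have -> : (Y.*2.+1)%:R * (T.*2.+1)%:R ^+ 3 * (D%:R * 2) ^+ 3 =
  ((Y.*2.+1)%:R * (T.*2.+1)%:R ^+ 3 * (D%:R * 2) ^+ 3) * 1 :> R by rewrite mulr1.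
apply: (atmost_exists (J := J3) (Q := Q)) => //.
- move=> [[b A] j] [A0 Abj [d [e [t [hp hs ti ht hn]]]]].
  have dv i (v : int) : (v %| A)%Z -> (v %| d i * e i)%Z by move=> vA; rewrite hp dvdz_mulr.
  have [v1 [v1A h1] l1] := dvdz_half A0 (dv 0 A (dvdzz A)).
  have v10 : v1 != 0 by apply: contraNneq A0 => v0; rewrite -dvd0z -v0.
  have [v2 [v21 h2] l2] := dvdz_half v10 (dv 1 v1 v1A).
  have v2A := dvdz_trans v21 v1A.
  have v20 : v2 != 0 by apply: contraNneq A0 => v0; rewrite -dvd0z -v0.
  have [v [v32 h3] l3] := dvdz_half v20 (dv 2 v2 v2A).
  have vA := dvdz_trans v32 v2A.
  have v0 : v != 0 by apply: contraNneq A0 => v0; rewrite -dvd0z -v0.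
  have hv i : (v %| d i)%Z \/ (v %| e i)%Z.
    case: i => [[|[|[|//]]] hi].
    + rewrite (_ : Ordinal hi = 0) ?(val_inj (erefl _)) //; last exact: val_inj.
      by case: h1 => h; [left|right]; apply: dvdz_trans h; apply: dvdz_trans v32 v21.
    + rewrite (_ : Ordinal hi = 1); last exact: val_inj.
      by case: h2 => h; [left|right]; apply: dvdz_trans h.
    + by rewrite (_ : Ordinal hi = 2); last exact: val_inj.
  pose A' := (A %/ v)%Z; have eA : A = v * A' by rewrite mulrC divzK.
  have A'0 : A' != 0 by apply: contraNneq A0 => h; rewrite eA h mulr0.
  have AN : (`|A| <= N ^ 2)%N.
    have := hp 0; have [+ _] := ht 0; have [hd he] := hn 0 => t0 ep.
    have : (`|A| * `|t ord0| = `|d ord0| * `|e ord0|)%N by rewrite -!abszM ep.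
    have t1 : (0 < `|t ord0|)%N by rewrite absz_gt0.
    move=> ea; apply: leq_trans (leq_pmulr _ t1) _; rewrite ea -mulnn.
    by apply: leq_mul; rewrite -lez_nat abszE.
  have A'Y : `|A'| <= Y%:Z.
    have hA8 : (`|A| <= `|v| ^ 8)%N.
      apply: leq_trans l1 _; rewrite (_ : 8 = 4 * 2)%N // expnM leq_exp2r //.
      apply: leq_trans l2 _; rewrite (_ : 4 = 2 * 2)%N // expnM leq_exp2r //.
    have h : (`|A'| ^ 8 <= (Y ^ 2) ^ 4)%N.
      rewrite -(leq_pmul2l (_ : 0 < `|v| ^ 8)%N) ?expn_gt0 ?absz_gt0 ?v0 //.
      rewrite -expnMn -abszM -eA (_ : 8 = 1 + 7)%N // {1}expnD expn1.
      rewrite -expnM (_ : 2 * 4 = 4 * 2)%N // expnM.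
      apply: leq_mul => //; apply: leq_trans (_ : (N ^ 2) ^ 7 <= _)%N; first by rewrite leq_exp2r.
      by rewrite -expnM mulnC expnM leq_exp2r.
    have : (`|A'| ^ 8 <= Y ^ 8)%N by rewrite [X in (_ <= X)%N](_ : Y ^ 8 = (Y ^ 2) ^ 4)%N // -expnM.
    by rewrite leq_exp2r // => ?; lia.
  (* After exchanging [d i] and [e i] if necessary, [v] divides the first. *)
  have sol i : exists de : int * int, de.1 * de.2 = A' * t i /\ v * de.1 + de.2 = j + b * t i.
    case: (hv i) => /dvdzP[x ex].
      exists (x, e i); split; last by rewrite /= -hs ex mulrC.
      by apply: (mulfI v0); rewrite /= mulrA -[v * x]mulrC -ex hp eA mulrA.
    exists (x, d i); split; last by rewrite /= -hs ex mulrC addrC.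
    by apply: (mulfI v0); rewrite /= mulrA -[v * x]mulrC -ex mulrC hp eA mulrA.
  have [[d1 e1] /= [p1 s1]] := sol 0; have [[d2 e2] /= [p2 s2]] := sol 1.
  have [[d3 e3] /= [p3 s3]] := sol 2.
  have [[t10 t1T] [t20 t2T] [t30 t3T]] := And3 (ht 0) (ht 1) (ht 2).
  exists (A', (t 0, t 1, t 2), (d1, d2, d3)).
    split; first by [].
    split; first by split; rewrite mulf_neq0.
    by rewrite -p1 -p2 -p3 !dvdz_mulr.
  split => //; last by exists v, e1, e2, e3.
  by split => //; apply/eqP => /ti.
- pose P1 (x : int * (int * int * int)) := let: (A, (t1, t2, t3)) := x in
    `|A| <= Y%:Z /\ (`|t1| <= T%:Z /\ `|t2| <= T%:Z) /\ `|t3| <= T%:Z.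
  pose P2 (x : int * (int * int * int)) (y : int * int * int) :=
   let: (A, (t1, t2, t3)) := x in let: (d1, d2, d3) := y in
   [/\ (A * t1 != 0), (A * t2 != 0) & A * t3 != 0] /\
   ((d1 %| A * t1)%Z /\ (d2 %| A * t2)%Z) /\ (d3 %| A * t3)%Z.
  apply: (@atmost_sub _ _ _ (fun w => P1 w.1 /\ P2 w.1 w.2)).
    by move=> [[A [[t1 t2] t3]] [[d1 d2] d3]].
  apply: (@atmost_pair _ _ _ P1 P2); first by rewrite exprn_ge0 // mulr_ge0.
    apply: (@atmost_sub _ _ _ (fun w : int * (int * int * int) => `|w.1| <= Y%:Z /\
      (fun _ (u : int * int * int) => (`|u.1.1| <= T%:Z /\ `|u.1.2| <= T%:Z) /\ `|u.2| <= T%:Z) w.1 w.2)).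
      by move=> [A [[t1 t2] t3]].
    apply: (@atmost_pair _ _ _ (fun A : int => `|A| <= Y%:Z)
      (fun _ (u : int * int * int) => (`|u.1.1| <= T%:Z /\ `|u.1.2| <= T%:Z) /\ `|u.2| <= T%:Z)); rewrite ?exprn_ge0 //.
      exact: atmost_int_abs.
    move=> A hA; rewrite exprSr expr2.
    apply: (@atmost_pair _ _ _ (fun u : int * int => `|u.1| <= T%:Z /\ `|u.2| <= T%:Z) (fun _ (x : int) => `|x| <= T%:Z)) => //.
      apply: (@atmost_pair _ _ _ (fun u : int => `|u| <= T%:Z) (fun _ (x : int) => `|x| <= T%:Z)) => //.
        exact: atmost_int_abs.
      by move=> _ _; exact: atmost_int_abs.
    by move=> _ _; exact: atmost_int_abs.
  move=> [A [[t1 t2] t3]] [hA [[h1 h2] h3]].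
  have hd t : A * t != 0 -> `|t| <= T%:Z -> atmost (fun d : int => (d %| A * t)%Z) (D%:R * 2 : R).
    move=> n0 ht; apply: atmost_le (atmost_divz R n0).
    rewrite ler_pM2r // ler_nat; apply: hD; first by rewrite absz_gt0.
    by rewrite abszM leq_mul //; lia.
  have [[a1 a2 a3]|h] := pselect ([/\ (A * t1 != 0), (A * t2 != 0) & A * t3 != 0]); last first.
    by apply: atmost0; [rewrite exprn_ge0 // mulr_ge0|move=> [[d1 d2] d3] []].
  rewrite exprSr expr2.
  apply: (@atmost_sub _ _ _ (fun w : int * int * int => (fun u : int * int => (u.1 %| A * t1)%Z /\ (u.2 %| A * t2)%Z) w.1 /\ (fun _ (x : int) => (x %| A * t3)%Z) w.1 w.2)).
    by move=> [[d1 d2] d3] [].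
  apply: (@atmost_pair _ _ _ (fun u : int * int => (u.1 %| A * t1)%Z /\ (u.2 %| A * t2)%Z)
    (fun _ (x : int) => (x %| A * t3)%Z)); rewrite ?mulr_ge0 //; last by move=> _ _; exact: hd.
  apply: (@atmost_pair _ _ _ (fun u : int => (u %| A * t1)%Z) (fun _ (x : int) => (x %| A * t2)%Z)); rewrite ?mulr_ge0 //.
    exact: hd.
  by move=> _ _; exact: hd.
- move=> [[A' [[t1 t2] t3]] [[d1 d2] d3]] _; apply: atmost_uniq.
  move=> [[b A] j] [[b' B] j'] [A0 Abj [n12 n13 n23 A'0 [t10 t20 t30]]].
  move=> [v [e1 [e2 [e3 [eA [p1 s1] [p2 s2] [p3 s3]]]]]].
  move=> [B0 Bbj _ [w [f1 [f2 [f3 [eB [q1 r1] [q2 r2] [q3 r3]]]]]]].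
  have de (d e f t : int) : t != 0 -> d * e = A' * t -> d * f = A' * t -> f = e.
    move=> t0 h1 h2; have d0 : d != 0.
      by apply/eqP => d0; move/eqP: h1; rewrite d0 mul0r eq_sym mulf_eq0 (negPf A'0) (negPf t0).
    by apply: (mulfI d0); rewrite h1 h2.
  move: (de _ _ _ _ t10 p1 q1) (de _ _ _ _ t20 p2 q2) (de _ _ _ _ t30 p3 q3) => ef1 ef2 ef3.
  subst f1 f2 f3.
  pose c := (t2 - t3) * d1 + (t3 - t1) * d2 + (t1 - t2) * d3.
  pose c' := (t2 - t3) * e1 + (t3 - t1) * e2 + (t1 - t2) * e3.
  have E1 : v * c + c' = 0.
    have -> : v * c + c' = (t2 - t3) * (v * d1 + e1) + (t3 - t1) * (v * d2 + e2) + (t1 - t2) * (v * d3 + e3).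
      by rewrite /c /c'; ring.
    by rewrite s1 s2 s3; ring.
  have E2 : w * c + c' = 0.
    have -> : w * c + c' = (t2 - t3) * (w * d1 + e1) + (t3 - t1) * (w * d2 + e2) + (t1 - t2) * (w * d3 + e3).
      by rewrite /c /c'; ring.
    by rewrite r1 r2 r3; ring.
  (* If [c] vanishes, so does [c'], and the degenerate case [A = b * j] results; otherwise [v] is
     determined as [- c' / c], and two of the sums then give [b] and [j]. *)
  have [c0|c0] := eqVneq c 0.
    case: Abj; apply: (@affine_pair_degenerate A b j t1 t2 t3 (v * d1) (v * d2) (v * d3) e1 e2 e3) => //.
    + by rewrite -mulrA p1 eA mulrA.
    + by rewrite -mulrA p2 eA mulrA.
    + by rewrite -mulrA p3 eA mulrA.
    + by rewrite !(mulrCA _ v) -!mulrDr -/c c0 mulr0.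
    + by move: E1; rewrite c0 mulr0 add0r.
  have vw : v = w by apply: (mulIf c0); apply: (addIr c'); rewrite E1 E2.
  subst w.
  have u1 : j + b * t1 = j' + b' * t1 by rewrite -s1 -r1.
  have u2 : j + b * t2 = j' + b' * t2 by rewrite -s2 -r2.
  have h12 : (b - b') * (t1 - t2) = 0.
    have -> : (b - b') * (t1 - t2) = (j + b * t1 - (j' + b' * t1)) - (j + b * t2 - (j' + b' * t2)) by ring.
    by rewrite u1 u2 !subrr.
  have ebb : b = b'.
    by move/eqP: h12; rewrite mulf_eq0 [t1 - t2 == 0]subr_eq0 (negPf n12) orbF subr_eq0 => /eqP.
  by subst b'; congr (_, _, _); [rewrite eA eB|apply: (addIr (b * t1))].
Qed.

End Count.

(** * Plane vectors *)

Notation vec := (int * int)%type.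

Definition det2 (v w : vec) : int := v.1 * w.2 - v.2 * w.1.

(* [lg 0 = 0] *)
Definition lg (x : int) : nat := trunc_log 2 `|x|.

Lemma lg_bounds (x : int) : x != 0 -> (2 ^ lg x <= `|x| < 2 ^ (lg x).+1)%N.
Proof. by move=> x0; apply: trunc_log_bounds => //; rewrite absz_gt0. Qed.

Section Lattice.
Variable R : realFieldType.

(* Distinct slopes of vectors of comparable size differ by at least the
   determinant over the product of the second coordinates. *)
Lemma atmost_slopes (T : eqType) (P : T -> Prop) (f g : T -> int) (a c m : nat) : (0 < m)%N ->
  (forall t, P t -> (`|f t| < 2 ^ a.+1)%N) ->
  (forall t, P t -> (2 ^ c <= `|g t| < 2 ^ c.+1)%N) ->
  (forall s t, P s -> P t -> s != t -> m%:Z <= `|f s * g t - g s * f t|) ->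
  atmost P (2 + 16 * (2 ^+ a * 2 ^+ c) / m%:R : R).
Proof.
move=> m0 hf hg hd.
pose K := (2 ^ (a + c).+3 %/ m)%N.
have hK : K%:R <= 8 * (2 ^+ a * 2 ^+ c) / m%:R :> R.
  rewrite ler_pdivlMr ?ltr0n // -natrM; apply: le_trans (_ : (2 ^ (a + c).+3)%:R <= _).
    by rewrite ler_nat leq_trunc_div.
  by rewrite natrX !exprS exprD le_eqVlt; apply/orP; left; apply/eqP; ring.
pose X t : int := (`|g t|)%:Z; pose F t : int := if 0 <= g t then f t else - f t.
(* The slope [f / g] in units of [m / 4 ^ (c + 1)], rounded down. Distinct slopes differ by at least
   [m / |g g'|], which is more than one unit. *)
pose key t : int := (F t * (4 ^ c.+1)%:Z %/ (X t * m%:Z))%Z.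
apply: (@atmost_le _ _ _ ((K.*2.+2)%:R)).
  have -> : (K.*2.+2)%:R = 2 + 2 * K%:R :> R by rewrite -addn2 natrD -muln2 natrM; ring.
  by rewrite -[16](_ : 2 * 8 = 16 :> R) -?[2 * 8 * _ / _]mulrA ?natrM; [|ring]; lra.
have key_bounds t : P t -> key t * (X t * m%:Z) <= F t * (4 ^ c.+1)%:Z < (key t + 1) * (X t * m%:Z).
  move=> ht; have [g1 g2] := andP (hg t ht).
  have Xm : 0 < X t * m%:Z by rewrite /X; have := expn_gt0 2 c; nia.
  by apply/andP; split; [apply: lez_floor; lia|apply: ltz_ceil].
apply: (@atmost_inj _ _ _ _ (fun x : int => - (K%:Z + 1) <= x < - (K%:Z + 1) + (K.*2.+2)%:Z) key);
  last exact: atmost_int_window.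
- move=> t ht; have [g1 g2] := andP (hg t ht); have h1 := hf t ht.
  have /andP[k1 k2] := key_bounds t ht.
  have hF : (`|F t| < 2 ^ a.+1)%N by rewrite /F; case: ifP => _; rewrite ?abszN.
  have hK2 : (2 ^ (a + c).+3 < K.+1 * m)%N by apply: ltn_ceil.
  have e1 : (2 ^ a.+1 * 4 ^ c.+1 = 2 ^ c * 2 ^ (a + c).+3)%N.
    by rewrite (_ : 4 = 2 ^ 2)%N // -expnM -!expnD; congr (_ ^ _)%N; lia.
  have h2 : (`|F t| * 4 ^ c.+1 < K.+1 * (`|g t| * m))%N.
    apply: leq_trans (_ : 2 ^ a.+1 * 4 ^ c.+1 <= _)%N; first by rewrite ltn_pmul2r ?expn_gt0.
    rewrite e1; apply: leq_trans (leq_mul g1 (ltnW hK2)) _; rewrite mulnCA leq_mul //.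
  have Xm : 0 < X t * m%:Z by rewrite /X; have := expn_gt0 2 c; nia.
  move: k1 k2 h2 Xm; rewrite /X; move: (4 ^ c.+1)%N (key t) (F t) (absz (g t)) => q k u w.
  move=> k1 k2 h2 wm.
  have k3 : k * (w%:Z * m%:Z) < (K.+1)%:Z * (w%:Z * m%:Z) by nia.
  have k4 : - (K.+1)%:Z * (w%:Z * m%:Z) < (k + 1) * (w%:Z * m%:Z) by nia.
  move: k3 k4; rewrite !ltr_pM2r // => k3 k4; lia.
move=> s t hs ht ek; apply/eqP; apply: contraT => st.
have := hd s t hs ht st.
have /andP[s1 s2] := hg s hs; have /andP[t1 t2] := hg t ht.
have /andP[ks1 ks2] := key_bounds s hs; have /andP[kt1 kt2] := key_bounds t ht.
have eD : `|f s * g t - g s * f t| = `|F s * X t - X s * F t|.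
  by rewrite /F /X; case: (leP 0 (g s)) => ?; case: (leP 0 (g t)) => ?; lia.
rewrite eD; move: ks1 ks2; rewrite ek.
have XX : (`|g s| * `|g t| <= 4 ^ c.+1)%N.
  rewrite (_ : 4 = 2 * 2)%N // expnMn; apply: leq_mul; exact: ltnW.
have g0s : (0 < `|g s|)%N by apply: leq_trans s1; rewrite expn_gt0.
have g0t : (0 < `|g t|)%N by apply: leq_trans t1; rewrite expn_gt0.
have q0 : (0 < 4 ^ c.+1)%N by rewrite expn_gt0.
move: kt1 kt2 XX g0s g0t q0; rewrite /X; move: (4 ^ c.+1)%N (key t) (F t) (F s) (absz (g s)) (absz (g t)).
move=> q k u v x y k1 k2 xy x0 y0 q0 l1 l2 hm.
have e1 : (v * y%:Z - x%:Z * u) * q%:Z < x%:Z * y%:Z * m%:Z.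
  have : v * q%:Z * y%:Z < (k + 1) * (x%:Z * m%:Z) * y%:Z by rewrite ltr_pM2r.
  have : k * (y%:Z * m%:Z) * x%:Z <= u * q%:Z * x%:Z by rewrite ler_pM2r.
  by move=> *; lia.
have e2 : (x%:Z * u - v * y%:Z) * q%:Z < x%:Z * y%:Z * m%:Z.
  have : u * q%:Z * x%:Z < (k + 1) * (y%:Z * m%:Z) * x%:Z by rewrite ltr_pM2r.
  have : k * (x%:Z * m%:Z) * y%:Z <= v * q%:Z * y%:Z by rewrite ler_pM2r.
  by move=> *; lia.
have e3 : x%:Z * y%:Z * m%:Z <= q%:Z * m%:Z by rewrite ler_pM2r; lia.
have [h|h] := leP 0 (v * y%:Z - x%:Z * u).
  have : (v * y%:Z - x%:Z * u) * q%:Z < m%:Z * q%:Z by rewrite [m%:Z * _]mulrC; lia.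
  by rewrite ltr_pM2r; lia.
have : (x%:Z * u - v * y%:Z) * q%:Z < m%:Z * q%:Z by rewrite [m%:Z * _]mulrC; lia.
by rewrite ltr_pM2r; lia.
Qed.

Lemma eq_vec_parallel (v w : vec) : v.1 != 0 -> gcdz v.1 v.2 = gcdz w.1 w.2 ->
  (0 <= v.1) = (0 <= w.1) -> det2 v w = 0 -> v = w.
Proof.
case: v w => [v1 v2] [w1 w2] /= v0 eg es; rewrite /det2 /= => /eqP; rewrite subr_eq0 => /eqP ed.
have g0 : gcdz v1 v2 != 0 by rewrite gcdz_eq0 negb_and v0.
have : (`|v1|)%:Z * gcdz w1 w2 = (`|w1|)%:Z * gcdz v1 v2.
  by rewrite !mulz_gcdr ed [w1 * v1]mulrC [w1 * v2]mulrC.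
rewrite -eg => /(mulIf g0) ea.
have e1 : v1 = w1 by lia.
by subst w1; congr (_, _); apply: (mulfI v0); rewrite ed mulrC.
Qed.

(** Parallel vectors with the same gcd and the same sign of the first coordinate are equal. This
    gives at most [2 * G] families, in each of which the slopes [x / y] are separated. *)
Lemma atmost_vectors (P : vec -> Prop) (x y : vec -> int) (a c m G : nat) : (0 < m)%N ->
  (forall v, P v -> v.1 != 0 /\ (`|gcdz v.1 v.2| <= G)%N) ->
  (forall v, P v -> (`|x v| < 2 ^ a.+1)%N) ->
  (forall v, P v -> (2 ^ c <= `|y v| < 2 ^ c.+1)%N) ->
  (forall v w, P v -> P w -> det2 v w <> 0 -> m%:Z <= `|x v * y w - y v * x w|) ->
  atmost P (G%:R * 2 * (2 + 16 * (2 ^+ a * 2 ^+ c) / m%:R) : R).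
Proof.
move=> m0 hP hx hy hd.
pose J (u : nat * bool) : Prop := (u.1 < G)%N /\ (fun _ b => b \in [:: true; false]) u.1 u.2.
apply: (@atmost_fiber _ _ _ _ J (fun v => ((`|gcdz v.1 v.2|).-1%N, 0 <= v.1))).
- by rewrite addr_ge0 // divr_ge0 // mulr_ge0 // mulr_ge0 ?exprn_ge0.
- move=> v hv; have [v0 hG] := hP v hv; split => /=; last by case: leP.
  have : (0 < `|gcdz v.1 v.2|)%N by rewrite absz_gt0 gcdz_eq0 negb_and v0.
  by move: hG; rewrite /gcdz /=; lia.
- apply: (@atmost_pair _ nat bool (fun k => (k < G)%N) (fun _ b => b \in [:: true; false])) => //.
    exact: atmost_nat.
  by move=> _ _; exact: (@atmost_seq R _ [:: true; false]).
move=> u _; apply: (atmost_slopes (f := x) (g := y)) => //.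
- by move=> t [/hx].
- by move=> t [/hy].
move=> s t [hs es] [ht et] st; apply: hd => // d0; move/eqP: st; apply.
have [s0 _] := hP s hs; have [t0 _] := hP t ht.
apply: eq_vec_parallel => //; last by move: es et => <- [_ ->].
move: es et => <- [eg _].
have h1 : (0 < `|gcdz s.1 s.2|)%N by rewrite absz_gt0 gcdz_eq0 negb_and s0.
have h2 : (0 < `|gcdz t.1 t.2|)%N by rewrite absz_gt0 gcdz_eq0 negb_and t0.
have : (`|gcdz s.1 s.2| = `|gcdz t.1 t.2|)%N by rewrite -(prednK h1) -(prednK h2) eg.
by rewrite /gcdz /= => ->.
Qed.

(** The congruence defines a lattice of index [b], so all determinants are multiples of [b]: the
    separation is [m = b]. *)
Lemma atmost_line_mod (P : vec -> Prop) (X Y : int) (b a c G : nat) : (0 < b)%N ->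
  coprimez X b%:Z ->
  (forall v, P v -> [/\ v.1 != 0, (`|gcdz v.1 v.2| <= G)%N, (b%:Z %| v.1 * X - v.2 * Y)%Z,
      (`|v.1| < 2 ^ a.+1)%N & (2 ^ c <= `|v.2| < 2 ^ c.+1)%N]) ->
  atmost P (G%:R * 2 * (2 + 16 * (2 ^+ a * 2 ^+ c) / b%:R) : R).
Proof.
move=> b0 cX hP; apply: (atmost_vectors (x := fst) (y := snd)) => //.
- by move=> v /hP[].
- by move=> v /hP[].
- by move=> v /hP[].
move=> v w /hP[_ _ dv _ _] /hP[_ _ dw _ _] d0.
have : (b%:Z %| X * det2 v w)%Z.
  have -> : X * det2 v w = (v.1 * X - v.2 * Y) * w.2 - (w.1 * X - w.2 * Y) * v.2.
    by rewrite /det2; ring.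
  by apply: rpredB; apply: dvdz_mulr.
rewrite Gauss_dvdzr; last by rewrite coprimez_sym.
rewrite dvdzE => /dvdn_leq h; have : (0 < `|det2 v w|)%N by rewrite absz_gt0; exact/eqP.
by move=> /h; rewrite /det2 /=; lia.
Qed.

(** One product and the determinant give the other product; the coordinates are then found by
    factoring both. *)
Lemma atmost_det_pairs (b N X e D : nat) : (0 < b)%N ->
  (forall n, 0 < n -> n <= N -> size (divisors n) <= D)%N ->
  atmost (fun u : vec * vec => [/\ (u.1.1 != 0) && (u.1.2 != 0), (u.2.1 != 0) && (u.2.2 != 0),
     `|u.1.1 * u.2.2| <= N%:Z /\ `|u.1.2 * u.2.1| <= N%:Z,
     `|u.1.1 * u.2.2| <= X%:Z \/ `|u.1.2 * u.2.1| <= X%:Z &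
     exists2 n : int, det2 u.1 u.2 = b%:Z * n & (`|n| < 2 ^ e.+1)%N])
  (2 * ((X.*2.+1)%:R * (2 ^+ e * 5)) * (D%:R * 2) ^+ 2 : R).
Proof.
move=> b0 hD.
(* Which product is small, its value, and the determinant divided by b. *)
pose J (w : bool * int * int) : Prop := (w.1.1 \in [:: true; false] /\ `|w.1.2| <= X%:Z) /\ `|w.2| <= (2 ^ e.+1).-1%:Z.
pose Q (w : bool * int * int) (u : vec * vec) : Prop :=
  let: (s, g, n) := w in
  [/\ (u.1.1 != 0) && (u.1.2 != 0), (u.2.1 != 0) && (u.2.2 != 0),
     `|u.1.1 * u.2.2| <= N%:Z /\ `|u.1.2 * u.2.1| <= N%:Z,
     u.1.1 * u.2.2 = (if s then g else g + b%:Z * n) &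
     u.1.2 * u.2.1 = (if s then g - b%:Z * n else g)].
apply: (@atmost_exists _ _ _ _ J Q).
- by rewrite exprn_ge0 // mulr_ge0.
- move=> [[p q] [r s]] /= [h1 h2 h3 hX [n en hn]].
  have hn' : `|n| <= (2 ^ e.+1).-1%:Z by lia.
  move: en; rewrite /det2 /= => en.
  case: hX => hX.
    by exists (true, p * s, n); split => //=; lia.
  by exists (false, q * r, n); split => //=; lia.
- have -> : 2 * ((X.*2.+1)%:R * (2 ^+ e * 5)) = (2 * (X.*2.+1)%:R) * (2 ^+ e * 5) :> R by ring.
  apply: (@atmost_pair _ _ _ (fun u : bool * int => u.1 \in [:: true; false] /\ `|u.2| <= X%:Z) (fun _ (n : int) => `|n| <= (2 ^ e.+1).-1%:Z)).
  + by rewrite mulr_ge0 // exprn_ge0.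
  + apply: (@atmost_pair _ _ _ (fun u : bool => u \in [:: true; false]) (fun _ (n : int) => `|n| <= X%:Z)) => //.
      exact: (@atmost_seq R _ [:: true; false]).
    by move=> _ _; exact: atmost_int_abs.
  + move=> _ _; apply: (@atmost_le _ _ _ ((2 ^ e.+1).-1.*2.+1)%:R); last exact: atmost_int_abs.
    have : ((2 ^ e.+1).-1.*2.+1 <= 2 ^ e * 5)%N by rewrite expnS; have := expn_gt0 2 e; lia.
    by rewrite -(ler_nat R) natrM natrX.
move=> [[s g] n] _.
pose g1 := if s then g else g + b%:Z * n; pose g2 := if s then g - b%:Z * n else g.
have [h0|h0] := pselect ([/\ g1 != 0, g2 != 0, (`|g1| <= N%:Z) & (`|g2| <= N%:Z)]); last first.
  apply: atmost0; first by rewrite exprn_ge0 // mulr_ge0.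
  move=> [[p q] [r t]] [/= /andP[p0 q0] /andP[r0 t0] [hN1 hN2] e1 e2]; apply: h0.
  by rewrite /g1 /g2 -e1 -e2; split => //; rewrite mulf_neq0.
have [g10 g20 hg1 hg2] := h0.
have hd (x : int) : x != 0 -> `|x| <= N%:Z -> atmost (fun d : int => (d %| x)%Z) (D%:R * 2 : R).
  move=> x0 hx; apply: atmost_le (atmost_divz R x0).
  by rewrite ler_pM2r // ler_nat; apply: hD; rewrite ?absz_gt0 //; lia.
apply: (@atmost_inj _ _ _ _ (fun w : int * int => (w.1 %| g1)%Z /\ (fun _ (x : int) => (x %| g2)%Z) w.1 w.2) (fun u => (u.1.1, u.1.2))).
- by move=> [[p q] [r t]] [/= _ _ _]; rewrite -/g1 -/g2 => <- <-; rewrite !dvdz_mulr.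
- move=> [[p q] [r t]] [[p' q'] [r' t']] /= [/= /andP[p0 q0] /andP[r0 t0] _ e1 e2] [/= _ _ _ f1 f2] [ep eq].
  subst p' q'; congr (_, (_, _)).
    by apply: (mulfI q0); rewrite e2 f2.
  by apply: (mulfI p0); rewrite e1 f1.
rewrite expr2; apply: (@atmost_pair _ _ _ (fun u : int => (u %| g1)%Z) (fun _ (x : int) => (x %| g2)%Z)); rewrite ?mulr_ge0 //.
  exact: hd.
by move=> _ _; exact: hd.
Qed.

End Lattice.

(** * Quadruples of vectors *)

Definition unit_vec (b : nat) (v : vec) : Prop :=
  [/\ v.1 != 0, v.2 != 0, coprimez v.1 b & coprimez v.2 b].

(** The labels run over all permutations of the indices, so the last bound holds for both mixed
    products [p_s q_t] and [p_t q_s]. *)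
Definition cfg (b N : nat) (P : 'I_4 -> vec) : Prop :=
  (forall i, unit_vec b (P i)) /\
  forall i l s t, uniq [:: i; l; s; t] ->
    [/\ (b%:Z %| det2 (P i) (P l))%Z, det2 (P i) (P l) != 0 &
        (`|det2 (P i) (P l)| * (`|(P s).1| * `|(P t).2|) <= b * N)%N].

Definition ndet (b : nat) (v w : vec) : int := (det2 v w %/ b%:Z)%Z.

Definition gcdv (v : vec) : nat := `|gcdz v.1 v.2|.

Lemma uniq4P (i l s t : 'I_4) : uniq [:: i; l; s; t] -> forall k, k \in [:: i; l; s; t].
Proof.
move=> u k; have h : #|[set x in [:: i; l; s; t]]| = #|'I_4|.
  by rewrite cardsE (card_uniqP u) card_ord.
have /eqP e : [set x in [:: i; l; s; t]] == [set: 'I_4].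
  by rewrite eqEcard subsetT cardsT h leqnn.
by have := in_setT k; rewrite -e inE.
Qed.

Lemma uniq4_extend (i l : 'I_4) : i != l -> exists s t, uniq [:: i; l; s; t].
Proof.
move=> il.
have := cardsC [set i; l]; rewrite cards2 card_ord il /= => h.
have {h} : size (enum (~: [set i; l])) = 2%N by rewrite -cardE; apply: (@addnI 2).
have hm k : k \in enum (~: [set i; l]) -> (k != i) && (k != l).
  by rewrite mem_enum !inE negb_or.
move: (enum_uniq (~: [set i; l])) hm; case: (enum _) => [|s [|t []]] //= st hm _.
have /andP[s1 s2] := hm s (mem_head _ _).
have /andP[t1 t2] : (t != i) && (t != l) by apply: hm; rewrite !inE eqxx orbT.
move: st; rewrite !inE andbT => st.
by exists s, t; rewrite /= !inE !negb_or il st ![i == _]eq_sym ![l == _]eq_sym s1 s2 t1 t2.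
Qed.

Lemma eq_ffun4 (T : Type) (i l s t : 'I_4) (P Q : {ffun 'I_4 -> T}) :
  uniq [:: i; l; s; t] -> P i = Q i -> P l = Q l -> P s = Q s -> P t = Q t -> P = Q.
Proof.
move=> /uniq4P u ei el es et; apply/ffunP => k; have := u k.
by rewrite !inE => /or4P[]/eqP->.
Qed.

Lemma prod_ord4 (R : comPzRingType) (F : 'I_4 -> R) : \prod_k F k = F 0 * F 1 * F 2%:R * F 3%:R.
Proof.
rewrite !big_ord_recl big_ord0 mulr1 !mulrA.
by congr (_ * F _ * F _ * F _); apply: val_inj.
Qed.

Section Cfg.
Variables (b N : nat) (b0 : (0 < b)%N).

Lemma cfg_ndet (P : 'I_4 -> vec) i l : cfg b N P -> i != l ->
  det2 (P i) (P l) = b%:Z * ndet b (P i) (P l) /\ ndet b (P i) (P l) != 0.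
Proof.
move=> [_ hP] il.
have [s [t u]] := uniq4_extend il.
have [d d0 _] := hP i l s t u.
have e : det2 (P i) (P l) = b%:Z * ndet b (P i) (P l) by rewrite mulrC divzK.
by split => //; apply: contra_neq d0; rewrite e => ->; rewrite mulr0.
Qed.

Lemma cfg_ndet_le (P : 'I_4 -> vec) i l s t : cfg b N P -> uniq [:: i; l; s; t] ->
  (`|ndet b (P i) (P l)| * (`|(P s).1| * `|(P t).2|) <= N)%N.
Proof.
move=> hP u; have il : i != l by move: u => /=; rewrite !inE !negb_or => /andP[/andP[]].
have [e _] := cfg_ndet hP il; have [_ _] := hP.2 _ _ _ _ u.
by rewrite e abszM /= -mulnA leq_pmul2l.
Qed.

End Cfg.

(** * One dyadic class: choosing the four vectors one after the other *)

Section Count.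
Variable R : realFieldType.

(** [ndet A v] and [ndet B v] serve as coordinates of [v]. By the identity [det(A,v) det(B,w) -
    det(B,v) det(A,w) = det(A,B) det(v,w)] the slopes in these coordinates are separated by
    [|ndet A B| >= 2 ^ m]. *)
Lemma atmost_third (b : nat) (A B : vec) (x y m G : nat) : (0 < b)%N ->
  unit_vec b A -> (b%:Z %| det2 A B)%Z -> lg (ndet b A B) = m -> ndet b A B != 0 ->
  atmost (fun v : vec => [/\ unit_vec b v, (gcdv v <= G)%N,
     (b%:Z %| det2 A v)%Z /\ (b%:Z %| det2 B v)%Z, lg (ndet b A v) = x &
      ndet b A v != 0 /\ (lg (ndet b B v) = y /\ ndet b B v != 0)])
   (32 * G%:R * (1 + 2 ^+ x * 2 ^+ y / 2 ^+ m) : R).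
Proof.
move=> b0 hA dAB hm n0.
apply: (@atmost_le _ _ _ (G%:R * 2 * (2 + 16 * (2 ^+ x * 2 ^+ y) / (2 ^ m)%:R))).
  rewrite natrX -mulrA [2 + _](_ : _ = 2 * (1 + 8 * (2 ^+ x * 2 ^+ y / 2 ^+ m))); last by ring.
  have h1 : 0 <= 2 ^+ x * 2 ^+ y / 2 ^+ m :> R by rewrite !mulr_ge0 ?invr_ge0 ?exprn_ge0.
  move: (_ / _) h1 => r h1; have h2 : 0 <= G%:R :> R by [].
  have : G%:R * r >= 0 by apply: mulr_ge0.
  lra.
apply: (@atmost_vectors R _ (fun v => ndet b A v) (fun v => ndet b B v)).
- by rewrite expn_gt0.
- by move=> v [[]].
- by move=> v [_ _ _ <- [h _]]; have /andP[] := lg_bounds h.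
- by move=> v [_ _ _ _ [_ [<- h]]]; exact: lg_bounds h.
move=> v w [[v1 v2 v3 v4] _ [dAv dBv] _ _] [_ _ [dAw dBw] _ _] /eqP d0.
(* [A.1] is invertible modulo [b], so [v] and [w] are both proportional to [A] modulo [b]. *)
have dvw : (b%:Z %| det2 v w)%Z.
  have : (b%:Z %| A.1 * det2 v w)%Z.
    have -> : A.1 * det2 v w = v.1 * det2 A w - w.1 * det2 A v by rewrite /det2; ring.
    by apply: rpredB; apply: dvdz_mull.
  by rewrite Gauss_dvdzr // coprimez_sym; case: hA.
have b1 : b%:Z != 0 by rewrite eqz_nat -lt0n.
have eb u u' : (b%:Z %| det2 u u')%Z -> det2 u u' = ndet b u u' * b%:Z.
  by move=> h; rewrite divzK.
have : (ndet b A v * ndet b B w - ndet b B v * ndet b A w) = ndet b A B * ndet b v w.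
  apply: (mulIf (mulf_neq0 b1 b1)).
  move: (eb _ _ dAv) (eb _ _ dBw) (eb _ _ dBv) (eb _ _ dAw) (eb _ _ dAB) (eb _ _ dvw).
  move: (ndet b A v) (ndet b B w) (ndet b B v) (ndet b A w) (ndet b A B) (ndet b v w) => a1 a2 a3 a4 a5 a6.
  move=> e1 e2 e3 e4 e5 e6.
  have -> : (a1 * a2 - a3 * a4) * (b%:Z * b%:Z) = (a1 * b%:Z) * (a2 * b%:Z) - (a3 * b%:Z) * (a4 * b%:Z) by ring.
  have -> : a5 * a6 * (b%:Z * b%:Z) = (a5 * b%:Z) * (a6 * b%:Z) by ring.
  by rewrite -e1 -e2 -e3 -e4 -e5 -e6 /det2; ring.
move=> ->; rewrite -abszE abszM lez_nat.
have : (2 ^ m <= `|ndet b A B|)%N by rewrite -hm; have /andP[] := lg_bounds n0.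
have : ndet b v w != 0 by apply: contra_neq d0; rewrite eb // => ->; rewrite mul0r.
by move=> r0 hm2; rewrite -[(2 ^ m)%N]muln1 leq_mul // absz_gt0.
Qed.

Definition in_class (b N G : nat) (e : 'I_4 -> 'I_4 -> nat) (P : 'I_4 -> vec) : Prop :=
  [/\ cfg b N P, forall k, (gcdv (P k) <= G)%N &
      forall i l, i != l -> lg (ndet b (P i) (P l)) = e i l].

Definition close_pair (X : nat) (A B : vec) : Prop :=
  (`|A.1| * `|B.2| <= X)%N \/ (`|A.2| * `|B.1| <= X)%N.

(** The opposite determinant is a nonzero multiple of [b], so both mixed products of [P i] and [P l]
    are at most [N] and their divisors are counted by [D]. *)
Lemma atmost_first_pairs (b N G X D : nat) (e : 'I_4 -> 'I_4 -> nat) i l s t :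
  (0 < b)%N -> uniq [:: i; l; s; t] ->
  (forall n, 0 < n -> n <= N -> size (divisors n) <= D)%N ->
  atmost (fun u : vec * vec => exists2 P : {ffun 'I_4 -> vec},
      in_class b N G e P /\ close_pair X (P i) (P l) & u = (P i, P l))
    (120 * D%:R ^+ 2 * X%:R * 2 ^+ e i l : R).
Proof.
move=> b0 u hD; have il : i != l by move: u => /=; rewrite !inE !negb_or => /andP[/andP[]].
(* Products of nonzero coordinates exceed 0, which excludes [X = 0]; afterwards [2 X + 1 <= 3 X]. *)
have [X0|X0] := posnP X.
  apply: atmost0; first by rewrite !mulr_ge0 ?exprn_ge0.
  move=> w [P [[[hP _] _ _] hc] _]; have [i1 i2 _ _] := hP i; have [l1 l2 _ _] := hP l.
  by move: hc; rewrite /close_pair X0 !leqn0 !muln_eq0 !absz_eq0 (negPf i1) (negPf i2) (negPf l1) (negPf l2); case.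
apply: (@atmost_le _ _ _ (2 * ((X.*2.+1)%:R * (2 ^+ e i l * 5)) * (D%:R * 2) ^+ 2)).
  have h : (X.*2.+1)%:R <= 3 * X%:R :> R by rewrite -natrM ler_nat; lia.
  have h2 : 0 <= (2 ^+ e i l * 5) * (D%:R * 2) ^+ 2 :> R by rewrite !mulr_ge0 ?exprn_ge0 ?mulr_ge0.
  have := ler_wpM2r h2 h.
  rewrite [_ * (_ * _ ^+ 2)](_ : _ = (X.*2.+1)%:R * (2 ^+ e i l * 5) * (D%:R * 2) ^+ 2); last by ring.
  rewrite [X in _ <= X -> _](_ : _ = 60 * D%:R ^+ 2 * X%:R * 2 ^+ e i l); last by ring.
  by lra.
apply: atmost_sub (@atmost_det_pairs R b N X (e i l) D b0 hD) => -[A B] [P [[hc hg he] hX] [-> ->]].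
have [hP hP2] := hc; have [i1 i2 _ _] := hP i; have [l1 l2 _ _] := hP l.
have [ed n0] := cfg_ndet hc il.
have st : uniq [:: s; t; i; l].
  by rewrite -[[:: s; t; i; l]]/([:: s; t] ++ [:: i; l]) uniq_catC.
have st' : uniq [:: s; t; l; i].
  by rewrite (perm_uniq (_ : perm_eq _ [:: s; t; i; l])) // -[[:: s; t; l; i]]/([:: s; t] ++ [:: l; i]) perm_cat2l (perm_catC [:: l] [:: i]).
have h0 : (0 < `|ndet b (P s) (P t)|)%N.
  have s_t : s != t by move: st => /=; rewrite !inE !negb_or => /andP[/andP[]].
  by rewrite absz_gt0; have [] := cfg_ndet hc s_t.
have h1 := cfg_ndet_le b0 hc st; have h2 := cfg_ndet_le b0 hc st'.
split => /=; first by rewrite i1.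
- by rewrite l1.
- by rewrite !normrM; split; nia.
- by case: hX => h; [left|right]; rewrite normrM; nia.
by exists (ndet b (P i) (P l)) => //; rewrite -he //; have /andP[] := lg_bounds n0.
Qed.

Lemma atmost_class (b N G X D : nat) (e : 'I_4 -> 'I_4 -> nat) i l s t :
  (0 < b)%N -> uniq [:: i; l; s; t] ->
  (forall n, 0 < n -> n <= N -> size (divisors n) <= D)%N ->
  atmost (fun P : {ffun 'I_4 -> vec} => in_class b N G e P /\ close_pair X (P i) (P l))
    ((120 * D%:R ^+ 2 * X%:R * 2 ^+ e i l) *
     ((32 * G%:R * (1 + 2 ^+ e i s * 2 ^+ e l s / 2 ^+ e i l)) *
      (32 * G%:R * (1 + 2 ^+ e i t * 2 ^+ e l t / 2 ^+ e i l))) : R).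
Proof.
move=> b0 u hD.
have [il [is_ [it [ls [lt st]]]]] : i != l /\ i != s /\ i != t /\ l != s /\ l != t /\ s != t.
  by move: u => /=; rewrite !inE !negb_or => /and4P[/and3P[-> -> ->] /andP[-> ->] -> _].
have g0 a c m : 0 <= 32 * G%:R * (1 + 2 ^+ a * 2 ^+ c / 2 ^+ m) :> R.
  by rewrite !mulr_ge0 ?addr_ge0 ?mulr_ge0 ?invr_ge0 ?exprn_ge0.
apply: (atmost_fiber (f := fun P : {ffun 'I_4 -> vec} => (P i, P l))
  (Q := fun u => exists2 P : {ffun 'I_4 -> vec},
      in_class b N G e P /\ close_pair X (P i) (P l) & u = (P i, P l))).
- by rewrite mulr_ge0.
- by move=> P hP; exists P.
- by apply: (@atmost_first_pairs b N G X D e i l s t).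
move=> _ [Q [hQ _] ->]; have [hQc hQg hQe] := hQ.
have [_ n0] := cfg_ndet hQc il.
pose S x y := fun v : vec => [/\ unit_vec b v, (gcdv v <= G)%N,
     (b%:Z %| det2 (Q i) v)%Z /\ (b%:Z %| det2 (Q l) v)%Z, lg (ndet b (Q i) v) = x &
      ndet b (Q i) v != 0 /\ (lg (ndet b (Q l) v) = y /\ ndet b (Q l) v != 0)].
have dQ : (b%:Z %| det2 (Q i) (Q l))%Z by have [-> _] := cfg_ndet hQc il; exact: dvdz_mulr.
apply: (@atmost_inj R _ _ _ (fun w : vec * vec => S (e i s) (e l s) w.1 /\ (fun _ => S (e i t) (e l t)) w.1 w.2) (fun P : {ffun 'I_4 -> vec} => (P s, P t))).
- move=> P [[[hPc hPg hPe] _] [eQi eQl]].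
  have aux k : i != k -> l != k -> S (e i k) (e l k) (P k).
    move=> ik lk; have [e1 n1] := cfg_ndet hPc ik; have [e2 n2] := cfg_ndet hPc lk.
    rewrite /S -eQi -eQl; split; [exact: hPc.1|exact: hPg| |exact: hPe|].
      by rewrite e1 e2 !dvdz_mulr.
    by do !split => //; exact: hPe.
  by split; apply: aux.
- move=> P P' [_ [ei el]] [_ [ei' el']] [es et].
  by apply: (eq_ffun4 u) => //; [exact: etrans ei (esym ei')|exact: etrans el (esym el')].
apply: (@atmost_pair _ _ _ (S (e i s) (e l s)) (fun _ => S (e i t) (e l t))) => //.
  by apply: atmost_third => //; [exact: hQc.1|exact: hQe].
by move=> _ _; apply: atmost_third => //; [exact: hQc.1|exact: hQe].
Qed.

End Count.

(** * Inequalities between the sizes of the six determinants *)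

Section Rule.
Variable R : realFieldType.
(** Each of the four terms of [n12 (1 + n13 n23 / n12) (1 + n14 n24 / n12)] is at most [w n34]. Here
    [n_il] is the dyadic size of the determinant of the vectors [i] and [l], divided by [b]. *)
Definition class_rule (n12 n13 n14 n23 n24 n34 w : R) :=
  [/\ n12 <= w * n34, n13 * n23 <= w * n34, n14 * n24 <= w * n34 &
      n13 * n23 * (n14 * n24) <= w * (n12 * n34)].

Lemma le_sq (x y : R) : 0 <= y -> x ^+ 2 <= y ^+ 2 -> x <= y.
Proof. by move=> y0 h; case: (leP x y) => // ?; nra. Qed.

(** The two inequalities with [n34] on the right express that index 1 is minimal. With their help
    the squares of the entries of the rule are bounded through the products [n13 n24], [n14 n23] and
    [n12 n34] of opposite pairs. *)
Lemma class_rule_core (n12 n13 n14 n23 n24 n34 w : R) : 1 <= n12 -> 1 <= n13 -> 1 <= n14 -> 1 <= n23 ->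
  1 <= n24 -> 1 <= n34 -> 0 <= w -> n12 * n13 <= n24 * n34 -> n12 * n14 <= n23 * n34 ->
  (n13 * n24) * (n14 * n23) <= w ^+ 2 ->
  (n13 * n24) * n23 ^+ 2 <= w ^+ 2 * (n12 * n34) ->
  (n14 * n23) * n24 ^+ 2 <= w ^+ 2 * (n12 * n34) ->
  (n13 * n24) * (n14 * n23) <= w * (n12 * n34) -> class_rule n12 n13 n14 n23 n24 n34 w.
Proof.
move=> g12 g13 g14 g23 g24 g34 w0 h14 h13.
move=> k1 k2 k3 k4.
have p12 := lt_le_trans ltr01 g12. have p13 := lt_le_trans ltr01 g13. have p14 := lt_le_trans ltr01 g14.
have p23 := lt_le_trans ltr01 g23. have p24 := lt_le_trans ltr01 g24. have p34 := lt_le_trans ltr01 g34.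
have wn : 0 <= w * n34 by apply: mulr_ge0 => //; exact: ltW.
split; last 1 first.
- by apply: le_trans k4; rewrite le_eqVlt; apply/orP; left; apply/eqP; ring.
- apply: le_sq => //.
  have e1 : n12 <= n13 * n24 * n34.
    apply: le_trans (_ : n12 * n13 * n13 <= _); first by rewrite -mulrA ler_peMr ?mulr_ege1 // ltW.
    by have := ler_wpM2r (ltW p13) h14; lra.
  have e2 : n12 <= n14 * n23 * n34.
    apply: le_trans (_ : n12 * n14 * n14 <= _); first by rewrite -mulrA ler_peMr ?mulr_ege1 // ltW.
    by have := ler_wpM2r (ltW p14) h13; lra.
  have : n12 * n12 <= (n13 * n24 * n34) * (n14 * n23 * n34) by apply: ler_pM; lra.
  have := ler_wpM2r (sqr_ge0 n34) k1.
  by rewrite exprMn; lra.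
- apply: le_sq => //; rewrite -(ler_pM2r p12).
  have : 0 <= n13 * n23 ^+ 2 by rewrite mulr_ge0 ?exprn_ge0 // ltW.
  move=> /ler_wpM2r /(_ _ _ h14); have := ler_wpM2r (ltW p34) k2.
  by rewrite !exprMn; lra.
apply: le_sq => //; rewrite -(ler_pM2r p12).
have : 0 <= n14 * n24 ^+ 2 by rewrite mulr_ge0 ?exprn_ge0 // ltW.
move=> /ler_wpM2r /(_ _ _ h13); have := ler_wpM2r (ltW p34) k3.
by rewrite !exprMn; lra.
Qed.

(** Serves the case where some product of opposite pairs is small: as [n12 n34] is the largest of
    the three, a bound for its product with one of the others yields all the conditions. *)
Lemma class_rule_max (n12 n13 n14 n23 n24 n34 w : R) : 1 <= n12 -> 1 <= n13 -> 1 <= n14 -> 1 <= n23 ->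
  1 <= n24 -> 1 <= n34 -> 0 <= w -> n12 * n13 <= n24 * n34 -> n12 * n14 <= n23 * n34 ->
  n13 * n24 <= n12 * n34 -> n14 * n23 <= n12 * n34 ->
  (n12 * n34) * (n13 * n24) <= w ^+ 2 \/ (n12 * n34) * (n14 * n23) <= w ^+ 2 -> class_rule n12 n13 n14 n23 n24 n34 w.
Proof.
move=> g12 g13 g14 g23 g24 g34 w0 h14 h13.
set t := n12 * n34; set x := n13 * n24; set z := n14 * n23 => xt zt h.
have z23 : n23 <= z by rewrite /z; nra.
have x24 : n24 <= x by rewrite /x; nra.
have x1 : 1 <= x by rewrite /x; nra.
have z1 : 1 <= z by rewrite /z; nra.
have w2 : 0 <= w ^+ 2 by apply: sqr_ge0.
have xz : x * z <= w ^+ 2 by case: h; nra.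
have z2 : n23 ^+ 2 <= z ^+ 2 by rewrite ler_sqr ?nnegrE; lra.
have x2 : n24 ^+ 2 <= x ^+ 2 by rewrite ler_sqr ?nnegrE; lra.
apply: class_rule_core; rewrite -/t -/x -/z //.
- apply: le_trans (_ : x * z ^+ 2 <= _); first by rewrite ler_pM2l //; lra.
  by have : z * (x * z) <= z * w ^+ 2; [rewrite ler_pM2l; lra|nra].
- apply: le_trans (_ : z * x ^+ 2 <= _); first by rewrite ler_pM2l //; lra.
  by have : x * (x * z) <= x * w ^+ 2; [rewrite ler_pM2l; lra|nra].
apply: le_sq; first by nra.
have t0 : 0 < t by lra.
have xx : x * z <= t * x by nra.
have zz : x * z <= t * z by nra.
have tt : x * z <= t * t by nra.
have x0 : 0 <= x * z by nra.
rewrite !expr2; case: h => h.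
  have : (x * z) * (x * z) <= (t * x) * (t * t) by apply: ler_pM.
  by nra.
have : (x * z) * (x * z) <= (t * z) * (t * t) by apply: ler_pM.
by nra.
Qed.

(** Serves the case where no product of opposite pairs is small. The labels 2, 3, 4 can then be in
    any order, at the price of [w = M ^ 2 / m]. *)
Lemma class_rule_flat (m M n12 n13 n14 n23 n24 n34 w : R) : 1 <= n12 -> 1 <= n13 -> 1 <= n14 -> 1 <= n23 ->
  1 <= n24 -> 1 <= n34 -> 0 <= w -> n12 * n13 <= n24 * n34 -> n12 * n14 <= n23 * n34 -> 0 < m ->
  m <= n12 * n34 -> n13 * n24 <= M -> n14 * n23 <= M -> m <= M -> w = M ^+ 2 / m -> class_rule n12 n13 n14 n23 n24 n34 w.
Proof.
move=> g12 g13 g14 g23 g24 g34 w0 h14 h13.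
move=> m0; set t := n12 * n34; set x := n13 * n24; set z := n14 * n23 => mt xM zM mM ew.
have z23 : n23 <= z by rewrite /z; nra.
have x24 : n24 <= x by rewrite /x; nra.
have x1 : 1 <= x by rewrite /x; nra.
have z1 : 1 <= z by rewrite /z; nra.
have M0 : 0 < M by lra.
have Mw : M <= w by rewrite ew ler_pdivlMr // expr2 ler_pM2l.
have wm : w * m = M ^+ 2 by rewrite ew divfK ?gt_eqF.
have wt : M ^+ 2 <= w * t by rewrite -wm ler_wpM2l.
have z2 : n23 ^+ 2 <= M ^+ 2 by rewrite ler_sqr ?nnegrE; lra.
have x2 : n24 ^+ 2 <= M ^+ 2 by rewrite ler_sqr ?nnegrE; lra.
have MM : M * M ^+ 2 <= w ^+ 2 * t.
  by rewrite expr2 [w ^+ 2]expr2 -mulrA; apply: ler_pM; rewrite -?expr2 ?sqr_ge0 //; lra.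
apply: class_rule_core; rewrite -/t -/x -/z //.
- by rewrite expr2; apply: ler_pM; lra.
- by apply: le_trans MM; apply: ler_pM; rewrite ?sqr_ge0 //; lra.
- by apply: le_trans MM; apply: ler_pM; rewrite ?sqr_ge0 //; lra.
by apply: le_trans wt; rewrite expr2; apply: ler_pM; lra.
Qed.

Lemma class_sum (X K n12 n13 n14 n23 n24 n34 w : R) : 0 < n12 -> 0 <= w -> 0 <= X -> class_rule n12 n13 n14 n23 n24 n34 w -> X * n34 <= K ->
  X * n12 * ((1 + n13 * n23 / n12) * (1 + n14 * n24 / n12)) <= 4 * K * w.
Proof.
move=> p12 w0 X0 [r1 r2 r3 r4] hX.
have -> : X * n12 * ((1 + n13 * n23 / n12) * (1 + n14 * n24 / n12)) =
  X * n12 + X * (n13 * n23) + X * (n14 * n24) + X * (n13 * n23 * (n14 * n24) / n12).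
  by field; lra.
have r4' : n13 * n23 * (n14 * n24) / n12 <= w * n34 by rewrite ler_pdivrMr //; lra.
have a1 := ler_wpM2l X0 r1. have a2 := ler_wpM2l X0 r2.
have a3 := ler_wpM2l X0 r3. have a4 := ler_wpM2l X0 r4'.
have := ler_wpM2r w0 hX; lra.
Qed.

End Rule.

Lemma uniq4_perm (i l s t : 'I_4) : uniq [:: i; l; s; t] ->
  [/\ uniq [:: s; t; i; l], uniq [:: s; t; l; i], uniq [:: i; s; l; t], uniq [:: i; t; l; s] &
   [/\ uniq [:: l; i; s; t], uniq [:: i; l; t; s], uniq [:: i; t; s; l], uniq [:: s; i; t; l] & uniq [:: i; s; t; l]]].
Proof.
rewrite /= !inE !negb_or => /and4P[/and3P[a1 a2 a3] /andP[a4 a5] a6 _].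
by rewrite ![s == i]eq_sym ![t == i]eq_sym ![s == l]eq_sym ![t == l]eq_sym ![l == i]eq_sym ![t == s]eq_sym a1 a2 a3 a4 a5 a6.
Qed.

Definition minimal_index (e : 'I_4 -> 'I_4 -> nat) (i : 'I_4) : Prop :=
  forall l s t, uniq [:: i; l; s; t] -> (e i l + e i s <= e l t + e s t)%N.

(** The index with the least sum of its three labels works: compare this sum with that of [t] and
    cancel [e i t]. *)
Lemma minimal_index_exists (e : 'I_4 -> 'I_4 -> nat) :
  (forall i l, i != l -> e i l = e l i) -> exists i, minimal_index e i.
Proof.
move=> esym; pose F i := (\sum_(k | k != i) e i k)%N.
have [i _ hi] := arg_minnP F (isT : xpredT (ord0 : 'I_4)).
exists i => l s t u; have ht := hi t isT.
have sumF (j a b c : 'I_4) : uniq [:: j; a; b; c] -> F j = (e j a + (e j b + e j c))%N.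
  move=> u'; rewrite /F -big_filter (perm_big [:: a; b; c]); last first.
    apply: uniq_perm; first by rewrite filter_uniq // index_enum_uniq.
      by case/andP: u'.
    move=> k; rewrite mem_filter mem_index_enum andbT.
    have := uniq4P u' k; rewrite !inE; case: eqP => [->|_] //= _.
    by move: u' => /andP[]; rewrite !inE => /negPf->.
  by rewrite !big_cons big_nil /=; lia.
have [ut1 ut2 ut3 ut4 [ut5 ut6 ut7 ut8 ut9]] := uniq4_perm u.
have ut : uniq [:: t; l; s; i].
  by move: ut1 => /=; rewrite !inE !negb_or => /and4P[/and3P[a1 a2 a3] /andP[a4 a5] a6 _];
   rewrite [t == s]eq_sym a1 a4 a5 [l == s]eq_sym [l == i]eq_sym a3 a6 a2.
move: ht; rewrite (sumF _ _ _ _ u) (sumF _ _ _ _ ut).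
have ne : [/\ t != l, t != s & t != i].
  by move: ut => /=; rewrite !inE !negb_or => /andP[/and3P[]].
by case: ne => n1 n2 n3; rewrite (esym _ _ n1) (esym _ _ n2) (esym _ _ n3); clear; lia.
Qed.

(** Minimality of [i] does not depend on the order of the other indices, so these can be permuted to
    make the pairing of [i] with [l] maximal. *)
Lemma minimal_max_labels (e : 'I_4 -> 'I_4 -> nat) :
  (forall i l, i != l -> e i l = e l i) -> exists i l s t, [/\ uniq [:: i; l; s; t], minimal_index e i,
   (e i s + e l t <= e i l + e s t)%N & (e i t + e l s <= e i l + e s t)%N].
Proof.
move=> esym; have [i hi] := minimal_index_exists esym.
have [l [s [t u]]] : exists l s t, uniq [:: i; l; s; t].
  have := cardsC [set i]; rewrite cards1 card_ord /= => h.
  have {h} : size (enum (~: [set i])) = 3%N by rewrite -cardE; apply: (@addnI 1).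
  have hm k : k \in enum (~: [set i]) -> (k != i) by rewrite mem_enum !inE.
  move: (enum_uniq (~: [set i])) hm; case: (enum _) => [|l [|s [|t []]]] //= u hm _.
  exists l, s, t; move: u => /= /andP[u1 u2]; rewrite u1 u2 !andbT !inE !negb_or ![i == _]eq_sym.
  by rewrite !hm // !inE eqxx ?orbT.
have [ut1 ut2 ut3 ut4 [ut5 ut6 ut7 ut8 ut9]] := uniq4_perm u.
have E : [/\ e l s = e s l, e s t = e t s & e l t = e t l].
  by move: u => /=; rewrite !inE !negb_or => /and4P[_ /andP[a4 a5] a6 _]; split; apply: esym.
case: E => E1 E2 E3.
have [h1|h1] := leqP (e i s + e l t) (e i l + e s t).
  have [h2|h2] := leqP (e i t + e l s) (e i l + e s t).
    by exists i, l, s, t.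
  by exists i, t, l, s; split => //; clear -E1 E2 E3 h1 h2; lia.
have [h2|h2] := leqP (e i t + e l s) (e i s + e l t).
  by exists i, s, l, t; split => //; clear -E1 E2 E3 h1 h2; lia.
by exists i, t, l, s; split => //; clear -E1 E2 E3 h1 h2; lia.
Qed.

(** * Summation over the dyadic classes and the gain from a small product *)

Section U2.
Variable R : realFieldType.
Implicit Types (P : {ffun 'I_4 -> vec}) (e : 'I_4 -> 'I_4 -> nat).

(** [b * ndet (P i) (P l)] is a difference of two mixed products, each at most
    [N / |ndet (P s) (P t)|]. *)
Lemma cfg_opposite b N (P : 'I_4 -> vec) i l s t : (0 < b)%N -> cfg b N P -> uniq [:: i; l; s; t] ->
  (b * (`|ndet b (P i) (P l)| * `|ndet b (P s) (P t)|) <= 2 * N)%N.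
Proof.
move=> b0 hP u; have [u1 u2 _ _ _] := uniq4_perm u.
have h1 := cfg_ndet_le b0 hP u1; have h2 := cfg_ndet_le b0 hP u2.
have il : i != l by move: u => /=; rewrite !inE !negb_or => /andP[/and3P[]].
have [ed _] := cfg_ndet hP il.
have : (b * `|ndet b (P i) (P l)| <= `|(P i).1| * `|(P l).2| + `|(P l).1| * `|(P i).2|)%N.
  rewrite -[b]/(`|b%:Z|%N) -abszM -ed /det2 -!abszM; lia.
move=> h; rewrite mulnA; apply: leq_trans (leq_mul h (leqnn _)) _.
by rewrite mulnDl mul2n -addnn leq_add // mulnC.
Qed.

Definition cfg_exp b (P : 'I_4 -> vec) (i l : 'I_4) : nat := lg (ndet b (P i) (P l)).

Lemma cfg_exp_sym b N (P : 'I_4 -> vec) i l : (0 < b)%N -> cfg b N P -> i != l -> cfg_exp b P i l = cfg_exp b P l i.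
Proof.
move=> b0 hP il; have li : l != i by rewrite eq_sym.
have [e1 _] := cfg_ndet hP il; have [e2 _] := cfg_ndet hP li.
rewrite /cfg_exp /lg; congr trunc_log.
have : b%:Z * ndet b (P i) (P l) = b%:Z * - ndet b (P l) (P i).
  by rewrite mulrN -e1 -e2 /det2; ring.
by move/mulfI => ->; [rewrite abszN|rewrite eqz_nat -lt0n].
Qed.

Lemma class_bound b N G D D2 e i l s t (w : R) : (0 < b)%N -> (0 < D2)%N -> uniq [:: i; l; s; t] ->
  (forall n, 0 < n -> n <= N -> size (divisors n) <= D)%N -> 0 <= w ->
  class_rule (2 ^+ e i l) (2 ^+ e i s) (2 ^+ e i t) (2 ^+ e l s) (2 ^+ e l t) (2 ^+ e s t) w ->
  atmost (fun P => in_class b N G e P /\ close_pair (N %/ (2 ^ e s t * D2)) (P i) (P l))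
    (480 * 32 ^+ 2 * D%:R ^+ 2 * G%:R ^+ 2 * (N%:R / D2%:R) * w : R).
Proof.
move=> b0 D20 u hD w0 hr.
apply: atmost_le (@atmost_class R b N G _ D e i l s t b0 u hD).
set X := (N %/ _)%N.
have hX : X%:R * 2 ^+ e s t <= N%:R / D2%:R :> R.
  rewrite ler_pdivlMr ?ltr0n // -natrX -!natrM ler_nat -mulnA; exact: leq_trunc_div.
have := class_sum (exprn_gt0 _ (ltr0n _ 2)) w0 (ler0n _ X) hr hX.
have h0 : 0 <= 120 * 32 * 32 * D%:R ^+ 2 * G%:R ^+ 2 :> R by rewrite !mulr_ge0 ?exprn_ge0.
move=> /(ler_wpM2l h0).
rewrite [X in _ <= X -> _](_ : _ = 480 * 32 ^+ 2 * D%:R ^+ 2 * G%:R ^+ 2 * (N%:R / D2%:R) * w); last by ring.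
apply: le_trans; rewrite le_eqVlt; apply/orP; left; apply/eqP; ring.
Qed.

(** Lets the divisor bound [D] control exponents too: the dyadic exponent of a number up to [N] is
    less than [D]. *)
Lemma size_divisors_exp2 (k : nat) : (k < size (divisors (2 ^ k)))%N.
Proof.
rewrite -[X in (X <= _)%N](size_iota 0) -(size_map (expn 2)).
apply: uniq_leq_size.
  by rewrite map_inj_uniq ?iota_uniq // => x y /eqP; rewrite eqn_exp2l // => /eqP.
move=> x /mapP[y]; rewrite mem_iota => /andP[_ hy] ->.
by rewrite -dvdn_divisors ?expn_gt0 // dvdn_exp2l //; lia.
Qed.

(** A class is given by a table of sixteen exponents, each less than [D]. *)
Lemma atmost_classes b N G D (Q : ('I_4 -> vec) -> Prop) (B : R) : (0 < b)%N -> 0 <= B ->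
  (forall n, 0 < n -> n <= N -> size (divisors n) <= D)%N ->
  (forall e, atmost (fun P => in_class b N G e P /\ Q P) B) ->
  atmost (fun P => cfg b N P /\ (forall k, (gcdv (P k) <= G)%N) /\ Q P) (D%:R ^+ 16 * B).
Proof.
move=> b0 B0 hD h.
have -> : D%:R ^+ 16 = (size (enum {ffun 'I_4 * 'I_4 -> 'I_D}))%:R :> R.
  by rewrite -cardE card_ffun card_prod !card_ord natrX.
apply: (@atmost_exists R _ _ _ (fun e : {ffun 'I_4 * 'I_4 -> 'I_D} => e \in enum {ffun 'I_4 * 'I_4 -> 'I_D})
   (fun (e : {ffun 'I_4 * 'I_4 -> 'I_D}) P => in_class b N G (fun i l => e (i, l)) P /\ Q P)) => //; last first.
- refine (@atmost_seq R _ (enum {ffun 'I_4 * 'I_4 -> 'I_D})).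
move=> P [hP [hg hQ]].
have bound i l : i != l -> (cfg_exp b P i l < D)%N.
  move=> il.
  have [_ n0] := cfg_ndet hP il.
  have /andP[h1 _] := lg_bounds n0; rewrite -/(cfg_exp b P i l) in h1.
  have nN : (`|ndet b (P i) (P l)| <= N)%N.
    have [s [t u]] := uniq4_extend il.
    apply: leq_trans (cfg_ndet_le b0 hP u).
    have [s0 _ _ _] := hP.1 s; have [_ t0 _ _] := hP.1 t.
    by rewrite leq_pmulr // muln_gt0 !absz_gt0 s0 t0.
  have := hD (2 ^ cfg_exp b P i l)%N; rewrite expn_gt0 => /(_ isT (leq_trans h1 nN)).
  exact/leq_trans/size_divisors_exp2.
have D0 : (0 < D)%N by apply: leq_ltn_trans (bound ord0 ord_max isT).
pose e := [ffun x : 'I_4 * 'I_4 => insubd (Ordinal D0) (cfg_exp b P x.1 x.2)].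
exists e; first by rewrite mem_enum.
split => //; split => // i l il.
by rewrite ffunE insubdK //; exact: bound.
Qed.

Lemma class_exp b N G e (P : 'I_4 -> vec) i l : in_class b N G e P -> i != l ->
  (2 ^ e i l <= `|ndet b (P i) (P l)| < 2 ^ (e i l).+1)%N.
Proof.
by move=> [hP _ he] il; rewrite -he //; apply: lg_bounds; have [] := cfg_ndet hP il.
Qed.

Lemma class_exp_sym b N G e (P : 'I_4 -> vec) i l : (0 < b)%N -> in_class b N G e P -> i != l -> e i l = e l i.
Proof.
move=> b0 [hP _ he] il; rewrite -!he // 1?eq_sym //; exact: cfg_exp_sym hP il.
Qed.

Lemma uniq4_neq (i l s t : 'I_4) : uniq [:: i; l; s; t] ->
  [/\ i != l, i != s, i != t, l != s & l != t /\ s != t].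
Proof. by rewrite /= !inE !negb_or => /and4P[/and3P[-> -> ->] /andP[-> ->] -> _]. Qed.

Lemma class_prod_le b N G e (P : 'I_4 -> vec) i l s t : (0 < b)%N -> in_class b N G e P -> uniq [:: i; l; s; t] ->
  2 ^+ e i l * 2 ^+ e s t <= 2 * N%:R / b%:R :> R.
Proof.
move=> b0 hP u; have [il _ _ _ [_ st]] := uniq4_neq u; have [hc _ _] := hP.
rewrite ler_pdivlMr ?ltr0n // -!natrX -!natrM ler_nat mulnC.
apply: leq_trans (cfg_opposite b0 hc u); rewrite leq_pmul2l //.
by apply: leq_mul; [have /andP[] := class_exp hP il|have /andP[] := class_exp hP st].
Qed.

(** The threshold 1 is the trivial bound for mixed products. *)
Lemma class_close b N G e (P : 'I_4 -> vec) i l s t : (0 < b)%N -> in_class b N G e P -> uniq [:: i; l; s; t] ->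
  close_pair (N %/ (2 ^ e s t * 1)) (P i) (P l).
Proof.
move=> b0 hP u; have [il _ _ _ [_ st]] := uniq4_neq u; have [hc _ _] := hP.
have [u1 _ _ _ _] := uniq4_perm u.
left; rewrite muln1 leq_divRL ?expn_gt0 // mulnC.
apply: leq_trans (cfg_ndet_le b0 hc u1); rewrite leq_mul2r; apply/orP; right.
by have /andP[] := class_exp hP st.
Qed.

Lemma minimal_index_pow e i l s t : uniq [:: i; l; s; t] -> minimal_index e i ->
  (forall i l, i != l -> e i l = e l i) ->
  2 ^+ e i l * 2 ^+ e i s <= 2 ^+ e l t * 2 ^+ e s t :> R /\
  2 ^+ e i l * 2 ^+ e i t <= 2 ^+ e l s * 2 ^+ e s t :> R.
Proof.
move=> u hi es; have [_ _ _ _ [_ st]] := uniq4_neq u.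
have [_ _ _ _ [_ u2 _ _ _]] := uniq4_perm u.
rewrite -!exprD !ler_weXn2l ?ler1n //; last exact: hi.
by have := hi _ _ _ u2; rewrite (es t s) // eq_sym.
Qed.

Lemma expr2_ge1 n : 1 <= 2 ^+ n :> R.
Proof. by rewrite exprn_ege1 // ler1n. Qed.

(** A property with these symmetries depends only on which index is paired with [i]. *)
Lemma pairing_cases (Phi : 'I_4 -> 'I_4 -> 'I_4 -> 'I_4 -> Prop) i l s t i' l' s' t' :
  (forall i l s t, uniq [:: i; l; s; t] -> Phi i l s t -> Phi l i s t /\ Phi s t i l) ->
  uniq [:: i; l; s; t] -> uniq [:: i'; l'; s'; t'] -> Phi i' l' s' t' ->
  [\/ Phi i l s t, Phi i s l t | Phi i t l s].
Proof.
move=> sym u u' h'.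
have swap a b c d : uniq [:: a; b; c; d] -> Phi a b c d -> Phi a b d c.
  move=> ua h; have [ub _ _ _ _] := uniq4_perm ua.
  have [_ h2] := sym _ _ _ _ ua h; have [h3 _] := sym _ _ _ _ ub h2.
  have uc : uniq [:: d; c; a; b] by have [_ _ _ _ [_ _ _ _ _]] := uniq4_perm ub; have [_ _ _ _ [? _ _ _ _]] := uniq4_perm ub.
  by have [] := sym _ _ _ _ uc h3.
have [a [b [c [ua ha]]]] : exists a b c, uniq [:: i; a; b; c] /\ Phi i a b c.
  have := uniq4P u' i; rewrite !inE => /or4P[]/eqP ei.
  - by exists l', s', t'; rewrite ei.
  - have [_ _ _ _ [v _ _ _ _]] := uniq4_perm u'.
    by exists i', s', t'; rewrite ei; split => //; have [] := sym _ _ _ _ u' h'.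
  - have [v _ _ _ _] := uniq4_perm u'.
    by exists t', i', l'; rewrite ei; split => //; have [] := sym _ _ _ _ u' h'.
  have [v _ _ _ _] := uniq4_perm u'; have [_ h2] := sym _ _ _ _ u' h'.
  have [_ _ _ _ [v2 _ _ _ _]] := uniq4_perm v.
  by exists s', i', l'; rewrite ei; split => //; have [] := sym _ _ _ _ v h2.
have [nia nib nic nab [nac nbc]] := uniq4_neq ua.
have := uniq4P u a; rewrite !inE eq_sym (negPf nia) /= => /or3P[]/eqP ea; subst a.
- have := uniq4P u b; rewrite !inE [b == i]eq_sym (negPf nib) [b == l]eq_sym (negPf nab) /= => /orP[]/eqP eb; subst b;
  have := uniq4P u c; rewrite !inE [c == i]eq_sym (negPf nic) [c == l]eq_sym (negPf nac) /= => /orP[]/eqP ec; subst c.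
  + by rewrite eqxx in nbc.
  + by constructor 1.
  + by constructor 1; apply: swap.
  + by rewrite eqxx in nbc.
- have := uniq4P u b; rewrite !inE [b == i]eq_sym (negPf nib) [b == s]eq_sym (negPf nab) /= => /orP[]/eqP eb; subst b;
  have := uniq4P u c; rewrite !inE [c == i]eq_sym (negPf nic) [c == s]eq_sym (negPf nac) /= => /orP[]/eqP ec; subst c.
  + by rewrite eqxx in nbc.
  + by constructor 2.
  + by constructor 2; apply: swap.
  + by rewrite eqxx in nbc.
have := uniq4P u b; rewrite !inE [b == i]eq_sym (negPf nib) [b == t]eq_sym (negPf nab) /= orbF => /orP[]/eqP eb; subst b;
have := uniq4P u c; rewrite !inE [c == i]eq_sym (negPf nic) [c == t]eq_sym (negPf nac) /= orbF => /orP[]/eqP ec; subst c.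
+ by rewrite eqxx in nbc.
+ by constructor 3.
+ by constructor 3; apply: swap.
by rewrite eqxx in nbc.
Qed.

(** [D ^ 18] is [D ^ 16] for the exponents times [D ^ 2] for the factorizations of the first pair;
    [G ^ 2] comes from the gcds of the other two vectors. *)
Definition count_const (G D : nat) : R := 480 * 32 ^+ 2 * D%:R ^+ 18 * G%:R ^+ 2.

(** By [cfg_opposite] such a product is always at most [2 N / b]; here it is smaller by a factor
    [Dd ^ 2]. *)
Definition small_prod b N Dd (P : 'I_4 -> vec) : Prop :=
  exists i l s t, uniq [:: i; l; s; t] /\
      (`|ndet b (P i) (P l)| * `|ndet b (P s) (P t)| * b * Dd ^ 2 <= 2 * N)%N.

(** [w ^ 2] is the largest possible product [2 N / b] times the small one [2 N / (b Dd ^ 2)], so the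
    saving is [Dd]. *)
Lemma atmost_cfg_small b N G D Dd : (0 < b)%N -> (0 < Dd)%N ->
  (forall n, 0 < n -> n <= N -> size (divisors n) <= D)%N ->
  atmost (fun P => cfg b N P /\ (forall k, (gcdv (P k) <= G)%N) /\ small_prod b N Dd P)
    (count_const G D * N%:R * (2 * N%:R / (b%:R * Dd%:R))).
Proof.
move=> b0 Dd0 hD; set w := 2 * _ / _.
have w0 : 0 <= w by rewrite /w divr_ge0 ?mulr_ge0.
rewrite (_ : _ * w = D%:R ^+ 16 * (480 * 32 ^+ 2 * D%:R ^+ 2 * G%:R ^+ 2 * (N%:R / 1%:R) * w)); last first.
  by rewrite /count_const; field.
have B0 : 0 <= 480 * 32 ^+ 2 * D%:R ^+ 2 * G%:R ^+ 2 * (N%:R / 1) * w.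
  by do ![apply: mulr_ge0 => // | apply: exprn_ge0 => // | rewrite invr_ge0 //].
apply: (@atmost_classes b N G D (small_prod b N Dd)) => // e.
(* The labelling depends only on [e], so it can be read off from one member of the class. *)
have [[P0 [hP0 [i' [l' [s' [t' [u' h']]]]]]]|none] := pselect (exists P, in_class b N G e P /\ small_prod b N Dd P); last first.
  apply: atmost0 => //.
  by move=> P hP; apply: none; exists P.
have esym i l : i != l -> e i l = e l i by exact: class_exp_sym hP0.
have [i [l [s [t [u hi m1 m2]]]]] := minimal_max_labels esym.
have hr : class_rule (2 ^+ e i l) (2 ^+ e i s) (2 ^+ e i t) (2 ^+ e l s) (2 ^+ e l t) (2 ^+ e s t) w.
  have [h14 h13] := minimal_index_pow u hi esym.
  have b1 : 0 < b%:R :> R by rewrite ltr0n.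
  have Dd1 : 0 < Dd%:R :> R by rewrite ltr0n.
  pose sm := 2 * N%:R / (b%:R * Dd%:R ^+ 2) : R.
  have key x : 0 <= x -> x <= 2 * N%:R / b%:R -> forall y, 0 <= y -> y <= sm -> x * y <= w ^+ 2.
    move=> x0 hx y y0 hy; have := ler_pM x0 y0 hx hy.
    by rewrite (_ : _ * sm = w ^+ 2) // /w /sm; field; rewrite !gt_eqF.
  have e0 n : 0 <= 2 ^+ n :> R by rewrite exprn_ge0.
  (* The small product of [P0], whatever its labels, is one of the three pairings of the chosen
     labelling. *)
  have P3 : [\/ 2 ^+ e i l * 2 ^+ e s t <= sm, 2 ^+ e i s * 2 ^+ e l t <= sm | 2 ^+ e i t * 2 ^+ e l s <= sm].
    apply: (@pairing_cases (fun i l s t => 2 ^+ e i l * 2 ^+ e s t <= sm) i l s t i' l' s' t') => //.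
      move=> i1 l1 s1 t1 u1; have [n1 _ _ _ [_ n2]] := uniq4_neq u1.
      by rewrite mulrC => h; split; last exact: h; rewrite (esym l1) 1?eq_sym // mulrC.
    have [n1 _ _ _ [_ n2]] := uniq4_neq u'.
    rewrite /sm ler_pdivlMr ?mulr_gt0 ?exprn_gt0 // -!natrX -!natrM ler_nat.
    apply: leq_trans h'; rewrite mulnA leq_mul2r leq_mul2r; apply/orP; right; apply/orP; right.
    by apply: leq_mul; [have /andP[] := class_exp hP0 n1|have /andP[] := class_exp hP0 n2].
  have tm := class_prod_le b0 hP0 u.
  have h1 : 2 ^+ e i s * 2 ^+ e l t <= 2 ^+ e i l * 2 ^+ e s t :> R by rewrite -!exprD ler_weXn2l ?ler1n.
  have h2 : 2 ^+ e i t * 2 ^+ e l s <= 2 ^+ e i l * 2 ^+ e s t :> R by rewrite -!exprD ler_weXn2l ?ler1n.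
  apply: class_rule_max => //; rewrite ?expr2_ge1 //.
  case: P3 => h; [left|left|right]; apply: key; rewrite ?mulr_ge0 //.
  exact: le_trans h1 h.
have hc := @class_bound b N G D 1 e i l s t w b0 isT u hD w0 hr.
apply: atmost_sub hc => P [hP _]; split => //.
exact: class_close hP u.
Qed.

(** For [Dd = 1] every configuration has a small product. *)
Lemma atmost_cfg b N G D : (0 < b)%N ->
  (forall n, 0 < n -> n <= N -> size (divisors n) <= D)%N ->
  atmost (fun P => cfg b N P /\ forall k, (gcdv (P k) <= G)%N)
    (count_const G D * N%:R * (2 * N%:R / b%:R)).
Proof.
move=> b0 hD; have := @atmost_cfg_small b N G D 1 b0 isT hD; rewrite mulr1.
apply: atmost_sub => P [hP hg]; split=> //; split=> //.
have [i [l [s [t [u _ _ _]]]]] := @minimal_max_labels (fun _ _ => 0%N) (fun _ _ _ => erefl).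
by exists i, l, s, t; split => //; rewrite muln1 mulnC; exact: cfg_opposite.
Qed.

End U2.

(** * The gains from a small mixed product and from a large gcd *)

Section U3.
Variable R : realFieldType.
Implicit Types (P : {ffun 'I_4 -> vec}).

(** A mixed product of [P i] and [P l] is smaller, by a factor [D2], than its bound in terms of the
    opposite determinant. The index [i] is minimal because the count of a class starts from such an
    index. *)
Definition close_min b N D2 (P : 'I_4 -> vec) : Prop :=
  exists i l s t, [/\ uniq [:: i; l; s; t], minimal_index (cfg_exp b P) i &
    close_pair (N %/ (2 ^ cfg_exp b P s t * D2)) (P i) (P l)].

(** The close pair prescribes [l], so [2 ^ 8] accounts for the labelling. The products of opposite
    pairs lie between [N / (2 b Dd ^ 2)] and [2 N / b], whence [w = 8 N Dd ^ 2 / b]: a loss of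
    [Dd ^ 2] against the gain [D2]. *)
Lemma atmost_cfg_close b N G D Dd D2 : (0 < b)%N -> (0 < Dd)%N -> (0 < D2)%N ->
  (forall n, 0 < n -> n <= N -> size (divisors n) <= D)%N ->
  atmost (fun P => cfg b N P /\ (forall k, (gcdv (P k) <= G)%N) /\
      (~ small_prod b N Dd P /\ close_min b N D2 P))
    (count_const R G D * (2 ^+ 8 * (N%:R / D2%:R) * (8 * N%:R * Dd%:R ^+ 2 / b%:R))).
Proof.
move=> b0 Dd0 D20 hD.
have b1 : 0 < b%:R :> R by rewrite ltr0n.
have Dd1 : 0 < Dd%:R :> R by rewrite ltr0n.
have D21 : 0 < D2%:R :> R by rewrite ltr0n.
pose w : R := 8 * N%:R * Dd%:R ^+ 2 / b%:R.
have w0 : 0 <= w by rewrite /w divr_ge0 // !mulr_ge0 // exprn_ge0.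
pose B : R := 480 * 32 ^+ 2 * D%:R ^+ 2 * G%:R ^+ 2 * (N%:R / D2%:R) * w.
have B0 : 0 <= B.
  by rewrite /B; do ![apply: mulr_ge0 => // | apply: exprn_ge0 => // | rewrite invr_ge0 //].
rewrite (_ : count_const R G D * _ = D%:R ^+ 16 * (2 ^+ 8 * B)); last first.
  by rewrite /count_const /B /w; field; rewrite !gt_eqF.
apply: (@atmost_classes R b N G D (fun P : 'I_4 -> vec => ~ small_prod b N Dd P /\ close_min b N D2 P)) => // [|e].
  by rewrite mulr_ge0 ?exprn_ge0.
pose T := ('I_4 * 'I_4 * 'I_4 * 'I_4)%type.
have -> : 2 ^+ 8 = (size (enum (T : finType)))%:R :> R.
  by rewrite -cardE !card_prod !card_ord -natrX.
apply: (@atmost_exists R _ _ _ (fun x : T => x \in enum (T : finType))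
  (fun x P => [/\ uniq [:: x.1.1.1; x.1.1.2; x.1.2; x.2], minimal_index e x.1.1.1,
     in_class b N G e P, ~ small_prod b N Dd P & close_pair (N %/ (2 ^ e x.1.2 x.2 * D2)) (P x.1.1.1) (P x.1.1.2)])) => //.
- move=> P [hP [hs [i [l [s [t [u hi hc]]]]]]]; exists (i, l, s, t); first by rewrite mem_enum.
  have [_ _ he] := hP; have [_ _ _ _ [_ n2]] := uniq4_neq u.
  split => //=; last by rewrite -he.
  move=> l' s' t' u'; have [m1 m2 _ _ [m3 m4]] := uniq4_neq u'.
  by rewrite -!he //; exact: hi.
- exact: (@atmost_seq R _ (enum (T : finType))).
move=> [[[i l] s] t] _ /=.
have [[P0 [u hi hP0 hs0 hc0]]|none] := pselect (exists P, [/\ uniq [:: i; l; s; t], minimal_index e i,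
     in_class b N G e P, ~ small_prod b N Dd P & close_pair (N %/ (2 ^ e s t * D2)) (P i) (P l)]); last first.
  by apply: atmost0 => // P hP; apply: none; exists P.
have esym i' l' : i' != l' -> e i' l' = e l' i' by exact: class_exp_sym hP0.
have [h14 h13] := minimal_index_pow R u hi esym.
(* A dyadic size may be as small as half the determinant; for two of them this loses a factor 4. *)
have hm i' l' s' t' : uniq [:: i'; l'; s'; t'] -> N%:R / (2 * b%:R * Dd%:R ^+ 2) <= 2 ^+ e i' l' * 2 ^+ e s' t' :> R.
  move=> u'; have [n1 _ _ _ [_ n2]] := uniq4_neq u'.
  have h : (2 * N <= `|ndet b (P0 i') (P0 l')| * `|ndet b (P0 s') (P0 t')| * b * Dd ^ 2)%N.
    by rewrite leqNgt; apply/negP => h; apply: hs0; exists i', l', s', t'; split => //; exact: ltnW.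
  have /andP[_ k1] := class_exp hP0 n1; have /andP[_ k2] := class_exp hP0 n2.
  have k := leq_mul (ltnW k1) (ltnW k2).
  have {h}h : (2 * N <= 2 ^ (e i' l').+1 * 2 ^ (e s' t').+1 * (b * Dd ^ 2))%N.
    by apply: leq_trans h _; rewrite -mulnA leq_mul2r k orbT.
  rewrite ler_pdivrMr ?mulr_gt0 ?exprn_gt0 // -!natrX -!natrM ler_nat.
  by rewrite -(leq_pmul2l (_ : 0 < 2)%N) //; apply: leq_trans h _; rewrite !expnS; apply: eq_leq; ring.
have hM i' l' s' t' : uniq [:: i'; l'; s'; t'] -> 2 ^+ e i' l' * 2 ^+ e s' t' <= 2 * N%:R / b%:R :> R.
  exact: class_prod_le hP0.
have [u1 u2 u3 u4 [u5 u6 u7 u8 u9]] := uniq4_perm u.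
have [n1 n2 n3 n4 [n5 n6]] := uniq4_neq u.
have N0 : 0 < N%:R :> R.
  rewrite ltr0n lt0n; apply/eqP => Nz; have := hM _ _ _ _ u; rewrite Nz mulr0 mul0r.
  by apply/negP; rewrite -ltNge mulr_gt0 // exprn_gt0.
have hr : class_rule (2 ^+ e i l) (2 ^+ e i s) (2 ^+ e i t) (2 ^+ e l s) (2 ^+ e l t) (2 ^+ e s t) w.
  apply: (@class_rule_flat R (N%:R / (2 * b%:R * Dd%:R ^+ 2)) (2 * N%:R / b%:R)) => //; rewrite ?expr2_ge1 //.
  - by rewrite divr_gt0 // mulr_gt0 ?exprn_gt0 // mulr_gt0.
  - exact: hm.
  - exact: hM.
  - exact: hM.
  - exact: le_trans (hm _ _ _ _ u) (hM _ _ _ _ u).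
  by rewrite /w; field; rewrite !gt_eqF.
have hc := @class_bound R b N G D D2 e i l s t w b0 D20 u hD w0 hr.
by apply: atmost_sub hc => P [].
Qed.

Definition divv (v : vec) (g : nat) : vec := ((v.1 %/ g%:Z)%Z, (v.2 %/ g%:Z)%Z).

Lemma divvK v : v = ((divv v (gcdv v)).1 * (gcdv v)%:Z, (divv v (gcdv v)).2 * (gcdv v)%:Z).
Proof.
case: v => x y; rewrite /divv /gcdv /= /gcdz /=.
by rewrite !divzK // dvdzE /= ?dvdn_gcdl ?dvdn_gcdr.
Qed.

Lemma gcdv_gt0 v : v.1 != 0 -> (0 < gcdv v)%N.
Proof. by move=> v0; rewrite /gcdv absz_gt0 gcdz_eq0 negb_and v0. Qed.

Lemma gcdvM x y (g : nat) : gcdv (x * g%:Z, y * g%:Z) = (gcdv (x, y) * g)%N.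
Proof. by rewrite /gcdv /gcdz /= !abszM /= muln_gcdl. Qed.

Lemma gcdv_divv v : v.1 != 0 -> gcdv (divv v (gcdv v)) = 1%N.
Proof.
move=> v0; have g0 := gcdv_gt0 v0; apply/eqP; rewrite -(eqn_pmul2r g0) mul1n.
by rewrite [divv v _]surjective_pairing -gcdvM -divvK.
Qed.

(** A determinant loses the gcds of its two vectors and the complementary mixed product those of the
    other two, so [N] is divided by the product of all four. *)
Lemma cfg_divv b N M (P : 'I_4 -> vec) : (0 < b)%N -> (0 < M)%N -> cfg b N P ->
  (M <= \prod_k gcdv (P k))%N -> cfg b (N %/ M) (fun k => divv (P k) (gcdv (P k))).
Proof.
move=> b0 M0 hP hM; have [h1 h2] := hP.
have g0 k : (0 < gcdv (P k))%N by apply: gcdv_gt0; have [] := h1 k.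
have e1 k : (P k).1 = (divv (P k) (gcdv (P k))).1 * (gcdv (P k))%:Z by rewrite {1}(divvK (P k)).
have e2 k : (P k).2 = (divv (P k) (gcdv (P k))).2 * (gcdv (P k))%:Z by rewrite {1}(divvK (P k)).
have cg k : coprimez (gcdv (P k))%:Z b%:Z.
  have [_ _ c _] := h1 k; move: c; rewrite e1 coprimezMl => /andP[_ //].
split=> [k|i l s t u].
  have [a c d e] := h1 k; move: a c d e; rewrite e1 e2 !mulf_eq0 !negb_or !coprimezMl.
  by move=> /andP[? _] /andP[? _] /andP[? _] /andP[? _]; split.
have [il _ _ _ [_ st]] := uniq4_neq u; have [d d0 _] := h2 _ _ _ _ u.
set Q := fun k => divv (P k) (gcdv (P k)).
have ed : det2 (P i) (P l) = det2 (Q i) (Q l) * ((gcdv (P i))%:Z * (gcdv (P l))%:Z).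
  by rewrite /det2 !e1 !e2 -/(Q i) -/(Q l); ring.
have dQ : (b%:Z %| det2 (Q i) (Q l))%Z.
  by move: d; rewrite ed Gauss_dvdzl // coprimez_sym coprimezMl !cg.
split => //; first by move: d0; rewrite ed mulf_eq0 negb_or => /andP[].
have := cfg_ndet_le b0 hP u.
have -> : ndet b (P i) (P l) = ndet b (Q i) (Q l) * ((gcdv (P i))%:Z * (gcdv (P l))%:Z).
  have b1 : b%:Z != 0 by rewrite eqz_nat -lt0n.
  apply: (mulIf b1); rewrite divzK // ed -{1}(divzK dQ) /ndet; ring.
rewrite (e1 s) (e2 t) -/(Q s) -/(Q t) !abszM /= => h.
have eQ : det2 (Q i) (Q l) = ndet b (Q i) (Q l) * b%:Z by rewrite divzK.
rewrite eQ abszM /= [(_ * b)%N]mulnC -mulnA leq_pmul2l // leq_divRL //.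
apply: leq_trans h; apply: leq_trans (leq_mul (leqnn _) hM) _.
have -> : (\prod_k gcdv (P k) = gcdv (P i) * gcdv (P l) * gcdv (P s) * gcdv (P t))%N.
  rewrite (perm_big [:: i; l; s; t]).
    by rewrite !big_cons big_nil /=; ring.
  apply: uniq_perm => //; first exact: index_enum_uniq.
  by move=> k; rewrite mem_index_enum (uniq4P u).
by apply: eq_leq; ring.
Qed.

Lemma atmost_dyadic k : atmost (fun n : nat => (2 ^ k <= n < 2 ^ k.+1)%N) (2 ^+ k : R).
Proof.
rewrite -natrX; apply: (atmost_inj (f := fun n => n - 2 ^ k)%N) (@atmost_nat R _).
  by move=> n; rewrite expnS; lia.
by move=> n m; lia.
Qed.

Lemma atmost_dyadic4 (kk : 'I_4 -> nat) :
  atmost (fun g : {ffun 'I_4 -> nat} => forall k, (2 ^ kk k <= g k < 2 ^ (kk k).+1)%N)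
    (\prod_k 2 ^+ kk k : R).
Proof.
rewrite prod_ord4.
pose S k n := (2 ^ kk k <= n < 2 ^ (kk k).+1)%N.
have u : uniq ([:: 0; 1; 2%:R; 3%:R] : seq 'I_4) by [].
apply: (@atmost_inj R _ _ _ (fun x : nat * nat * nat * nat => ((S 0 x.1.1.1 /\ S 1 x.1.1.2) /\ S 2%:R x.1.2) /\ S 3%:R x.2)
  (fun g : {ffun 'I_4 -> nat} => (g 0, g 1, g 2%:R, g 3%:R))).
- by move=> g hg; split; [split; [split|]|]; apply: hg.
- by move=> g h _ _ [e0 e1 e2 e3]; apply: (eq_ffun4 u).
have p k : 0 <= 2 ^+ kk k :> R by rewrite exprn_ge0.
apply: (@atmost_pair R _ _ (fun x : nat * nat * nat => (S 0 x.1.1 /\ S 1 x.1.2) /\ S 2%:R x.2) (fun _ n => S 3%:R n)) => //; last first.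
  by move=> _ _; exact: atmost_dyadic.
apply: (@atmost_pair R _ _ (fun x : nat * nat => S 0 x.1 /\ S 1 x.2) (fun _ n => S 2%:R n)) => //; last first.
  by move=> _ _; exact: atmost_dyadic.
apply: (@atmost_pair R _ _ (fun x : nat => S 0 x) (fun _ n => S 1 n)) => //; last first.
  by move=> _ _; exact: atmost_dyadic.
exact: atmost_dyadic.
Qed.

(** For gcds of given dyadic sizes with product [M] there are at most [M] quadruples of gcds and, up
    to constants and powers of [D], [(N / M) ^ 2 / b] reduced configurations. One gcd exceeds [G],
    so [M] is at least [G / 2]; the sizes cost [D ^ 4]. *)
Lemma atmost_cfg_gcd b N G D : (0 < b)%N -> (0 < G)%N ->
  (forall n, 0 < n -> n <= N -> size (divisors n) <= D)%N ->
  atmost (fun P => cfg b N P /\ exists k, (G < gcdv (P k))%N)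
    (D%:R ^+ 4 * (count_const R 1 D * N%:R * (4 * N%:R / (b%:R * G%:R)))).
Proof.
move=> b0 G0 hD.
have b1 : 0 < b%:R :> R by rewrite ltr0n.
have G1 : 0 < G%:R :> R by rewrite ltr0n.
have C0 : 0 <= count_const R 1 D.
  by rewrite /count_const; do ![apply: mulr_ge0 => // | apply: exprn_ge0 => //].
have -> : D%:R ^+ 4 = (size (enum {ffun 'I_4 -> 'I_D}))%:R :> R.
  by rewrite -cardE card_ffun !card_ord natrX.
set B := _ * (_ / _).
have B0 : 0 <= B.
  by rewrite /B; do ![apply: mulr_ge0 => // | apply: exprn_ge0 => // | rewrite invr_ge0 //].
pose W (kk : {ffun 'I_4 -> 'I_D}) P := cfg b N P /\ (exists k, (G < gcdv (P k))%N) /\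
  forall k, (2 ^ kk k <= gcdv (P k) < 2 ^ (kk k).+1)%N.
apply: (@atmost_exists R _ _ _ (fun kk : {ffun 'I_4 -> 'I_D} => kk \in enum {ffun 'I_4 -> 'I_D}) W) => //.
- move=> P [hP hG].
  have g0 k : (0 < gcdv (P k))%N by apply: gcdv_gt0; have [] := hP.1 k.
  have bound k : (trunc_log 2 (gcdv (P k)) < D)%N.
    have [l lk] : exists l : 'I_4, l != k.
      by exists (if k == 0 then 1 else 0); case: (eqVneq k 0) => [->|] //; rewrite eq_sym.
    have [s [t u]] := uniq4_extend lk.
    have [u6 _ _ _ _] := uniq4_perm u.
    have h := cfg_ndet_le b0 hP u6.
    have [il _ _ _ _] := uniq4_neq u6; have [_ n0] := cfg_ndet hP il.
    have [p0 _ _ _] := hP.1 l; have [_ k0 _ _] := hP.1 k.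
    have gN : (gcdv (P k) <= N)%N.
      apply: leq_trans h; apply: leq_trans (_ : `|(P k).2| <= _)%N.
        by rewrite dvdn_leq ?absz_gt0 // /gcdv -dvdzE dvdz_gcdr.
      by rewrite mulnA leq_pmull // muln_gt0 !absz_gt0 n0 p0.
    have /andP[h1 _] := trunc_log_bounds (isT : (1 < 2)%N) (g0 k).
    have := hD (2 ^ trunc_log 2 (gcdv (P k)))%N; rewrite expn_gt0 => /(_ isT (leq_trans h1 gN)).
    exact/leq_trans/size_divisors_exp2.
  exists [ffun k => Ordinal (bound k)]; first by rewrite mem_enum.
  by split => //; split => // k; rewrite ffunE /=; apply: trunc_log_bounds.
- exact: (@atmost_seq R _ (enum {ffun 'I_4 -> 'I_D})).
move=> kk _; pose M := (\prod_k 2 ^ kk k)%N.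
have M0 : (0 < M)%N by rewrite prodn_gt0 // => k; rewrite expn_gt0.
have M1 : 0 < M%:R :> R by rewrite ltr0n.
have [GM|GM] := ltnP (2 * M) G.
  apply: atmost0 => // P [_ [[k hk] h]]; have /andP[_ h2] := h k.
  have : (2 ^ kk k <= M)%N.
    by rewrite /M (bigD1 k) //= leq_pmulr // prodn_gt0 // => j; rewrite expn_gt0.
  move=> hkM; move: h2 hk GM hkM; rewrite expnS; clearbody M; move: (gcdv _) (2 ^ _)%N; clear; lia.
apply: (@atmost_le _ _ _ (\prod_k 2 ^+ kk k * (count_const R 1 D * (N %/ M)%:R * (2 * (N %/ M)%:R / b%:R)))).
  have -> : \prod_k 2 ^+ kk k = M%:R :> R by rewrite natr_prod; apply: eq_bigr => k _; rewrite natrX.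
  have h : (N %/ M)%:R <= N%:R / M%:R :> R by rewrite ler_pdivlMr // -natrM ler_nat leq_trunc_div.
  have h0 : 0 <= (N %/ M)%:R :> R by [].
  have h2 := ler_pM h0 h0 h h.
  have h3 : G%:R <= 2 * M%:R :> R by rewrite -natrM ler_nat.
  apply: (@le_trans _ _ (count_const R 1 D * (2 * N%:R ^+ 2 / (b%:R * M%:R)))).
    have h4 : 0 <= M%:R * (count_const R 1 D * 2 / b%:R) by rewrite !mulr_ge0 ?invr_ge0.
    have := ler_wpM2l h4 h2.
    rewrite [X in X <= _ -> _](_ : _ = M%:R * (count_const R 1 D * (N %/ M)%:R * (2 * (N %/ M)%:R / b%:R))); last by ring.
    by rewrite [X in _ <= X -> _](_ : _ = count_const R 1 D * (2 * N%:R ^+ 2 / (b%:R * M%:R))) //; field; rewrite !gt_eqF.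
  rewrite /B -[X in _ <= X]mulrA ler_wpM2l //.
  have h5 : M%:R^-1 <= 2 / G%:R :> R.
    by rewrite -[X in X <= _]mul1r ler_pdivrMr // mulrAC ler_pdivlMr // mul1r.
  have h6 : 0 <= 2 * N%:R ^+ 2 / b%:R :> R by rewrite divr_ge0 // mulr_ge0 // exprn_ge0.
  have := ler_wpM2l h6 h5.
  rewrite [X in X <= _ -> _](_ : _ = 2 * N%:R ^+ 2 / (b%:R * M%:R)); last by field; rewrite !gt_eqF.
  by rewrite [X in _ <= X -> _](_ : _ = N%:R * (4 * N%:R / (b%:R * G%:R))) //; field; rewrite !gt_eqF.
apply: (atmost_fiber (f := fun P => [ffun k => gcdv (P k)])
  (Q := fun g : {ffun 'I_4 -> nat} => forall k, (2 ^ kk k <= g k < 2 ^ (kk k).+1)%N)).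
- by do ![apply: mulr_ge0 => // | rewrite invr_ge0 //].
- by move=> P [_ [_ h]] k; rewrite ffunE.
- exact: atmost_dyadic4.
move=> g hg.
have hD' n : (0 < n -> n <= N %/ M -> size (divisors n) <= D)%N.
  by move=> n0 hn; apply: hD => //; apply: leq_trans hn (leq_div _ _).
apply: (@atmost_inj R _ _ _ (fun Q : {ffun 'I_4 -> vec} => cfg b (N %/ M) Q /\ forall k, (gcdv (Q k) <= 1)%N)
   (fun P => [ffun k => divv (P k) (gcdv (P k))])).
- move=> P [[hP [_ h]] eg].
  have hM : (M <= \prod_k gcdv (P k))%N by apply: leq_prod => k _; have /andP[] := h k.
  have hc := cfg_divv b0 M0 hP hM.
  split; last by move=> k; rewrite ffunE gcdv_divv //; have [] := hP.1 k.
  have eF : [ffun k => divv (P k) (gcdv (P k))] = (fun k => divv (P k) (gcdv (P k))) :> ('I_4 -> vec).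
    by apply/funext => k; rewrite ffunE.
  by rewrite eF.
- move=> P P' [_ eg] [_ eg'] /ffunP eP; apply/ffunP => k.
  have eg2 : gcdv (P k) = gcdv (P' k).
    by move/ffunP/(_ k): eg; move/ffunP/(_ k): eg'; rewrite !ffunE => -> ->.
  have := eP k; rewrite !ffunE => ed.
  by apply: etrans (divvK _) _; apply: etrans _ (esym (divvK _)); rewrite ed eg2.
exact: atmost_cfg.
Qed.

End U3.

(** * Quadruples with a good split *)

Definition mulv (u w : vec) : vec := (u.1 * w.1, u.2 * w.2).
Definition area (v : vec) : nat := (`|v.1| * `|v.2|)%N.

Definition orient (k : 'I_4) (v : vec) : int := if (k == 1) || (k == 2%:R) then v.1 else v.2.
Definition orient' (k : 'I_4) (v : vec) : int := if (k == 1) || (k == 2%:R) then v.2 else v.1.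

(* For the part of a quadruple lying in one factor of a fourth pair, [orient] selects the
   coordinates refining [y 0 false]; the congruence is [y 0 false = y 3 c] modulo [b]
   after cancellation of the common part. *)
Definition balanced (b : nat) (u : 'I_4 -> vec) : Prop :=
  (b%:Z %| \prod_k orient k (u k) - \prod_k orient' k (u k))%Z.

(* [P j] is divided by the fourth pair into two parts of area at least g. *)
Definition good_split (b g z : nat) (P : 'I_4 -> vec) : Prop :=
  exists i l s j, exists u w : 'I_4 -> vec, uniq [:: i; l; s; j] /\
    [/\ forall k, P k = mulv (u k) (w k), balanced b u /\ balanced b w,
        (g <= area (u j))%N /\ (g <= area (w j))%N, (b * g <= area (P j))%N & (b <= z * area (P s))%N].

Section Split.
Variable R : realFieldType.
Implicit Types (P : {ffun 'I_4 -> vec}).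

Definition in_box (x : nat * nat) (v : vec) : Prop := lg v.1 = x.1 /\ lg v.2 = x.2.

Lemma area_box v x : v.1 != 0 -> v.2 != 0 -> in_box x v ->
  (2 ^ x.1 * 2 ^ x.2 <= area v)%N /\ (area v <= 4 * (2 ^ x.1 * 2 ^ x.2))%N.
Proof.
move=> v1 v2 [<- <-]; have /andP[a1 a2] := lg_bounds v1; have /andP[c1 c2] := lg_bounds v2.
split; first exact: leq_mul.
apply: leq_trans (leq_mul (ltnW a2) (ltnW c2)) _; rewrite !expnS; apply: eq_leq; ring.
Qed.

Lemma atmost_line_box (b : nat) (X Y : int) x G : (0 < b)%N -> coprimez X b%:Z ->
  atmost (fun v : vec => [/\ v.1 != 0, v.2 != 0, (gcdv v <= G)%N, (b%:Z %| v.1 * X - v.2 * Y)%Z & in_box x v])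
   (32 * G%:R * (1 + 2 ^+ x.1 * 2 ^+ x.2 / b%:R) : R).
Proof.
move=> b0 cX; apply: (@atmost_le _ _ _ (G%:R * 2 * (2 + 16 * (2 ^+ x.1 * 2 ^+ x.2) / b%:R))).
  rewrite -mulrA [2 + _](_ : _ = 2 * (1 + 8 * (2 ^+ x.1 * 2 ^+ x.2 / b%:R))); last by ring.
  have h1 : 0 <= 2 ^+ x.1 * 2 ^+ x.2 / b%:R :> R by rewrite !mulr_ge0 ?invr_ge0 ?exprn_ge0.
  move: (_ / _) h1 => r h1; have h2 : 0 <= G%:R :> R by [].
  have : G%:R * r >= 0 by apply: mulr_ge0.
  lra.
apply: (@atmost_line_mod R _ X Y) b0 cX _ => v [v1 v2 hg d [h1 h2]]; split => //.
  by rewrite -h1; have /andP[] := lg_bounds v1.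
by rewrite -h2; exact: lg_bounds.
Qed.

Lemma gcdv_mulv_le u w : u.1 != 0 -> w.1 != 0 -> u.2 != 0 -> w.2 != 0 ->
  (gcdv u <= gcdv (mulv u w))%N /\ (gcdv w <= gcdv (mulv u w))%N.
Proof.
move=> u1 w1 u2 w2; have g0 : (0 < gcdv (mulv u w))%N by apply: gcdv_gt0; rewrite mulf_neq0.
split; apply: dvdn_leq => //; rewrite /gcdv /gcdz /mulv /= !abszM dvdn_gcd.
  by rewrite !dvdn_mulr ?dvdn_gcdl ?dvdn_gcdr.
by rewrite !dvdn_mull ?dvdn_gcdl ?dvdn_gcdr.
Qed.

(** With all vectors but the one at [j] fixed, the balance condition is linear in the two
    coordinates of that vector. *)
Lemma orient_line (b : nat) (u : 'I_4 -> vec) j : balanced b u ->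
  exists X Y, (forall v : 'I_4 -> vec, (forall k, k != j -> v k = u k) -> balanced b v ->
     (b%:Z %| (v j).1 * X - (v j).2 * Y)%Z) /\
   ((forall k, unit_vec b (u k)) -> coprimez X b%:Z).
Proof.
move=> hu; pose A := \prod_(k | k != j) orient k (u k); pose B := \prod_(k | k != j) orient' k (u k).
pose sg := (j == 1) || (j == 2%:R).
exists (if sg then A else B), (if sg then B else A); split.
  move=> v hv; rewrite /balanced (bigD1 j) //= [X in _ - X](bigD1 j) //=.
  rewrite [X in orient j _ * X](eq_bigr (fun k => orient k (u k))); last by move=> k /hv->.
  rewrite [X in orient' j _ * X](eq_bigr (fun k => orient' k (u k))); last by move=> k /hv->.
  rewrite -/A -/B /orient /orient' -/sg; case: sg => //.
  by rewrite -opprB rpredN.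
move=> hk; have c F : (forall k, coprimez (F k) b%:Z) -> coprimez (\prod_(k | k != j) F k) b%:Z.
  move=> hF; apply: (big_ind (fun x => coprimez x b%:Z)) => //; first by rewrite /coprimez gcd1z.
  by move=> x y hx hy; rewrite coprimezMl hx.
by case: sg; apply: c => k; rewrite /orient /orient'; case: ifP => _; have [] := hk k.
Qed.

Lemma atmost_divv (v : vec) (N D : nat) : v.1 != 0 -> v.2 != 0 -> (`|v.1| <= N)%N -> (`|v.2| <= N)%N ->
  (forall n, 0 < n -> n <= N -> size (divisors n) <= D)%N ->
  atmost (fun u : vec => exists w, v = mulv u w) ((D%:R * 2) ^+ 2 : R).
Proof.
move=> v1 v2 l1 l2 hD.
have hd (x : int) : x != 0 -> (`|x| <= N)%N -> atmost (fun d : int => (d %| x)%Z) (D%:R * 2 : R).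
  move=> x0 hx; apply: atmost_le (atmost_divz R x0).
  by rewrite ler_pM2r // ler_nat; apply: hD; rewrite ?absz_gt0.
apply: (@atmost_sub _ _ _ (fun u : vec => (u.1 %| v.1)%Z /\ (fun _ x => (x %| v.2)%Z) u.1 u.2)).
  by move=> u [w ->] /=; rewrite !dvdz_mulr.
rewrite expr2; apply: (@atmost_pair R _ _ (fun u : int => (u %| v.1)%Z) (fun _ (x : int) => (x %| v.2)%Z)).
- by rewrite mulr_ge0.
- exact: hd.
by move=> _ _; exact: hd.
Qed.

Definition split_class b N G e g z s j (x y w : nat * nat) (P : 'I_4 -> vec) : Prop :=
  in_class b N G e P /\ exists u v : 'I_4 -> vec,
    [/\ forall k, P k = mulv (u k) (v k), balanced b u /\ balanced b v,
        (g <= area (u j))%N /\ (g <= area (v j))%N, (b * g <= area (P j))%N /\ (b <= z * area (P s))%N &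
        in_box x (P s) /\ (in_box y (u j) /\ in_box w (v j))].

(** After the pair [(P i, P l)], the vector [P s] lies in a lattice modulo [b] because of its
    determinant with [P i]. Once the splittings of these three vectors are fixed, the two balance
    conditions put the two parts of [P j] separately into lattices modulo [b]. *)
Lemma atmost_split_class b N G D e g z i l s j x y w : (0 < b)%N -> uniq [:: i; l; s; j] ->
  (forall n, 0 < n -> n <= N -> size (divisors n) <= D)%N ->
  atmost (fun P => split_class b N G e g z s j x y w P)
    ((120 * D%:R ^+ 2 * (N %/ (2 ^ e s j * 1))%:R * 2 ^+ e i l) * (32 * G%:R * (1 + 2 ^+ x.1 * 2 ^+ x.2 / b%:R)) *
     (((D%:R * 2) ^+ 2) ^+ 3 * ((32 * G%:R * (1 + 2 ^+ y.1 * 2 ^+ y.2 / b%:R)) *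
        (32 * G%:R * (1 + 2 ^+ w.1 * 2 ^+ w.2 / b%:R)))) : R).
Proof.
move=> b0 un hD; have [il is_ ij ls [lj sj]] := uniq4_neq un.
have [un1 un2 un3 un4 [un5 un6 un7 un8 un9]] := uniq4_perm un.
have L0 (y' : nat * nat) : 0 <= 32 * G%:R * (1 + 2 ^+ y'.1 * 2 ^+ y'.2 / b%:R) :> R.
  by rewrite !mulr_ge0 ?addr_ge0 ?mulr_ge0 ?invr_ge0 ?exprn_ge0.
set S := split_class b N G e g z s j x y w.
have dP (P : 'I_4 -> vec) k m : cfg b N P -> k != m -> (b%:Z %| det2 (P k) (P m))%Z.
  by move=> hP km; have [-> _] := cfg_ndet hP km; exact: dvdz_mulr.
apply: (atmost_fiber (f := fun P => (P i, P l, P s))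
  (Q := fun t : vec * vec * vec => exists2 P : {ffun 'I_4 -> vec}, S P & t = (P i, P l, P s))).
- by apply: mulr_ge0; [rewrite !exprn_ge0 ?mulr_ge0|apply: mulr_ge0].
- by move=> P hP; exists P.
- apply: (atmost_fiber (f := fst) (Q := fun u => exists2 P : {ffun 'I_4 -> vec},
      in_class b N G e P /\ close_pair (N %/ (2 ^ e s j * 1)) (P i) (P l) & u = (P i, P l))) => //.
  + move=> _ [P hP ->]; exists P => //; split; first by case: hP.
    by case: hP => hP _; exact: class_close hP un.
  + by apply: (@atmost_first_pairs R b N G _ D e i l s j).
  move=> _ [Q [hQ _] ->]; have [hQc _ _] := hQ.
  apply: (@atmost_inj R _ _ _ (fun v : vec => [/\ v.1 != 0, v.2 != 0, (gcdv v <= G)%N,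
      (b%:Z %| v.1 * (Q i).2 - v.2 * (Q i).1)%Z & in_box x v]) snd).
  + move=> _ [[P [hP [u [v [h1 h2 h3 h4 [h5 _]]]]] ->] /= [eP _]].
    have [hPc hg _] := hP; have [a1 a2 _ _] := hPc.1 s.
    split => //; rewrite -!eP -rpredN opprB; have := dP _ _ _ hPc is_; rewrite /det2.
    by congr (_ %| _)%Z; ring.
  + by move=> [u v] [u' v'] [_ /= ->] [_ /= ->] ->.
  by apply: atmost_line_box => //; have [] := hQc.1 i.
move=> _ [Q hQ ->].
have hQc : cfg b N Q by case: hQ => -[].
have hle k : (`|(Q k).1| <= N)%N /\ (`|(Q k).2| <= N)%N.
  have [m mk] : exists m : 'I_4, m != k.
    by exists (if k == 0 then 1 else 0); case: (eqVneq k 0) => [->|] //; rewrite eq_sym.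
  have [a [c uu]] := uniq4_extend mk.
  have [v1 v2 _ _ _] := uniq4_perm uu.
  have n0 : (0 < `|ndet b (Q a) (Q c)|)%N.
    have [nac _ _ _ _] := uniq4_neq v1; by rewrite absz_gt0; have [] := cfg_ndet hQc nac.
  have [m1 m2 _ _] := hQc.1 m.
  split.
    apply: leq_trans (cfg_ndet_le b0 hQc v2); rewrite mulnCA leq_pmulr // muln_gt0 n0 absz_gt0 m2 //.
  apply: leq_trans (cfg_ndet_le b0 hQc v1); rewrite mulnA leq_pmull // muln_gt0 n0 absz_gt0 m1 //.
have dk k : atmost (fun u : vec => exists w, Q k = mulv u w) ((D%:R * 2) ^+ 2 : R).
  by have [q1 q2 _ _] := hQc.1 k; have [h1 h2] := hle k; exact: (atmost_divv (N := N)).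
pose J (t : vec * vec * vec) := ((exists w, Q i = mulv t.1.1 w) /\ (exists w, Q l = mulv t.1.2 w)) /\ (exists w, Q s = mulv t.2 w).
have hJ : atmost J (((D%:R * 2) ^+ 2) ^+ 3 : R).
  have p0 : 0 <= (D%:R * 2) ^+ 2 :> R by rewrite exprn_ge0 // mulr_ge0.
  rewrite exprSr expr2.
  apply: (@atmost_pair R _ _ (fun t : vec * vec => (exists w, Q i = mulv t.1 w) /\ (exists w, Q l = mulv t.2 w)) (fun _ t => exists w, Q s = mulv t w)) => //.
  by apply: (@atmost_pair R _ _ (fun t : vec => (exists w, Q i = mulv t w)) (fun _ t => exists w, Q l = mulv t w)).
apply: (@atmost_exists R _ _ _ J (fun t P => [/\ P i = Q i, P l = Q l, P s = Q s &
  in_class b N G e P /\ exists u v : 'I_4 -> vec,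
    [/\ forall k, P k = mulv (u k) (v k), balanced b u /\ balanced b v,
      t = (u i, u l, u s) & in_box y (u j) /\ in_box w (v j)]])) => //.
- by rewrite mulr_ge0.
- move=> P [[hP [u [v [h1 h2 h3 h4 [h5 h6]]]]] [eI eL eS]].
  exists (u i, u l, u s).
    by split; [split|]; [exists (v i)|exists (v l)|exists (v s)]; rewrite -?eI -?eL -?eS /=.
  by split => //; split => //; exists u, v.
move=> t ht.
(* A fixed member [P0] supplies the two lattices; all the others share its parts at [i], [l] and
   [s]. *)
have [[P0 [eI0 eL0 eS0 [hP0 [u0 [v0 [hm0 [bu0 bv0] et0 _]]]]]]|none] := pselect (exists P, [/\ P i = Q i, P l = Q l, P s = Q s &
  in_class b N G e P /\ exists u v : 'I_4 -> vec,
    [/\ forall k, P k = mulv (u k) (v k), balanced b u /\ balanced b v,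
      t = (u i, u l, u s) & in_box y (u j) /\ in_box w (v j)]]); last first.
  by apply: atmost0; [rewrite mulr_ge0|move=> P hP; apply: none; exists P].
have units (P : 'I_4 -> vec) (u v : 'I_4 -> vec) : cfg b N P -> (forall k, P k = mulv (u k) (v k)) ->
   forall k, unit_vec b (u k) /\ unit_vec b (v k).
  move=> hP hm k; have := hP.1 k; rewrite hm /mulv; case=> /=.
  rewrite !mulf_eq0 !negb_or !coprimezMl.
  by move=> /andP[? ?] /andP[? ?] /andP[? ?] /andP[? ?].
have hc0 : cfg b N P0 by case: hP0.
have [Xu [Yu [hXu cXu]]] := orient_line j bu0.
have [Xv [Yv [hXv cXv]]] := orient_line j bv0.
have {}cXu := cXu (fun k => (units _ _ _ hc0 hm0 k).1).
have {}cXv := cXv (fun k => (units _ _ _ hc0 hm0 k).2).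
pose line X Y y' := fun v : vec => [/\ v.1 != 0, v.2 != 0, (gcdv v <= G)%N, (b%:Z %| v.1 * X - v.2 * Y)%Z & in_box y' v].
rewrite -[X in atmost _ X]mulr1.
apply: (@atmost_exists R _ _ _ (fun r : vec * vec => line Xu Yu y r.1 /\ (fun _ => line Xv Yv w) r.1 r.2)
  (fun r P => [/\ P i = Q i, P l = Q l, P s = Q s & P j = mulv r.1 r.2])) => //; last 2 first.
- apply: (@atmost_pair R _ _ (line Xu Yu y) (fun _ => line Xv Yv w)) => //; first exact: atmost_line_box.
  by move=> _ _; exact: atmost_line_box.
- move=> r _; apply: atmost_uniq => P P' [e1 e2 e3 e4] [e1' e2' e3' e4'].
  by apply: (eq_ffun4 un); rewrite ?e1 ?e2 ?e3 ?e4 ?e1' ?e2' ?e3' ?e4'.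
move=> P [eI eL eS [hP [u [v [hm [bu bv] et [by_ bw]]]]]].
have hc : cfg b N P by case: hP.
exists (u j, v j); last by split.
have eu k : k != j -> u k = u0 k.
  move: et; rewrite et0 => -[e1 e2 e3] kj; have := uniq4P un k.
  by rewrite !inE (negPf kj) orbF => /or3P[]/eqP->.
have ev k : k != j -> v k = v0 k.
  move=> kj; have [[a1 a2 _ _] _] := units _ _ _ hc hm k.
  have eP : P k = P0 k.
    have := uniq4P un k; rewrite !inE (negPf kj) orbF => /or3P[]/eqP->; by rewrite ?eI ?eI0 ?eL ?eL0 ?eS ?eS0.
  have := hm k; rewrite eP hm0 -eu // /mulv => -[/(mulfI a1) e1 /(mulfI a2) e2].
  by rewrite (surjective_pairing (v k)) (surjective_pairing (v0 k)) e1 e2.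
have [[a1 a2 _ _] [c1 c2 _ _]] := units _ _ _ hc hm j.
have [g1 g2] := gcdv_mulv_le a1 c1 a2 c2.
have gG : (gcdv (P j) <= G)%N by case: hP.
split; split => //; rewrite ?(hXu _ eu) ?(hXv _ ev) //.
  by apply: leq_trans g1 _; rewrite -hm.
by apply: leq_trans g2 _; rewrite -hm.
Qed.

End Split.

Section Split.
Variable R : realFieldType.
Implicit Types (P : {ffun 'I_4 -> vec}).

(** [x], [y], [w] are the areas of [P s] and of the parts of [P j]; [E], [E'] are opposite
    determinants. The lower bounds replace [1 + x / b] by [z x / b] and the other two factors by
    [y w / (b g)], up to constants; then [x y w E ^ 2 <= N ^ 2] and [N <= 2 b Dd ^ 2 E E'] eliminate
    the areas. *)
Lemma split_arith (b g z Dd N X E E' x y w : R) :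
  0 < E -> 0 < E' -> 0 < x -> 0 < y -> 0 < w -> 0 <= X -> 0 <= N -> 1 <= z -> 1 <= g -> g <= b ->
  X * E' <= N -> b <= 4 * z * x -> g <= 4 * y -> g <= 4 * w -> b * g <= 16 * (y * w) ->
  x * (y * w) * E ^+ 2 <= N ^+ 2 -> N <= 2 * b * Dd ^+ 2 * (E * E') ->
  X * E * ((1 + x / b) * ((1 + y / b) * (1 + w / b))) <= 250 * z * Dd ^+ 2 * N ^+ 2 / (b * g).
Proof.
move=> E0 E'0 x0 y0 w0 X0 N0 z1 g1 gb hX hx hy hw hyw hN hD.
have g0 : 0 < g by lra.
have b0 : 0 < b by lra.
have z0 : 0 < z by lra.
have k1 : 1 + x / b <= 5 * z * x / b.
  rewrite ler_pdivlMr // mulrDl mul1r divfK ?gt_eqF //.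
  have : x <= z * x by rewrite ler_peMl // ltW.
  lra.
(* [25 = 16 + 4 + 4 + 1], one summand for each term of the expanded product. *)
have k2 : (1 + y / b) * (1 + w / b) <= 25 * (y * w) / (b * g).
  have e : (1 + y / b) * (1 + w / b) = (b ^+ 2 + b * y + b * w + y * w) / b ^+ 2 by field; rewrite gt_eqF.
  rewrite e ler_pdivrMr ?exprn_gt0 //.
  have -> : 25 * (y * w) / (b * g) * b ^+ 2 = 25 * (y * w) * b / g by field; rewrite !gt_eqF.
  rewrite ler_pdivlMr //.
  have h1 := ler_wpM2l (ltW b0) hyw.
  have h2 : b * y * g <= b * y * (4 * w) by rewrite ler_wpM2l // mulr_ge0 // ltW.
  have h3 : b * w * g <= b * w * (4 * y) by rewrite ler_wpM2l // mulr_ge0 // ltW.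
  have h4 : y * w * g <= y * w * b by rewrite ler_wpM2l // mulr_ge0 // ltW.
  lra.
have xb : 0 <= 1 + x / b by rewrite addr_ge0 // divr_ge0 // ltW.
have ywb : 0 <= (1 + y / b) * (1 + w / b) by rewrite mulr_ge0 // addr_ge0 // divr_ge0 // ltW.
have k3 := ler_pM xb ywb k1 k2.
have XE : 0 <= X * E by rewrite mulr_ge0 // ltW.
apply: le_trans (ler_wpM2l XE k3) _.
have -> : X * E * (5 * z * x / b * (25 * (y * w) / (b * g))) = (125 * z / (b ^+ 2 * g)) * (X * E * (x * (y * w))).
  by field; rewrite !gt_eqF.
have -> : 250 * z * Dd ^+ 2 * N ^+ 2 / (b * g) = (125 * z / (b ^+ 2 * g)) * (N ^+ 2 * (2 * b * Dd ^+ 2)).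
  by field; rewrite !gt_eqF.
rewrite ler_wpM2l //.
  by apply: divr_ge0; [|apply: mulr_ge0; [exact: sqr_ge0|]]; [rewrite mulr_ge0 // ltW|exact: ltW].
have EE : 0 < E * E' by rewrite mulr_gt0.
rewrite -(ler_pM2r EE).
have h0 : 0 <= x * (y * w) * E ^+ 2 by rewrite !mulr_ge0 ?sqr_ge0 // ltW.
have h1 := ler_pM (mulr_ge0 X0 (ltW E'0)) h0 hX hN.
have h2 := ler_wpM2l (sqr_ge0 N) hD.
apply: (@le_trans _ _ (N * N ^+ 2)); last by lra.
by apply: le_trans h1; rewrite le_eqVlt; apply/orP; left; apply/eqP; ring.
Qed.

(** [D ^ 30] collects 16 for the exponents, 6 for the boxes, 2 for the first pair and 6 for the
    splittings of three vectors; [2 ^ 14] is [2 ^ 8] for the labelling times [2 ^ 6] for the signs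
    of the divisors. *)
Definition split_const (G D Dd z : nat) : R :=
  120 * 2 ^+ 14 * 32 ^+ 3 * 250 * D%:R ^+ 30 * G%:R ^+ 3 * z%:R * Dd%:R ^+ 2.

Lemma area_le (b N : nat) (P : 'I_4 -> vec) i l s j : (0 < b)%N -> cfg b N P -> uniq [:: i; l; s; j] ->
  (area (P s) * area (P j) * `|ndet b (P i) (P l)| ^ 2 <= N ^ 2)%N.
Proof.
move=> b0 hP u; have [_ _ _ _ [_ u2 _ _ _]] := uniq4_perm u.
have h1 := cfg_ndet_le b0 hP u; have h2 := cfg_ndet_le b0 hP u2.
rewrite -[(N ^ 2)%N]mulnn; apply: leq_trans (leq_mul h1 h2); rewrite /area -mulnn; apply: eq_leq; ring.
Qed.

Lemma atmost_good_split b N G D Dd g z : (0 < g)%N -> (g <= b)%N -> (0 < z)%N -> (0 < Dd)%N ->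
  (forall n, 0 < n -> n <= N -> size (divisors n) <= D)%N ->
  atmost (fun P => cfg b N P /\ (forall k, (gcdv (P k) <= G)%N) /\
      (~ small_prod b N Dd P /\ good_split b g z P))
    (split_const G D Dd z * N%:R ^+ 2 / (b%:R * g%:R)).
Proof.
move=> g0 gb z0 Dd0 hD; have b0 := leq_trans g0 gb.
have b1 : 0 < b%:R :> R by rewrite ltr0n.
have g1 : 0 < g%:R :> R by rewrite ltr0n.
pose B : R := 120 * 2 ^+ 6 * 32 ^+ 3 * D%:R ^+ 8 * G%:R ^+ 3 * (250 * z%:R * Dd%:R ^+ 2 * N%:R ^+ 2 / (b%:R * g%:R)).
have B0 : 0 <= B.
  by rewrite /B; do ![apply: mulr_ge0 => // | apply: exprn_ge0 => // | rewrite invr_ge0 //].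
have -> : split_const G D Dd z * N%:R ^+ 2 / (b%:R * g%:R) = D%:R ^+ 16 * ((2 ^+ 8 * D%:R ^+ 6) * B).
  by rewrite /split_const /B; field; rewrite !gt_eqF.
apply: (@atmost_classes R b N G D (fun P : 'I_4 -> vec => ~ small_prod b N Dd P /\ good_split b g z P)) => // [|e].
  by do ![apply: mulr_ge0 => // | apply: exprn_ge0 => //].
pose T := ('I_4 * 'I_4 * 'I_4 * 'I_4 * ('I_D * 'I_D * ('I_D * 'I_D) * ('I_D * 'I_D)))%type.
have -> : 2 ^+ 8 * D%:R ^+ 6 = (size (enum (T : finType)))%:R :> R.
  by rewrite -cardE !card_prod !card_ord -!natrX -natrM; congr (_%:R); ring.
pose nn (x : 'I_D * 'I_D) : nat * nat := (nat_of_ord x.1, nat_of_ord x.2).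
apply: (@atmost_exists R _ _ _ (fun x : T => x \in enum (T : finType))
  (fun x P => uniq [:: x.1.1.1.1; x.1.1.1.2; x.1.1.2; x.1.2] /\ ~ small_prod b N Dd P /\
     split_class b N G e g z x.1.1.2 x.1.2 (nn x.2.1.1) (nn x.2.1.2) (nn x.2.2) P)) => //.
- move=> P [hP [hs [i [l [s [j [u [v [un [hm hb hg hj hz]]]]]]]]]]; have [hc _ _] := hP.
  have dle k : (`|(P k).1| <= N)%N /\ (`|(P k).2| <= N)%N.
    have [m mk] : exists m : 'I_4, m != k.
      by exists (if k == 0 then 1 else 0); case: (eqVneq k 0) => [->|] //; rewrite eq_sym.
    have [a [c uu]] := uniq4_extend mk.
    have [v1 v2 _ _ _] := uniq4_perm uu.
    have n0 : (0 < `|ndet b (P a) (P c)|)%N.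
      have [nac _ _ _ _] := uniq4_neq v1; by rewrite absz_gt0; have [] := cfg_ndet hc nac.
    have [m1 m2 _ _] := hc.1 m.
    split.
      apply: leq_trans (cfg_ndet_le b0 hc v2); rewrite mulnCA leq_pmulr // muln_gt0 n0 absz_gt0 m2 //.
    apply: leq_trans (cfg_ndet_le b0 hc v1); rewrite mulnA leq_pmull // muln_gt0 n0 absz_gt0 m1 //.
  have nz k : [/\ (u k).1 != 0, (v k).1 != 0, (u k).2 != 0 & (v k).2 != 0].
    by have := hc.1 k; rewrite hm /mulv; case=> /=; rewrite !mulf_eq0 !negb_or => /andP[-> ->] /andP[-> ->].
  have lgD (x : int) : x != 0 -> (`|x| <= N)%N -> (lg x < D)%N.
    move=> x0 xN; have /andP[h1 _] := lg_bounds x0.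
    have := hD (2 ^ lg x)%N; rewrite expn_gt0 => /(_ isT (leq_trans h1 xN)).
    exact/leq_trans/size_divisors_exp2.
  have [s1 s2 _ _] := hc.1 s; have [ls1 ls2] := dle s; have [lj1 lj2] := dle j.
  have [nu1 nv1 nu2 nv2] := nz j.
  have [a1 a2 a3 a4] : [/\ (`|(u j).1| <= N)%N, (`|(v j).1| <= N)%N, (`|(u j).2| <= N)%N & (`|(v j).2| <= N)%N].
    move: lj1 lj2; rewrite hm /mulv !abszM => lj1 lj2; split.
    - by apply: leq_trans lj1; rewrite leq_pmulr // absz_gt0.
    - by apply: leq_trans lj1; rewrite leq_pmull // absz_gt0.
    - by apply: leq_trans lj2; rewrite leq_pmulr // absz_gt0.
    - by apply: leq_trans lj2; rewrite leq_pmull // absz_gt0.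
  exists (i, l, s, j, ((Ordinal (lgD _ s1 ls1), Ordinal (lgD _ s2 ls2)), (Ordinal (lgD _ nu1 a1), Ordinal (lgD _ nu2 a3)), (Ordinal (lgD _ nv1 a2), Ordinal (lgD _ nv2 a4)))).
    by rewrite mem_enum.
  split => //; split => //; split => //; exists u, v; split => //.
- exact: (@atmost_seq R _ (enum (T : finType))).
move=> [[[[i l] s] j] [[x y] w]] _ /=.
move: (nn x) (nn y) (nn w) => {}x {}y {}w.
have [[P0 [un [hs0 hP0]]]|none] := pselect (exists P, uniq [:: i; l; s; j] /\ ~ small_prod b N Dd P /\
     split_class b N G e g z s j x y w P); last first.
  by apply: atmost0 => // P hP; apply: none; exists P.
have H := @atmost_split_class R b N G D e g z i l s j x y w b0 un hD.
suff H2 : atmost (fun P => split_class b N G e g z s j x y w P) B.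
  by apply: atmost_sub H2 => P [_ []].
apply: atmost_le H.
have [hc0 [u [v [hm _ [hgu hgv] [hbj hbs] [hx [hy hw]]]]]] := hP0; have [hc _ _] := hc0.
have nz k : [/\ (u k).1 != 0, (v k).1 != 0, (u k).2 != 0 & (v k).2 != 0].
  by have := hc.1 k; rewrite hm /mulv; case=> /=; rewrite !mulf_eq0 !negb_or => /andP[-> ->] /andP[-> ->].
have [nu1 nv1 nu2 nv2] := nz j; have [s1 s2 _ _] := hc.1 s.
have [x1 x2] := area_box s1 s2 hx; have [y1 y2] := area_box nu1 nu2 hy; have [w1 w2] := area_box nv1 nv2 hw.
have aj : area (P0 j) = (area (u j) * area (v j))%N by rewrite hm /mulv /area /= !abszM; ring.
have [il _ _ _ [_ sj]] := uniq4_neq un.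
have /andP[e1 _] := class_exp hc0 il; have /andP[_ e2] := class_exp hc0 sj; have /andP[_ e3] := class_exp hc0 il.
pose X := (N %/ (2 ^ e s j * 1))%N.
have F : X%:R * 2 ^+ e i l * ((1 + 2 ^+ x.1 * 2 ^+ x.2 / b%:R) * ((1 + 2 ^+ y.1 * 2 ^+ y.2 / b%:R) * (1 + 2 ^+ w.1 * 2 ^+ w.2 / b%:R)))
   <= 250 * z%:R * Dd%:R ^+ 2 * N%:R ^+ 2 / (b%:R * g%:R) :> R.
  apply: (@split_arith _ _ _ _ _ _ _ (2 ^+ e s j)); rewrite ?mulr_gt0 ?exprn_gt0 ?ler1n ?ler_nat //.
  - by rewrite -natrX -natrM ler_nat /X muln1 leq_trunc_div.
  - rewrite -!natrX -!natrM ler_nat; apply: leq_trans hbs _.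
    by apply: leq_trans (leq_mul (leqnn z) x2) _; apply: eq_leq; ring.
  - by rewrite -!natrX -!natrM ler_nat; apply: leq_trans hgu _.
  - by rewrite -!natrX -!natrM ler_nat; apply: leq_trans hgv _.
  - rewrite -!natrX -!natrM ler_nat; apply: leq_trans hbj _; rewrite aj.
    by apply: leq_trans (leq_mul y2 w2) _; apply: eq_leq; ring.
  - rewrite -!natrX -!natrM ler_nat; apply: leq_trans (area_le b0 hc un); rewrite aj.
    by apply: leq_mul; [apply: leq_mul => //; apply: leq_mul|rewrite leq_exp2r].
  have h : (2 * N <= `|ndet b (P0 i) (P0 l)| * `|ndet b (P0 s) (P0 j)| * b * Dd ^ 2)%N.
    by rewrite leqNgt; apply/negP => h; apply: hs0; exists i, l, s, j; split => //; exact: ltnW.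
  have k := leq_mul (ltnW e3) (ltnW e2).
  have {}h : (2 * N <= 2 ^ (e i l).+1 * 2 ^ (e s j).+1 * (b * Dd ^ 2))%N.
    by apply: leq_trans h _; rewrite -mulnA leq_mul2r k orbT.
  rewrite -!natrX -!natrM ler_nat -(leq_pmul2l (_ : 0 < 2)%N) //.
  by apply: leq_trans h _; rewrite !expnS; apply: eq_leq; ring.
have C0 : 0 <= 120 * 2 ^+ 6 * 32 ^+ 3 * D%:R ^+ 8 * G%:R ^+ 3 :> R.
  by do ![apply: mulr_ge0 => // | apply: exprn_ge0 => //].
have := ler_wpM2l C0 F; rewrite -/B; apply: le_trans; rewrite -/X le_eqVlt; apply/orP; left; apply/eqP.
by ring.
Qed.

End Split.

(** * Existence of a good split *)

Local Open Scope nat_scope.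

Section Dichotomy.
Variables (T : finType) (rho : T -> nat) (bit : 'I_4 -> T -> bool).

(** Atoms of size [rho t] are sorted by four binary partitions. The cells of two partitions will be
    the areas of the vectors of a configuration, those of three the areas of their parts. *)
Definition cell2 i l a b : nat := \prod_(t | (bit i t == a) && (bit l t == b)) rho t.
Definition cell3 i l q a b c : nat :=
  \prod_(t | [&& bit i t == a, bit l t == b & bit q t == c]) rho t.
Let cell4 i l q s a b c d : nat :=
  \prod_(t | [&& bit i t == a, bit l t == b, bit q t == c & bit s t == d]) rho t.

Lemma cell_split (Q : pred T) q c : (\prod_(t | Q t) rho t =
  \prod_(t | Q t && (bit q t == c)) rho t * \prod_(t | Q t && (bit q t == ~~ c)) rho t)%N.
Proof.
rewrite (bigID (fun t => bit q t == c)) /=; congr (_ * _)%N.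
by apply: eq_bigl => t; case: (bit q t); case: c.
Qed.

Lemma cell2E i l q a b c : cell2 i l a b = (cell3 i l q a b c * cell3 i l q a b (~~ c))%N.
Proof.
rewrite /cell2 (cell_split _ q c) /cell3; congr (_ * _)%N; apply: eq_bigl => t; by rewrite -andbA.
Qed.

Lemma cell2C i l a b : cell2 i l a b = cell2 l i b a.
Proof. by apply: eq_bigl => t; rewrite andbC. Qed.

Lemma cell3C i l q a b c : cell3 i l q a b c = cell3 l i q b a c.
Proof. by apply: eq_bigl => t; rewrite andbCA. Qed.

Lemma cell3R i l q a b c : cell3 i l q a b c = cell3 l q i b c a.
Proof. by apply: eq_bigl => t; rewrite andbC andbA. Qed.

Hypothesis rho_gt0 : forall t, (0 < rho t)%N.

Lemma prod_sub (Q Q' : pred T) : (forall t, Q t -> Q' t) ->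
  (\prod_(t | Q t) rho t <= \prod_(t | Q' t) rho t)%N.
Proof.
move=> h; rewrite [X in (_ <= X)%N](bigID Q) /=.
rewrite [X in (_ <= X * _)%N](eq_bigl Q); last by move=> t; case: (boolP (Q t)) => [/h->|]; rewrite ?andbF.
by rewrite leq_pmulr // prodn_gt0.
Qed.

Lemma cell3_gt0 i l q a b c : (0 < cell3 i l q a b c)%N.
Proof. exact: prodn_gt0. Qed.

Variables (b0 N0 g z : nat).

Definition good_cell :=
  exists i l q s a b, [/\ uniq [:: i; l; q; s], forall c, (g <= cell3 i l q a b c)%N & (b0 * g <= cell2 i l a b)%N].

Hypotheses (g_gt0 : (0 < g)%N) (z_gt0 : (0 < z)%N).
Hypothesis big_b0 : (z ^ 2 * g ^ 5 <= b0)%N.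
Hypothesis pairwise_large : forall i l a b a' b', i != l -> (a, b) != (a', b') ->
  (b0 ^ 2 <= z ^ 2 * (cell2 i l a b * cell2 i l a' b'))%N.

Lemma neq_negb (x y : bool) : x != y -> x = ~~ y.
Proof. by case: x y => [] []. Qed.

Lemma leq_sqr_mul (x y w v : nat) : (x ^ 2 <= w ^ 2 * (y * v) -> (x <= w * y) \/ (x <= w * v))%N.
Proof.
move=> h; have [h1|h1] := leqP x (w * y); [by left|right].
have [//|h2] := leqP x (w * v).
have : ((w * y) * (w * v) < x * x)%N.
  by apply: (@leq_ltn_trans ((w * y) * x)); rewrite ?leq_mul2l ?(ltnW h2) ?orbT // ltn_pmul2r //; apply: leq_ltn_trans h1.
by rewrite ltnNge => /negP; case; rewrite mulnn (leq_trans h) //; apply: eq_leq; ring.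
Qed.

(** In the cell [(c, ~~ d)] of [q], [s] the portions lying in three of the four cells of [i], [l]
    are at most [g], so the cell is concentrated on [(~~ a, ~~ b)]; the same holds for [(~~ c, d)].
    One of these two cells is at least [b0 / z]. Together with the cell [(a, ~~ b)] of [i], [l] it
    produces a cell of [l] and [q], or of [l] and [s], which [i] divides into two large parts. *)
Lemma good_cell_core i l q s a b c d : uniq [:: i; l; q; s] ->
  (forall x e, (x, e) = (q, c) \/ (x, e) = (s, d) ->
     [/\ (cell3 i l x a b e < g)%N, (cell3 i l x a (~~ b) (~~ e) < g)%N & (cell3 i l x (~~ a) b (~~ e) < g)%N]) ->
  (b0 <= z * cell2 i l a (~~ b))%N -> good_cell.
Proof.
move=> u hx hb; have [il iq is_ lq [ls qs]] := uniq4_neq u.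
have [q1 q2 q3] := hx q c (or_introl erefl); have [s1 s2 s3] := hx s d (or_intror erefl).
(* The two parts are at least [b0 / (z g)] and [b0 / (z g ^ 3)]. Their product must reach [b0 g],
   whence the hypothesis [z ^ 2 g ^ 5 <= b0]. *)
have fin x e y : uniq [:: l; x; i; y] -> (cell3 i l x a (~~ b) (~~ e) < g)%N ->
    (b0 <= z * (g ^ 3 * cell3 i l x (~~ a) (~~ b) e))%N -> good_cell.
  move=> ux h1 h2.
  have k1 : (b0 <= z * (g * cell3 i l x a (~~ b) e))%N.
    apply: leq_trans hb _; rewrite (cell2E i l x a (~~ b) e) leq_mul2l [(g * _)%N]mulnC leq_mul2l (ltnW h1) !orbT //.
  have zz := z_gt0.
  exists l, x, i, y, (~~ b), e; split => //.
    move=> c'; rewrite -(cell3R i l x c').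
    have G5 : (z ^ 2 * g ^ 5 <= b0)%N by [].
    have [->|->] : c' = a \/ c' = ~~ a by case: (c'); case: (a); [left|right|right|left].
      rewrite -(leq_pmul2l (_ : 0 < z * g)%N) ?muln_gt0 ?zz //.
      apply: leq_trans (leq_trans _ k1) _; last by rewrite mulnA.
      apply: leq_trans G5; rewrite -mulnA -[(z ^ 2)%N]mulnn -[X in (X <= _)%N]muln1 mulnC.
      rewrite mul1n -mulnA leq_mul2l; apply/orP; right.
      apply: leq_trans (leq_pmull _ zz); rewrite mulnn leq_pexp2l //.
    rewrite -(leq_pmul2l (_ : 0 < z * g ^ 3)%N) ?muln_gt0 ?zz ?expn_gt0 ?g_gt0 //.
    apply: leq_trans (leq_trans _ h2) _; last by rewrite mulnA.
    apply: leq_trans G5; rewrite -mulnA -[(z ^ 2)%N]mulnn -mulnA leq_mul2l; apply/orP; right.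
    by apply: leq_trans (leq_pmull _ zz); rewrite -expnSr leq_pexp2l.
  rewrite (cell2E l x i (~~ b) e a) -(cell3R i l x a) -(cell3R i l x (~~ a)).
  have h3 := leq_mul k1 h2.
  have zg : (0 < z ^ 2 * g ^ 4)%N by rewrite muln_gt0 !expn_gt0 zz g_gt0.
  rewrite -(leq_pmul2l zg).
  apply: leq_trans (_ : b0 * b0 <= _)%N.
    rewrite mulnCA leq_mul2l; apply/orP; right.
    by apply: leq_trans big_b0; apply: eq_leq; ring.
  by apply: leq_trans h3 _; apply: eq_leq; ring.
have bound4 (x y : nat) : (x < g -> y <= x -> y <= g)%N by move=> h1 h2; apply: leq_trans h2 (ltnW h1).
have sub4 (Q : pred T) i1 i2 i3 a1 a2 a3 : (forall t, Q t -> [&& bit i1 t == a1, bit i2 t == a2 & bit i3 t == a3]) ->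
    (cell3 i1 i2 i3 a1 a2 a3 < g)%N -> (\prod_(t | Q t) rho t <= g)%N.
  by move=> h1 h2; apply: bound4 h2 _; apply: prod_sub.
have expand e f : (forall a' b', (a', b') != (~~ a, ~~ b) -> (cell4 i l q s a' b' e f <= g)%N) ->
    (cell2 q s e f <= g ^ 3 * cell4 i l q s (~~ a) (~~ b) e f)%N.
  move=> h.
  have -> : cell2 q s e f = (cell4 i l q s a b e f * cell4 i l q s a (~~ b) e f *
      (cell4 i l q s (~~ a) b e f * cell4 i l q s (~~ a) (~~ b) e f))%N.
    rewrite /cell2 (cell_split _ i a) (cell_split _ l b) [X in (_ * X)%N](cell_split _ l b) /cell4.
    by congr (_ * _ * (_ * _))%N; apply: eq_bigl => t; do !case: (_ == _).
  rewrite (_ : g ^ 3 = g * g * g)%N ?mulnA; last by ring.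
  rewrite leq_mul2r; apply/orP; right.
  by apply: leq_mul; [apply: leq_mul|]; apply: h; case: (a); case: (b).
have e1 : (cell2 q s c (~~ d) <= g ^ 3 * cell4 i l q s (~~ a) (~~ b) c (~~ d))%N.
  apply: expand => a' b'; case: (eqVneq a' a) => [->|na].
    case: (eqVneq b' b) => [->|nb] _.
      by apply: sub4 q1 => t /and4P[-> -> -> _].
    have -> := neq_negb nb.
    by apply: sub4 s2 => t /and4P[-> -> _ ->].
  have -> := neq_negb na.
  case: (eqVneq b' b) => [->|nb] h.
    by apply: sub4 s3 => t /and4P[-> -> _ ->].
  by case/negP: h; rewrite (neq_negb nb).
have e2 : (cell2 q s (~~ c) d <= g ^ 3 * cell4 i l q s (~~ a) (~~ b) (~~ c) d)%N.
  apply: expand => a' b'; case: (eqVneq a' a) => [->|na].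
    case: (eqVneq b' b) => [->|nb] _.
      by apply: sub4 s1 => t /and4P[-> -> _ ->].
    have -> := neq_negb nb.
    by apply: sub4 q2 => t /and4P[-> -> -> _].
  have -> := neq_negb na.
  case: (eqVneq b' b) => [->|nb] h.
    by apply: sub4 q3 => t /and4P[-> -> -> _].
  by case/negP: h; rewrite (neq_negb nb).
have := @pairwise_large q s c (~~ d) (~~ c) d qs.
have -> : (c, ~~ d) != (~~ c, d) by case: (c); case: (d).
move/(_ isT).
have [u1 u2 u3 u4 [u5 u6 u7 u8 u9]] := uniq4_perm u.
case/leq_sqr_mul => h.
  apply: (fin q c s) => //; first by move: u; rewrite /= !inE !negb_or => /and4P[/and3P[v1 v2 v3] /andP[v4 v5] v6 _]; rewrite v4 v5 [l == i]eq_sym v1 [q == i]eq_sym v2 v6 v3.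
  apply: leq_trans h _; rewrite leq_mul2l; apply/orP; right; apply: leq_trans e1 _.
  rewrite leq_mul2l; apply/orP; right; apply: prod_sub => t /and4P[-> -> -> _] //.
apply: (fin s d q) => //.
  by move: u; rewrite /= !inE !negb_or => /and4P[/and3P[v1 v2 v3] /andP[v4 v5] v6 _]; rewrite v4 v5 [l == i]eq_sym v1 [s == i]eq_sym v3 [s == q]eq_sym v6 v2.
apply: leq_trans h _; rewrite leq_mul2l; apply/orP; right; apply: leq_trans e2 _.
rewrite leq_mul2l; apply/orP; right; apply: prod_sub => t /and4P[-> -> _ ->] //.
Qed.

Hypothesis total_large : forall i l, i != l ->
  ((b0 * g) ^ 4 <= cell2 i l false false * cell2 i l false true * (cell2 i l true false * cell2 i l true true))%N.

(** Take the largest of all cells. If [q] leaves less than [g] of it on side [c], the cells obtained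
    by exchanging [l] or [i] for [q] are not larger, which forces two more triple cells below [g].
    If this happens for both remaining partitions, [good_cell_core] applies, possibly with [i] and
    [l] exchanged. *)
Lemma good_cell_exists : good_cell.
Proof.
pose F (x : 'I_4 * 'I_4 * bool * bool) := cell2 x.1.1.1 x.1.1.2 x.1.2 x.2.
have [[[[i l] a] b] /= il hmax] := @arg_maxnP _ (ord0, ord_max, true, true) (fun x : 'I_4 * 'I_4 * bool * bool => x.1.1.1 != x.1.1.2) F isT.
have {}hmax i' l' a' b' : i' != l' -> (cell2 i' l' a' b' <= cell2 i l a b)%N.
  by move=> h; exact: (hmax (i', l', a', b')).
have big : (b0 * g <= cell2 i l a b)%N.
  rewrite -(leq_exp2r _ _ (_ : 0 < 4)%N) //; apply: leq_trans (total_large il) _.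
  rewrite (_ : cell2 i l a b ^ 4 = cell2 i l a b * cell2 i l a b * (cell2 i l a b * cell2 i l a b))%N; last by ring.
  by apply: leq_mul; apply: leq_mul; exact: hmax.
have [q [s u]] := uniq4_extend il.
have [_ iq is_ lq [ls qs]] := uniq4_neq u.
have step x y : uniq [:: i; l; x; y] -> good_cell \/ exists e,
    [/\ (cell3 i l x a b e < g)%N, (cell3 i l x a (~~ b) (~~ e) < g)%N & (cell3 i l x (~~ a) b (~~ e) < g)%N].
  move=> ux; have [_ ix _ lx _] := uniq4_neq ux.
  have [h1|h1] := pselect (forall c, (g <= cell3 i l x a b c)%N).
    by left; exists i, l, x, y, a, b.
  right; have [e he] : exists e, (cell3 i l x a b e < g)%N.
    by apply: contrapT => h2; apply: h1 => c; rewrite leqNgt; apply/negP => h3; apply: h2; exists c.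
  exists e; split => //; apply: leq_ltn_trans he.
    have := hmax i x a (~~ e) ix; rewrite (cell2E i x l a (~~ e) b) (cell2E i l x a b e).
    have sw f : cell3 i x l a (~~ e) f = cell3 i l x a f (~~ e).
      by apply: eq_bigl => t; congr (_ && _); rewrite andbC.
    by rewrite !sw mulnC leq_pmul2r // cell3_gt0.
  have := hmax l x b (~~ e) lx; rewrite (cell2E l x i b (~~ e) a) (cell2E i l x a b e) -(cell3R i l x a) -(cell3R i l x (~~ a)).
  by rewrite mulnC leq_pmul2r // cell3_gt0.
have [_ us _ _ [_ u' _ _ _]] := uniq4_perm u.
case: (step _ _ u) => [//|[c [c1 c2 c3]]]; case: (step _ _ u') => [//|[d [d1 d2 d3]]].
have := @pairwise_large i l a (~~ b) (~~ a) b il.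
have -> : (a, ~~ b) != (~~ a, b) by case: (a); case: (b).
move/(_ isT).
case/leq_sqr_mul => h.
  by apply: (good_cell_core u _ h (c := c) (d := d)) => x e [[-> ->]|[-> ->]].
have [_ _ _ _ [ul _ _ _ _]] := uniq4_perm u.
rewrite cell2C in h.
by apply: (good_cell_core ul _ h (c := c) (d := d)) => x e [[-> ->]|[-> ->]]; rewrite !(cell3C l i).
Qed.

End Dichotomy.

Local Open Scope ring_scope.

(** * Configurations without close pairs: all areas are large *)

Section Separation.
Variables (b N D2 : nat) (P : 'I_4 -> vec).
Hypotheses (b_gt0 : (0 < b)%N) (D2_gt0 : (0 < D2)%N) (hP : cfg b N P) (far : ~ close_min b N D2 P).

Let pq k m : nat := (`|(P k).1| * `|(P m).2|)%N.
Let n k m : nat := `|ndet b (P k) (P m)|.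

Lemma far_index : exists i, forall l s t, uniq [:: i; l; s; t] ->
  (N <= pq i l * (n s t * D2))%N /\ (N <= pq l i * (n s t * D2))%N.
Proof.
have es k m : k != m -> cfg_exp b P k m = cfg_exp b P m k by exact: cfg_exp_sym hP.
have [i hi] := minimal_index_exists es; exists i => l s t u.
have [_ _ _ _ [_ st]] := uniq4_neq u; have [_ n0] := cfg_ndet hP st.
have /andP[e1 _] := lg_bounds n0; rewrite -/(cfg_exp b P s t) in e1.
have d0 : (0 < 2 ^ cfg_exp b P s t * D2)%N by rewrite muln_gt0 expn_gt0.
have key m : (N %/ (2 ^ cfg_exp b P s t * D2) < m)%N -> (N <= m * (n s t * D2))%N.
  move=> hm; apply: leq_trans (ltnW (ltn_ceil N d0)) _; apply: leq_mul => //.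
  by rewrite leq_mul2r e1 orbT.
split; apply: key; rewrite ltnNge; apply/negP => h; apply: far; exists i, l, s, t; split => //.
  by left.
by right; rewrite mulnC.
Qed.

Let n_gt0 k m : k != m -> (0 < n k m)%N.
Proof. by move=> km; have [_ h] := cfg_ndet hP km; rewrite absz_gt0. Qed.

Let pq_le i l s t : uniq [:: i; l; s; t] -> (pq i l * n s t <= N)%N /\ (pq l i * n s t <= N)%N.
Proof.
move=> u; have [u1 u2 _ _ _] := uniq4_perm u.
by split; rewrite mulnC; apply: cfg_ndet_le.
Qed.

Let bn_le k m : k != m -> (b * n k m <= pq k m + pq m k)%N.
Proof.
move=> km; have [ed _] := cfg_ndet hP km.
rewrite /n -[b]/(`|b%:Z|%N) -abszM -ed /det2 /pq -!abszM mulrC; lia.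
Qed.

Lemma separated_near k m : k != m ->
  (forall s t, uniq [:: k; m; s; t] -> (N <= pq k m * (n s t * D2))%N /\ (N <= pq m k * (n s t * D2))%N) ->
  (b * n k m <= 2 * D2 * pq k m)%N /\ (b * n k m <= 2 * D2 * pq m k)%N.
Proof.
move=> km h; have [s [t u]] := uniq4_extend km; have [h1 h2] := h _ _ u.
have [_ _ _ _ [_ st]] := uniq4_neq u; have nst := n_gt0 st.
have h3 := cfg_opposite b_gt0 hP u; rewrite -/(n k m) -/(n s t) in h3.
split; rewrite -(leq_pmul2r nst) -[X in (X <= _)%N]mulnA; apply: leq_trans h3 _.
  by apply: leq_trans (leq_mul (leqnn 2) h1) _; apply: eq_leq; ring.
by apply: leq_trans (leq_mul (leqnn 2) h2) _; apply: eq_leq; ring.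
Qed.

Lemma pq_comparable i l s t : uniq [:: i; l; s; t] ->
  (N <= pq i l * (n s t * D2))%N -> (N <= pq l i * (n s t * D2))%N ->
  (pq i l <= D2 * pq l i)%N /\ (pq l i <= D2 * pq i l)%N.
Proof.
move=> u h1 h2; have [_ _ _ _ [_ st]] := uniq4_neq u; have nst := n_gt0 st.
have [h3 h4] := pq_le u.
split; rewrite -(leq_pmul2r nst).
  by apply: leq_trans h3 (leq_trans h2 _); apply: eq_leq; ring.
by apply: leq_trans h4 (leq_trans h1 _); apply: eq_leq; ring.
Qed.

(** For pairs containing the minimal index [i], compare the lower bound with [cfg_opposite]. There
    [pq] is symmetric up to a factor [D2], and [pq k m * pq i k * pq m i = pq m k * pq k i * pq i m]
    makes it symmetric up to [D2 ^ 2] for the other pairs. *)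
Lemma separated : exists i, (forall l s t, uniq [:: i; l; s; t] ->
   (N <= pq i l * (n s t * D2))%N /\ (N <= pq l i * (n s t * D2))%N) /\
  forall k m, k != m -> (b * n k m <= 2 * D2 ^ 2 * pq k m)%N.
Proof.
have [i hi] := far_index; exists i; split => // k m km.
have DD : (D2 <= D2 ^ 2)%N by rewrite -mulnn leq_pmull.
have up x y : (x <= 2 * D2 * y -> x <= 2 * D2 ^ 2 * y)%N.
  by move=> h; apply: leq_trans h _; rewrite leq_mul2r leq_mul2l DD !orbT.
have [ek|ki] := eqVneq k i.
  subst k; have [h1 _] := separated_near km (fun s t u => hi m s t u); exact: up.
have [em|mi] := eqVneq m i.
  subst m; have hk : i != k by rewrite eq_sym.
  have [_ h1] := separated_near hk (fun s t u => hi k s t u).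
  apply: up; apply: leq_trans h1; rewrite /n leq_mul2l.
  have [e1 _] := cfg_ndet hP hk; have [e2 _] := cfg_ndet hP km.
  have : b%:Z * ndet b (P k) (P i) = b%:Z * - ndet b (P i) (P k) by rewrite mulrN -e1 -e2 /det2; ring.
  by move/mulfI => ->; [rewrite abszN leqnn orbT|rewrite eqz_nat -lt0n].
have [s' [t' u']] : exists s t, uniq [:: i; k; m; s] /\ uniq [:: i; m; k; t].
  have ik : i != k by rewrite eq_sym.
  have [s [t u]] := uniq4_extend km; have := uniq4P u i; rewrite !inE.
  rewrite eq_sym (negPf ki) eq_sym (negPf mi) /= => /orP[]/eqP ei; subst i.
    exists t, t; move: u; rewrite /= !inE !negb_or => /and4P[/and3P[v1 v2 v3] /andP[v4 v5] v6 _].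
    by rewrite ![s == _]eq_sym ![m == k]eq_sym v1 v2 v3 v4 v5 [t == s]eq_sym v6.
  exists s, s; move: u; rewrite /= !inE !negb_or => /and4P[/and3P[v1 v2 v3] /andP[v4 v5] v6 _].
  by rewrite ![t == _]eq_sym ![m == k]eq_sym v1 v2 v3 v4 v5 v6.
case: u' => u1 u2.
have [a1 a2] := hi _ _ _ u1; have [c1 c2] := hi _ _ _ u2.
have [d1 d2] := pq_comparable u1 a1 a2; have [f1 f2] := pq_comparable u2 c1 c2.
have id1 : (pq k m * (pq i k * pq m i) = pq m k * (pq k i * pq i m))%N by rewrite /pq; ring.
have pos x y : (0 < pq x y)%N.
  by rewrite /pq muln_gt0 !absz_gt0; have [-> _ _ _] := hP.1 x; have [_ -> _ _] := hP.1 y.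
have h : (pq m k <= D2 ^ 2 * pq k m)%N.
  have q0 : (0 < pq k i * pq i m)%N by rewrite muln_gt0 !pos.
  rewrite -(leq_pmul2r q0) -id1.
  apply: leq_trans (leq_mul (leqnn _) (leq_mul d1 f2)) _; apply: eq_leq; ring.
apply: leq_trans (bn_le km) _; apply: leq_trans (leq_add (leqnn _) h) _.
rewrite -mulnA mul2n -addnn leq_add2r leq_pmull // expn_gt0 D2_gt0 //.
Qed.

Lemma area_pair k m : (area (P k) * area (P m) = pq k m * pq m k)%N.
Proof. by rewrite /area /pq; ring. Qed.

Lemma area_pair_large k m : k != m -> (b ^ 2 <= (2 * D2 ^ 2) ^ 2 * (area (P k) * area (P m)))%N.
Proof.
move=> km; have [i [_ h]] := separated; have mk : m != k by rewrite eq_sym.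
have h1 := h _ _ km; have h2 := h _ _ mk.
have e1 : (b <= 2 * D2 ^ 2 * pq k m)%N by apply: leq_trans h1; rewrite leq_pmulr // n_gt0.
have e2 : (b <= 2 * D2 ^ 2 * pq m k)%N by apply: leq_trans h2; rewrite leq_pmulr // n_gt0.
rewrite -mulnn; apply: leq_trans (leq_mul e1 e2) _; rewrite area_pair; apply: eq_leq; ring.
Qed.

(** [N] is bounded through a pair containing [i] and [b] through the opposite pair; the determinant
    [n s t] cancels. *)
Lemma area_total_large : ((b * N) ^ 2 <= 4 * D2 ^ 6 * \prod_k area (P k))%N.
Proof.
have [i [hi h]] := separated.
have [l li] : exists l : 'I_4, i != l.
  by exists (if i == 0 then 1 else 0); case: (eqVneq i 0) => [->|].
have [s [t u]] := uniq4_extend li.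
have [_ _ _ _ [_ st]] := uniq4_neq u; have ts : t != s by rewrite eq_sym.
have [h1 h2] := hi _ _ _ u; have h3 := h _ _ st; have h4 := h _ _ ts.
have nst := n_gt0 st.
have ent : n t s = n s t.
  have [e1 _] := cfg_ndet hP st; have [e2 _] := cfg_ndet hP ts.
  have : b%:Z * ndet b (P t) (P s) = b%:Z * - ndet b (P s) (P t) by rewrite mulrN -e1 -e2 /det2; ring.
  by rewrite /n; move/mulfI => ->; [rewrite abszN|rewrite eqz_nat -lt0n].
rewrite ent in h4.
have -> : (\prod_k area (P k) = area (P i) * area (P l) * (area (P s) * area (P t)))%N.
  rewrite (perm_big [:: i; l; s; t]).
    by rewrite !big_cons big_nil /=; ring.
  apply: uniq_perm => //; first exact: index_enum_uniq.
  by move=> k; rewrite mem_index_enum (uniq4P u).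
rewrite !area_pair -(leq_pmul2r (_ : 0 < n s t ^ 2)%N) ?expn_gt0 ?nst //.
have h5 := leq_mul (leq_mul h1 h2) (leq_mul h3 h4).
apply: leq_trans (leq_trans h5 _); apply: eq_leq; ring.
Qed.

End Separation.

(** * From factorizations to quadruples *)

(** Greedily: [gcd(z x0, g)] is taken out of [g], and the cofactor, coprime to the rest of [g], must
    divide [h]. *)
Lemma refine_factors (T : eqType) (x0 : T) (s : seq T) (z : T -> int) (g h : int) :
  uniq (x0 :: s) -> (forall x, z x != 0) -> \prod_(x <- x0 :: s) z x = g * h ->
  exists u w : T -> int, [/\ forall x, x \in x0 :: s -> u x * w x = z x,
    \prod_(x <- x0 :: s) u x = g & \prod_(x <- x0 :: s) w x = h].
Proof.
move=> us z0; elim: s x0 us g h => [|x1 s IH] x0 us g h.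
  rewrite big_seq1 => e; exists (fun=> g), (fun=> h); split; rewrite ?big_seq1 //.
  by move=> x; rewrite inE => /eqP->.
rewrite big_cons => e; set Z := \prod_(_ <- _) _ in e.
pose a := gcdz (z x0) g.
have a0 : a != 0 by rewrite gcdz_eq0 negb_and z0.
have ez : z x0 = (z x0 %/ a)%Z * a by rewrite divzK // dvdz_gcdl.
have eg : g = (g %/ a)%Z * a by rewrite divzK // dvdz_gcdr.
set k := (z x0 %/ a)%Z in ez; set g' := (g %/ a)%Z in eg.
have cp : coprimez k g'.
  rewrite /coprimez -(inj_eq (mulIf a0)) mul1r.
  have -> : gcdz k g' * a = gcdz (k * a) (g' * a) by rewrite -mulz_gcdl.
  by rewrite -ez -eg.
have e2 : k * Z = g' * h.
  by apply: (mulIf a0); rewrite mulrAC -ez e {1}eg; ring.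
have /dvdzP[h' eh] : (k %| h)%Z by rewrite -(Gauss_dvdzr _ cp) -e2 dvdz_mulr.
have k0 : k != 0 by apply: contraNneq (z0 x0) => k0; rewrite ez k0 mul0r.
have e3 : Z = g' * h' by apply: (mulfI k0); rewrite e2 eh; ring.
have us' : uniq (x1 :: s) by case/andP: us.
have [u [w [h1 h2 h3]]] := IH x1 us' _ _ e3.
have nx x : x \in x1 :: s -> (x == x0) = false.
  by move=> hx; apply: contraTF us => /eqP ex; rewrite /= -ex hx.
exists (fun x => if x == x0 then a else u x), (fun x => if x == x0 then k else w x); split.
- move=> x; rewrite inE; case: eqP => [-> _|_ /= /h1 //].
  by rewrite ez mulrC.
- rewrite big_cons eqxx eg mulrC; congr (_ * _); rewrite -h2 big_seq [RHS]big_seq.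
  by apply: eq_bigr => x /nx->.
rewrite big_cons eqxx eh mulrC; congr (_ * _); rewrite -h3 big_seq [RHS]big_seq.
by apply: eq_bigr => x /nx->.
Qed.

(** Each further factorization splits every atom in two and adds one bit to its index. *)
Lemma atoms (n : nat) (y : nat -> bool -> int) (K : int) : K != 0 ->
  (forall i, (i < n)%N -> y i false * y i true = K) ->
  exists (T : finType) (z : T -> int) (bit : nat -> T -> bool),
    [/\ (0 < #|T|)%N, forall t, z t != 0, \prod_t z t = K &
     forall i c, (i < n)%N -> \prod_(t | bit i t == c) z t = y i c].
Proof.
move=> K0; elim: n => [|n IH] hy.
  exists unit, (fun=> K), (fun _ _ => false).
  by rewrite card_unit (big_pred1 tt) //; case.
have [T [z [bit [T0 z0 hK hb]]]] := IH (fun i hi => hy i (ltnW hi)).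
have [x0 [s es]] : exists x0 s, index_enum T = x0 :: s.
  have /card_gt0P[t _] := T0; have := mem_index_enum t.
  by case: (index_enum T) => // x0 s _; exists x0, s.
have us : uniq (x0 :: s) by rewrite -es index_enum_uniq.
have hK' : \prod_(x <- x0 :: s) z x = y n false * y n true by rewrite -es hK hy.
have [u [w [h1 h2 h3]]] := refine_factors us z0 hK'.
have h1' t : u t * w t = z t by apply: h1; rewrite -es mem_index_enum.
pose z' (x : T * bool) := if x.2 then w x.1 else u x.1.
pose bit' i (x : T * bool) := if i == n then x.2 else bit i x.1.
have hp (Q : pred T) : \prod_(x | Q x.1) z' x = \prod_(t | Q t) z t.
  have -> : \prod_(x | Q x.1) z' x = \prod_(x | Q x.1 && true) z' (x.1, x.2).
    by apply: eq_big => [x|[t c]] //=; rewrite andbT.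
  rewrite -(pair_big_dep Q (fun _ _ => true) (fun t c => z' (t, c))) /=.
  by apply: eq_bigr => t _; rewrite big_bool /z' /= mulrC.
exists (T * bool)%type, z', bit'; split.
- by rewrite card_prod card_bool muln_gt0 T0.
- move=> [t c]; rewrite /z' /=; have := z0 t; rewrite -h1' mulf_eq0 negb_or => /andP[? ?].
  by case: c.
- by rewrite (hp xpredT).
move=> i c; rewrite ltnS leq_eqVlt => /orP[/eqP->|hi].
  have -> : \prod_(x | bit' n x == c) z' x = \prod_t z' (t, c).
    have -> : \prod_(x | bit' n x == c) z' x = \prod_(x | true && (x.2 == c)) z' (x.1, x.2).
      by apply: eq_big => [x|[t d]] //=; rewrite /bit' eqxx.
    rewrite -(pair_big_dep xpredT (fun _ d => d == c) (fun t d => z' (t, d))) /=.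
    by apply: eq_bigr => t _; rewrite big_pred1_eq.
  by rewrite -[index_enum T]/(index_enum T) es /z' /=; case: c.
rewrite -(hb i c hi) -hp; apply: eq_bigl => x.
by rewrite /bit' ltn_eqF.
Qed.

(** The factors will be values [b u - a] with [1 <= u <= N]; this is the origin of the congruence
    and of the distance [b * N]. *)
Definition rich (b N n : nat) (y : nat -> bool -> int) (K : int) : Prop :=
  [/\ K != 0, forall i, (i < n)%N -> y i false * y i true = K,
      forall i c, (i < n)%N -> coprimez (y i c) b%:Z,
      forall i j c d, (i < n)%N -> (j < n)%N -> (b%:Z %| y i c - y j d)%Z /\ (`|y i c - y j d| <= b * N)%N &
      forall i j c d, (i < n)%N -> (j < n)%N -> i != j -> y i c != y j d].

(* [F x0 x1 x2] is the part of [K] common to [y 0 x0], [y 1 x1] and [y 2 x2].  The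
   difference of two factors of distinct pairs is the determinant of two of these
   vectors times coordinates of the other two. *)
Definition vecs (F : bool -> bool -> bool -> int) (k : 'I_4) : vec :=
  match val k with
  | 0%N => (F true true true, F false false false)
  | 1%N => (F false false true, F true true false)
  | 2%N => (F false true false, F true false true)
  | _ => (F true false false, F false true true)
  end.

(* The pair [(y 0 false, y 0 true)] of the factorizations refined by [P]. *)
Definition line_of (P : 'I_4 -> vec) : int * int :=
  ((P 1).1 * (P 2%:R).1 * ((P 0).2 * (P 3%:R).2), (P 0).1 * (P 3%:R).1 * ((P 1).2 * (P 2%:R).2)).

(** Names the factor [p_i p_s q_l q_t]. The six sets of two indices correspond to the six factors,
    complementary sets to the two factors of one pair. *)
Definition pair_index (i s : nat) : nat * bool :=
  match i, s with
  | 1, 2 | 2, 1 => (0, false) | 0, 3 | 3, 0 => (0, true)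
  | 1, 3 | 3, 1 => (1, false) | 0, 2 | 2, 0 => (1, true)
  | 2, 3 | 3, 2 => (2, false) | _, _ => (2, true)
  end%N.

Lemma vecs_cfg (b N : nat) (y : nat -> bool -> int) (K : int) F :
  rich b N 3 y K ->
  (forall c, y 0%N c = F c false false * F c false true * (F c true false * F c true true)) ->
  (forall c, y 1%N c = F false c false * F false c true * (F true c false * F true c true)) ->
  (forall c, y 2%N c = F false false c * F false true c * (F true false c * F true true c)) ->
  cfg b N (vecs F) /\ line_of (vecs F) = (y 0%N false, y 0%N true).
Proof.
move=> [K0 hy hc hd hn] y0 y1 y2.
have nz a c d : F a c d != 0 /\ coprimez (F a c d) b%:Z.
  split.
    have : y 0%N false * y 0%N true != 0 by rewrite hy.
    by rewrite !y0 !mulf_eq0 !negb_or => /andP[/andP[/andP[? ?] /andP[? ?]] /andP[/andP[? ?] /andP[? ?]]]; case: a c d => [] [] [].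
  have := hc 0%N a isT; rewrite y0 !coprimezMl => /andP[/andP[? ?] /andP[? ?]].
  by case: c d => [] [].
have W i l s t : uniq [:: i; l; s; t] ->
   (vecs F i).1 * (vecs F s).1 * ((vecs F l).2 * (vecs F t).2) = y (pair_index i s).1 (pair_index i s).2.
  by case: i => [[|[|[|[|//]]]] hi]; case: s => [[|[|[|[|//]]]] hs] //; case: l => [[|[|[|[|//]]]] hl] //;
     case: t => [[|[|[|[|//]]]] ht] // _; rewrite /vecs /= ?y0 ?y1 ?y2; ring.
split; last first.
  by rewrite /line_of /vecs /= !y0; congr (_, _); ring.
split=> [k|i l s t u].
  have nzc a c d a' c' d' : unit_vec b (F a c d, F a' c' d').
    by have [? ?] := nz a c d; have [? ?] := nz a' c' d'.
  by case: k => [[|[|[|[|//]]]] hk]; apply: nzc.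
have [_ _ u3 _ [u5 _ _ _ _]] := uniq4_perm u.
have e : det2 (vecs F i) (vecs F l) * ((vecs F s).1 * (vecs F t).2) =
   y (pair_index i s).1 (pair_index i s).2 - y (pair_index l s).1 (pair_index l s).2.
  by rewrite -(W i l s t u) -(W l i s t u5) /det2; ring.
have lt3 a c : ((pair_index a c).1 < 3)%N by do 4?[case: a => [|a]]; do 4?[case: c => [|c]].
have ne : (pair_index i s).1 != (pair_index l s).1.
  clear -u; move: u.
  by case: i => [[|[|[|[|//]]]] hi]; case: s => [[|[|[|[|//]]]] hs] //; case: l => [[|[|[|[|//]]]] hl] //;
     case: t => [[|[|[|[|//]]]] ht].
have [dv le] := hd _ _ (pair_index i s).2 (pair_index l s).2 (lt3 i s) (lt3 l s).
have n0 := hn _ _ (pair_index i s).2 (pair_index l s).2 (lt3 i s) (lt3 l s) ne.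
rewrite -e in dv le; move: n0; rewrite -subr_eq0 -e mulf_eq0 negb_or => /andP[n0 _].
split => //; last by rewrite -!abszM.
have cs : coprimez b%:Z ((vecs F s).1 * (vecs F t).2).
  rewrite coprimez_sym coprimezMl /vecs.
  apply/andP; split.
    by clear -nz; case: s => [[|[|[|[|//]]]] hs] /=; apply: (proj2 (nz _ _ _)).
  by clear -nz; case: t => [[|[|[|[|//]]]] hs] /=; apply: (proj2 (nz _ _ _)).
by rewrite -(Gauss_dvdzl _ cs).
Qed.

Lemma rich_sub (b N n m : nat) (y : nat -> bool -> int) (K : int) (f : nat -> nat) :
  rich b N n y K -> (forall i, (i < m)%N -> (f i < n)%N) ->
  (forall i j, (i < m)%N -> (j < m)%N -> i != j -> f i != f j) ->
  rich b N m (fun i => y (f i)) K.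
Proof.
move=> [K0 hy hc hd hn] hf fi; split => //.
- by move=> i hi; exact/hy/hf.
- by move=> i c hi; exact/hc/hf.
- by move=> i j c d hi hj; apply: hd; exact: hf.
by move=> i j c d hi hj ij; apply: hn; [exact: hf|exact: hf|exact: fi].
Qed.

Lemma absz_prod (T : finType) (Q : pred T) (z : T -> int) :
  absz (\prod_(t | Q t) z t) = (\prod_(t | Q t) absz (z t))%N.
Proof. exact: (big_morph absz abszM (erefl : absz 1 = 1%N)). Qed.

(** * Extraction of a good split from five factorizations *)

Section Extract.
Variables (b N : nat) (y : nat -> bool -> int) (K : int) (T : finType) (z : T -> int) (bit : nat -> T -> bool).
Hypotheses (b_gt0 : (0 < b)%N) (hrich : rich b N 5 y K) (z_neq0 : forall t, z t != 0).
Hypothesis atom_prod : forall i c, (i < 5)%N -> \prod_(t | bit i t == c) z t = y i c.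

(** The pair 0 belongs to every triple because [line_of] has to recover it; [al] and [be] number the
    other four pairs. *)
Definition F3 (al be : 'I_4) x0 x1 x2 : int :=
  \prod_(t | [&& bit 0 t == x0, bit al.+1 t == x1 & bit be.+1 t == x2]) z t.
Definition F4 (al be ga : 'I_4) x0 x1 x2 x3 : int :=
  \prod_(t | [&& bit 0 t == x0, bit al.+1 t == x1, bit be.+1 t == x2 & bit ga.+1 t == x3]) z t.

Lemma prod_bit (Q : pred T) i : \prod_(t | Q t) z t =
  (\prod_(t | Q t && (bit i t == false)) z t) * \prod_(t | Q t && (bit i t == true)) z t.
Proof.
rewrite (bigID (fun t => bit i t == false)) /=; congr (_ * _).
by apply: eq_bigl => t; case: (bit i t).
Qed.

Lemma F3_F4 al be ga x0 x1 x2 c :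
  F3 al be x0 x1 x2 = F4 al be ga x0 x1 x2 c * F4 al be ga x0 x1 x2 (~~ c).
Proof.
rewrite /F3 (prod_bit _ ga.+1) /F4; case: c => /=; [rewrite mulrC|];
  by congr (_ * _); apply: eq_bigl => t; rewrite -!andbA.
Qed.

Lemma y_F3 (al be : 'I_4) c :
  [/\ y 0%N c = F3 al be c false false * F3 al be c false true * (F3 al be c true false * F3 al be c true true),
    y al.+1 c = F3 al be false c false * F3 al be false c true * (F3 al be true c false * F3 al be true c true) &
    y be.+1 c = F3 al be false false c * F3 al be false true c * (F3 al be true false c * F3 al be true true c)].
Proof.
have h (i : 'I_4) : (i.+1 < 5)%N by rewrite ltnS.
rewrite -!atom_prod // /F3; split.
- rewrite (prod_bit _ al.+1) (prod_bit _ be.+1) [X in _ * X](prod_bit _ be.+1).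
  by congr (_ * _ * (_ * _)); apply: eq_bigl => t; rewrite -!andbA.
- rewrite (prod_bit _ 0) (prod_bit _ be.+1) [X in _ * X](prod_bit _ be.+1).
  by congr (_ * _ * (_ * _)); apply: eq_bigl => t; rewrite -!andbA; do !case: (_ == _).
rewrite (prod_bit _ 0) (prod_bit _ al.+1) [X in _ * X](prod_bit _ al.+1).
by congr (_ * _ * (_ * _)); apply: eq_bigl => t; rewrite -!andbA; do !case: (_ == _).
Qed.

Lemma triple_cfg (al be : 'I_4) : al != be ->
  cfg b N (vecs (F3 al be)) /\ line_of (vecs (F3 al be)) = (y 0%N false, y 0%N true).
Proof.
move=> ab; pose f k := match k with 0 => 0 | 1 => al.+1 | _ => be.+1 end%N.
have hr : rich b N 3 (fun k => y (f k)) K.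
  apply: rich_sub hrich _ _; first by case=> [|[|[|]]] //= _; rewrite ltnS.
  by case=> [|[|[|]]] // [|[|[|]]] //= _ _ _; rewrite eqSS // eq_sym.
by apply: (vecs_cfg hr) => c; have [] := y_F3 al be c.
Qed.

Definition rho t : nat := `|z t|.
(** The two coordinates of a vector have complementary bits; taken relative to the pair 0 these
    agree, so that a vector becomes one cell. *)
Definition rel_bit (i : 'I_4) t := bit 0 t (+) bit i.+1 t.
Definition index_a (k : 'I_4) : bool := (1 < k)%N.
Definition index_b (k : 'I_4) : bool := odd k.
Definition index_of (x1 x2 : bool) : 'I_4 :=
  if x1 then (if x2 then 3%:R else 2%:R) else if x2 then 1 else 0.

Lemma rho_gt0 t : (0 < rho t)%N. Proof. by rewrite absz_gt0. Qed.

Lemma nprod_bit (Q : pred T) : (\prod_(t | Q t) rho t =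
  (\prod_(t | Q t && (bit 0 t == false)) rho t) * \prod_(t | Q t && (bit 0 t == true)) rho t)%N.
Proof.
rewrite (bigID (fun t => bit 0 t == false)) /=; congr (_ * _)%N.
by apply: eq_bigl => t; case: (bit 0 t).
Qed.

Lemma cell2_F3 al be x1 x2 : cell2 rho rel_bit al be x1 x2 =
  (`|F3 al be false x1 x2| * `|F3 al be true (~~ x1) (~~ x2)|)%N.
Proof.
rewrite /cell2 nprod_bit /F3 !absz_prod; congr (_ * _)%N; apply: eq_bigl => t; rewrite /rel_bit;
  by case: (bit 0 t); case: (bit al.+1 t); case: (bit be.+1 t); case: x1; case: x2.
Qed.

Lemma cell3_F4 al be ga x1 x2 x3 : cell3 rho rel_bit al be ga x1 x2 x3 =
  (`|F4 al be ga false x1 x2 x3| * `|F4 al be ga true (~~ x1) (~~ x2) (~~ x3)|)%N.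
Proof.
rewrite /cell3 nprod_bit /F4 !absz_prod; congr (_ * _)%N; apply: eq_bigl => t; rewrite /rel_bit;
  by case: (bit 0 t); case: (bit al.+1 t); case: (bit be.+1 t); case: (bit ga.+1 t); case: x1; case: x2; case: x3.
Qed.

Lemma area_vecs (F : bool -> bool -> bool -> int) k : area (vecs F k) =
  (`|F false (index_a k) (index_b k)| * `|F true (~~ index_a k) (~~ index_b k)|)%N.
Proof.
by case: k => [[|[|[|[|//]]]] hk]; rewrite /area /vecs /index_a /index_b //= mulnC.
Qed.

Lemma area_F3 al be k : area (vecs (F3 al be) k) = cell2 rho rel_bit al be (index_a k) (index_b k).
Proof. by rewrite area_vecs cell2_F3. Qed.

(** [x0 (+) c] makes the bit of the fourth pair relative to the pair 0, so that a part becomes a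
    triple cell. *)
Definition part al be ga c (k : 'I_4) : vec := vecs (fun x0 x1 x2 => F4 al be ga x0 x1 x2 (x0 (+) c)) k.

Lemma area_part al be ga c k :
  area (part al be ga c k) = cell3 rho rel_bit al be ga (index_a k) (index_b k) c.
Proof. by rewrite /part area_vecs cell3_F4. Qed.

Lemma vecs_parts al be ga k :
  vecs (F3 al be) k = mulv (part al be ga false k) (part al be ga true k).
Proof.
by case: k => [[|[|[|[|//]]]] hk]; rewrite /mulv /part /vecs /=; congr (_, _);
  [rewrite (F3_F4 _ _ ga _ _ _ true)|rewrite (F3_F4 _ _ ga _ _ _ false)|rewrite (F3_F4 _ _ ga _ _ _ false)|
   rewrite (F3_F4 _ _ ga _ _ _ true)|rewrite (F3_F4 _ _ ga _ _ _ false)|rewrite (F3_F4 _ _ ga _ _ _ true)|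
   rewrite (F3_F4 _ _ ga _ _ _ true)|rewrite (F3_F4 _ _ ga _ _ _ false)].
Qed.

(** The two products are the part [A false c] of [y 0 false] and the part [A true (~~ c)] of
    [y ga.+1 (~~ c)]. These two factors share [A false (~~ c)], which is coprime to [b] and cancels
    from their congruence. *)
Lemma part_balanced al be ga c : balanced b (part al be ga c).
Proof.
pose A x0 x3 := \prod_(t | (bit 0 t == x0) && (bit ga.+1 t == x3)) z t.
have eA x0 x3 : A x0 x3 = F4 al be ga x0 false false x3 * F4 al be ga x0 false true x3 *
    (F4 al be ga x0 true false x3 * F4 al be ga x0 true true x3).
  rewrite /A (prod_bit _ al.+1) (prod_bit _ be.+1) [X in _ * X](prod_bit _ be.+1) /F4.
  by congr (_ * _ * (_ * _)); apply: eq_bigl => t; rewrite -!andbA; do !case: (_ == _).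
have e1 : \prod_k orient k (part al be ga c k) = A false c.
  by rewrite prod_ord4 eA /orient /part /vecs /=; case: (c) => /=; ring.
have e2 : \prod_k orient' k (part al be ga c k) = A true (~~ c).
  by rewrite prod_ord4 eA /orient' /part /vecs /=; case: (c) => /=; ring.
have h4 : (ga.+1 < 5)%N by rewrite ltnS.
have ey0 x0 : y 0%N x0 = A x0 false * A x0 true by rewrite -atom_prod // (prod_bit _ ga.+1).
have eyg x3 : y ga.+1 x3 = A false x3 * A true x3.
  by rewrite -atom_prod // (prod_bit _ 0); congr (_ * _); apply: eq_bigl => t; rewrite andbC.
rewrite /balanced e1 e2; have [_ _ hc hd _] := hrich.
have [dv _] := hd 0%N ga.+1 false (~~ c) isT h4.
have cA x3 : coprimez b%:Z (A false x3).
  have := hc 0%N false isT; rewrite ey0 coprimezMl coprimez_sym => /andP[c1 c2].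
  by case: x3; rewrite ?c1 // coprimez_sym.
rewrite -(Gauss_dvdzr _ (cA (~~ c))).
move: dv; rewrite ey0 eyg; congr (_ %| _)%Z; case: (c) => /=; ring.
Qed.

Lemma index_ofK x1 x2 : index_a (index_of x1 x2) = x1 /\ index_b (index_of x1 x2) = x2.
Proof. by case: x1; case: x2. Qed.

Variables (G Dd D2 g : nat).
Hypotheses (g_gt0 : (0 < g)%N) (D2_gt0 : (0 < D2)%N).
Hypothesis b_large : ((2 * D2 ^ 2) ^ 2 * g ^ 5 <= b)%N.
Hypothesis b_small : (2 * D2 ^ 3 * (g ^ 2 * b) <= N)%N.

(** Without close pairs, the area bounds are the hypotheses of the combinatorial dichotomy, with
    [z = 2 D2 ^ 2]; the bound for all four areas uses [b_small]. For the vector [s] of the split one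
    of two further vectors has area at least [b / z], by the bound for pairs. *)
Lemma triple_good_split :
  (forall al be : 'I_4, al != be -> ~ close_min b N D2 (vecs (F3 al be))) ->
  exists al be : 'I_4, al != be /\ good_split b g (2 * D2 ^ 2) (vecs (F3 al be)).
Proof.
move=> far; set zz := (2 * D2 ^ 2)%N.
have zz0 : (0 < zz)%N by rewrite muln_gt0 expn_gt0 D2_gt0.
have hpair i l x1 x2 x1' x2' : i != l -> (x1, x2) != (x1', x2') ->
    (b ^ 2 <= zz ^ 2 * (cell2 rho rel_bit i l x1 x2 * cell2 rho rel_bit i l x1' x2'))%N.
  move=> il ne; have [hc _] := triple_cfg il.
  have := area_pair_large b_gt0 D2_gt0 hc (far _ _ il) (k := index_of x1 x2) (m := index_of x1' x2').
  rewrite !area_F3; have [-> ->] := index_ofK x1 x2; have [-> ->] := index_ofK x1' x2'; apply.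
  have [a1 a2] := index_ofK x1 x2; have [c1 c2] := index_ofK x1' x2'.
  by apply: contra_neq ne => e; congr (_, _); [rewrite -a1 e c1|rewrite -a2 e c2].
have htot i l : i != l -> ((b * g) ^ 4 <= cell2 rho rel_bit i l false false * cell2 rho rel_bit i l false true *
     (cell2 rho rel_bit i l true false * cell2 rho rel_bit i l true true))%N.
  move=> il; have [hc _] := triple_cfg il; have := area_total_large b_gt0 D2_gt0 hc (far _ _ il).
  have -> : (\prod_k area (vecs (F3 i l) k) = cell2 rho rel_bit i l false false * cell2 rho rel_bit i l false true *
     (cell2 rho rel_bit i l true false * cell2 rho rel_bit i l true true))%N.
    by rewrite !big_ord_recl big_ord0 !area_F3 /= muln1 !mulnA.
  move=> h; rewrite -(leq_pmul2l (_ : 0 < 4 * D2 ^ 6)%N) ?muln_gt0 ?expn_gt0 ?D2_gt0 //.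
  apply: leq_trans h; apply: leq_trans (_ : (b * (2 * D2 ^ 3 * (g ^ 2 * b))) ^ 2 <= _)%N.
    by apply: eq_leq; ring.
  by rewrite leq_exp2r // leq_mul2l b_small orbT.
have [i [l [q [s [x1 [x2 [u h1 h2]]]]]]] := good_cell_exists rho_gt0 g_gt0 zz0 b_large hpair htot.
have [il _ _ _ _] := uniq4_neq u; exists i, l; split => //.
have [hc _] := triple_cfg il.
pose j := index_of x1 x2; have [ja jb] := index_ofK x1 x2.
have [k jk] : exists k : 'I_4, j != k.
  by exists (if j == 0 then 1 else 0); case: (eqVneq j 0) => [->|].
have [m [o uj]] := uniq4_extend jk.
have [_ _ _ kmn _] := uniq4_neq uj.
have [v1 _ _ _ _] := uniq4_perm uj.
have hkm := area_pair_large b_gt0 D2_gt0 hc (far _ _ il) kmn.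
have parts k' : vecs (F3 i l) k' = mulv (part i l q false k') (part i l q true k') by exact: vecs_parts.
have big : (b * g <= area (vecs (F3 i l) j))%N by rewrite area_F3 ja jb.
have hg c : (g <= area (part i l q c j))%N by rewrite area_part ja jb.
have u4 s' s2 s3 : uniq [:: j; s'; s2; s3] -> (b <= zz * area (vecs (F3 i l) s'))%N ->
    good_split b g zz (vecs (F3 i l)).
  move=> us hb; exists s2, s3, s', j, (part i l q false), (part i l q true); split.
    move: us; rewrite /= !inE !negb_or => /and4P[/and3P[w1 w2 w3] /andP[w4 w5] w6 _].
    by rewrite w6 ![_ == s']eq_sym ![_ == j]eq_sym w1 w2 w3 w4 w5.
  by split => //; split; exact: part_balanced.
case/leq_sqr_mul: hkm => h; first exact: (u4 k m o).
apply: (u4 m k o) h.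
by have [_ _ ? _ _] := uniq4_perm uj.
Qed.

End Extract.

Lemma rich_triple (b N : nat) (y : nat -> bool -> int) (K : int) : rich b N 5 y K ->
  exists P : {ffun 'I_4 -> vec}, cfg b N P /\ line_of P = (y 0%N false, y 0%N true).
Proof.
move=> hr; have [K0 hy _ _ _] := hr.
have [T [z [bit [_ z0 _ hb]]]] := atoms K0 hy.
have [hc hl] := triple_cfg hr hb (isT : (0 : 'I_4) != 1).
exists [ffun k => vecs (F3 z bit 0 1) k].
have -> : [ffun k => vecs (F3 z bit 0 1) k] = vecs (F3 z bit 0 1) :> ('I_4 -> vec).
  by apply/funext => k; rewrite ffunE.
by [].
Qed.

Definition rich_alternatives (b N G Dd D2 g : nat) (P : 'I_4 -> vec) : Prop :=
  [\/ exists k, (G < gcdv (P k))%N,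
      (forall k, (gcdv (P k) <= G)%N) /\ small_prod b N Dd P,
      (forall k, (gcdv (P k) <= G)%N) /\ (~ small_prod b N Dd P /\ close_min b N D2 P) |
      (forall k, (gcdv (P k) <= G)%N) /\ (~ small_prod b N Dd P /\ good_split b g (2 * D2 ^ 2) P)].

(** Either some triple of the five pairs is exceptional, or all triples are without close pairs, as
    the extraction of a good split requires. *)
Lemma rich_good (b N G Dd D2 g : nat) (y : nat -> bool -> int) (K : int) : rich b N 5 y K ->
  (0 < g)%N -> (0 < D2)%N -> ((2 * D2 ^ 2) ^ 2 * g ^ 5 <= b)%N -> (2 * D2 ^ 3 * (g ^ 2 * b) <= N)%N ->
  exists P : {ffun 'I_4 -> vec}, [/\ cfg b N P, line_of P = (y 0%N false, y 0%N true) &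
    rich_alternatives b N G Dd D2 g P].
Proof.
move=> hr g0 D20 bl bs; have [K0 hy _ _ _] := hr.
have b0 : (0 < b)%N by apply: leq_trans bl; rewrite muln_gt0 !expn_gt0 muln_gt0 expn_gt0 D20 g0.
have [T [z [bit [_ z0 _ hb]]]] := atoms K0 hy.
have fin (al be : 'I_4) : al != be -> rich_alternatives b N G Dd D2 g (vecs (F3 z bit al be)) ->
    exists P : {ffun 'I_4 -> vec}, [/\ cfg b N P, line_of P = (y 0%N false, y 0%N true) &
    rich_alternatives b N G Dd D2 g P].
  move=> ab ha; exists [ffun k => vecs (F3 z bit al be) k].
  have -> : [ffun k => vecs (F3 z bit al be) k] = vecs (F3 z bit al be) :> ('I_4 -> vec).
    by apply/funext => k; rewrite ffunE.
  by have [] := triple_cfg hr hb ab.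
have cases (al be : 'I_4) : [\/ rich_alternatives b N G Dd D2 g (vecs (F3 z bit al be)) |
    (forall k, (gcdv (vecs (F3 z bit al be) k) <= G)%N) /\ ~ small_prod b N Dd (vecs (F3 z bit al be)) /\
    ~ close_min b N D2 (vecs (F3 z bit al be))].
  set V := vecs _; have [h1|h1] := pselect (exists k, (G < gcdv (V k))%N); first by left; constructor 1.
  have {}h1 k : (gcdv (V k) <= G)%N by rewrite leqNgt; apply/negP => h; apply: h1; exists k.
  have [h2|h2] := pselect (small_prod b N Dd V); first by left; constructor 2.
  have [h3|h3] := pselect (close_min b N D2 V); first by left; constructor 3.
  by right.
have [[al [be [ab h]]]|none] := pselect (exists al be : 'I_4, al != be /\ rich_alternatives b N G Dd D2 g (vecs (F3 z bit al be))).
  exact: fin ab h.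
have far al be : al != be -> ~ close_min b N D2 (vecs (F3 z bit al be)).
  move=> ab; case: (cases al be) => [h|[_ [_ //]]]; by case: none; exists al, be.
have [al [be [ab h]]] := triple_good_split b0 hr z0 hb g0 D20 bl bs far.
apply: fin ab _; case: (cases al be) => [//|[h1 [h2 _]]]; by constructor 4.
Qed.

(** The factor consists of two mixed products, each at most [N] over a determinant; the two
    determinants are opposite, with product at least [2 N / (b Dd ^ 2)]. *)
Lemma line_not_small (b N Dd : nat) (P : 'I_4 -> vec) : (0 < b)%N -> cfg b N P -> ~ small_prod b N Dd P ->
  (2 * `|(line_of P).1| <= N * (b * Dd ^ 2))%N.
Proof.
move=> b0 hP hs.
have u : uniq ([:: 0; 1; 2%:R; 3%:R] : seq 'I_4) by [].
have u1 : uniq ([:: 2%:R; 3%:R; 1; 0] : seq 'I_4) by [].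
have u2 : uniq ([:: 0; 1; 2%:R; 3%:R] : seq 'I_4) by [].
have h1 := cfg_ndet_le b0 hP u1; have h2 := cfg_ndet_le b0 hP u2.
have h3 : (2 * N <= `|ndet b (P 0%R) (P 1%R)| * `|ndet b (P 2%R) (P 3%R)| * b * Dd ^ 2)%N.
  by rewrite leqNgt; apply/negP => h; apply: hs; exists 0%R, 1%R, 2%R, 3%R; split => //; exact: ltnW.
have [N0|N0] := posnP N.
  move: h1; rewrite N0 leqn0 !muln_eq0 => /or3P[] /eqP e.
  - by have [_] := cfg_ndet hP (isT : (2%:R : 'I_4) != 3%:R); rewrite -absz_eq0 e.
  - by rewrite /line_of /= !abszM e.
  by rewrite /line_of /= !abszM e !(muln0, mul0n).
rewrite -(leq_pmul2r N0) -!mulnA [(`|_| * N)%N]mulnC mulnA.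
apply: leq_trans (leq_mul h3 (leqnn _)) _.
have := leq_mul h1 h2; rewrite /line_of /= !abszM => h.
apply: leq_trans (_ : (N * N) * (b * Dd ^ 2) <= _)%N; last by apply: eq_leq; ring.
by apply: leq_trans (leq_mul h (leqnn (b * Dd ^ 2))); apply: eq_leq; ring.
Qed.

(** * Counting rich lines *)

Section Lines.
Variable R : realFieldType.

Definition rich_line (b N : nat) (w : int * int) : Prop :=
  exists y K, [/\ rich b N 5 y K, y 0%N false = w.1 & y 0%N true = w.2].

(** Here [b] is too small for the dichotomy. Such lines are counted later through [b] and [a], both
    of which are small. *)
Definition tiny_line (N Dd D2 g b : nat) (w : int * int) : Prop :=
  (b < (2 * D2 ^ 2) ^ 2 * g ^ 5)%N /\ (2 * `|w.1| <= N * (b * Dd ^ 2))%N.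

Definition lines_const (G D Dd D2 g : nat) : R :=
  D%:R ^+ 4 * (count_const R 1 D * (4 / G%:R)) + count_const R G D * (2 / Dd%:R) +
  count_const R G D * (2 ^+ 8 * 8 * Dd%:R ^+ 2 / D2%:R) +
  split_const R G D Dd (2 * D2 ^ 2) / g%:R.

Lemma atmost_lines_b (b N G D Dd D2 g : nat) :
  (0 < b)%N -> (0 < G)%N -> (0 < Dd)%N -> (0 < D2)%N -> (0 < g)%N ->
  (2 * D2 ^ 3 * (g ^ 2 * b) <= N)%N ->
  (forall n, 0 < n -> n <= N -> size (divisors n) <= D)%N ->
  atmost (fun w => rich_line b N w /\ ~ tiny_line N Dd D2 g b w)
    (lines_const G D Dd D2 g * N%:R ^+ 2 * b%:R^-1).
Proof.
move=> b0 G0 Dd0 D20 g0 bN hD.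
have b1 : 0 < b%:R :> R by rewrite ltr0n.
have G1 : 0 < G%:R :> R by rewrite ltr0n.
have Dd1 : 0 < Dd%:R :> R by rewrite ltr0n.
have D21 : 0 < D2%:R :> R by rewrite ltr0n.
have g1 : 0 < g%:R :> R by rewrite ltr0n.
pose S1 (P : {ffun 'I_4 -> vec}) := cfg b N P /\ exists k, (G < gcdv (P k))%N.
pose S2 (P : {ffun 'I_4 -> vec}) := cfg b N P /\ (forall k, (gcdv (P k) <= G)%N) /\ small_prod b N Dd P.
pose S3 (P : {ffun 'I_4 -> vec}) := cfg b N P /\ (forall k, (gcdv (P k) <= G)%N) /\
   (~ small_prod b N Dd P /\ close_min b N D2 P).
pose S4 (P : {ffun 'I_4 -> vec}) := (g <= b)%N /\ (cfg b N P /\ (forall k, (gcdv (P k) <= G)%N) /\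
   (~ small_prod b N Dd P /\ good_split b g (2 * D2 ^ 2) P)).
have c1 : atmost S1 (D%:R ^+ 4 * (count_const R 1 D * N%:R * (4 * N%:R / (b%:R * G%:R)))).
  exact: atmost_cfg_gcd.
have c2 : atmost S2 (count_const R G D * N%:R * (2 * N%:R / (b%:R * Dd%:R))).
  exact: atmost_cfg_small.
have c3 : atmost S3 (count_const R G D * (2 ^+ 8 * (N%:R / D2%:R) * (8 * N%:R * Dd%:R ^+ 2 / b%:R))).
  exact: atmost_cfg_close.
have c4 : atmost S4 (split_const R G D Dd (2 * D2 ^ 2) * N%:R ^+ 2 / (b%:R * g%:R)).
  have [gb|gb] := leqP g b.
    have h : (0 < 2 * D2 ^ 2)%N by rewrite muln_gt0 expn_gt0 D20.
    by have hs := @atmost_good_split R b N G D Dd g _ g0 gb h Dd0 hD; apply: atmost_sub hs => P [].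
  apply: atmost0; last by move=> P [h _]; lia.
  by rewrite /split_const; do ![apply: mulr_ge0 => // | apply: exprn_ge0 => // | rewrite invr_ge0 //].
have := atmost_or (atmost_or (atmost_or c1 c2) c3) c4.
rewrite [X in atmost _ X](_ : _ = lines_const G D Dd D2 g * N%:R ^+ 2 * b%:R^-1); last first.
  by rewrite /lines_const; field; rewrite !gt_eqF.
move=> hU; apply: (@atmost_surj R _ _ _ _ (fun P : {ffun 'I_4 -> vec} => line_of P) _ _ hU) => w [[y [K [hr e1 e2]]] nt].
have ew P : line_of P = (y 0%N false, y 0%N true) -> line_of P = w.
  by rewrite e1 e2 -surjective_pairing.
have [hb|hb] := leqP ((2 * D2 ^ 2) ^ 2 * g ^ 5)%N b.
  have [P [hP el ha]] := rich_good G Dd hr g0 D20 hb bN.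
  exists P; last exact: ew.
  case: ha => h; [left; left; left|left; left; right|left; right|right] => //.
  split => //; apply: leq_trans hb; rewrite -[g in X in (X <= _)%N]expn1.
  apply: leq_trans (leq_pexp2l g0 (isT : (1 <= 5)%N)) _.
  by rewrite leq_pmull // expn_gt0 muln_gt0 expn_gt0 D20.
(* Below the threshold for [b] any triple will do: outside the first two alternatives the line would
   be tiny. *)
have [P [hP el]] := rich_triple hr.
exists P; last exact: ew.
left; left; have [h1|h1] := pselect (exists k, (G < gcdv (P k))%N); first by left.
have {}h1 k : (gcdv (P k) <= G)%N by rewrite leqNgt; apply/negP => h; apply: h1; exists k.
right; split => //; split => //; apply: contrapT => hs; apply: nt; split => //.
by rewrite -(ew P el); exact: line_not_small.
Qed.

Lemma atmost_sum (T : eqType) (P : T -> Prop) (f : T -> nat) (B : nat -> R) (n : nat) :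
  (forall x, P x -> (f x < n)%N) -> (forall k, (k < n)%N -> atmost (fun x => P x /\ f x = k) (B k)) ->
  atmost P (\sum_(k < n) B k).
Proof.
elim: n P => [|n IH] P hf hB.
  by rewrite big_ord0; apply: atmost0 => // x /hf.
rewrite big_ord_recr /=.
apply: (@atmost_sub _ _ _ (fun x => (P x /\ (f x < n)%N) \/ (P x /\ f x = n))).
  by move=> x hx; have := hf x hx; rewrite ltnS leq_eqVlt => /orP[/eqP|]; [right|left].
apply: atmost_or; last exact: hB.
apply: IH => [x []//|k kn]; apply: atmost_sub (hB k (ltnW kn)) => x [[]] //.
Qed.

(** Dyadic blocks, each of which contributes at most 1; the term [b = 0] is 0 by convention. *)
Lemma harmonic_le (k n : nat) : (n <= 2 ^ k)%N -> \sum_(b < n) (b%:R : R)^-1 <= k%:R.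
Proof.
elim: k n => [|k IH] n hn.
  by case: n hn => [|[]] // _; rewrite ?big_ord0 // big_ord1 invr0.
have [h|h] := leqP n (2 ^ k); first by apply: le_trans (IH _ h) _; rewrite ler_nat.
rewrite -(subnKC (ltnW h)) big_split_ord /= -natr1 lerD ?IH //.
have p0 : 0 < (2 ^ k)%:R :> R by rewrite ltr0n expn_gt0.
apply: (@le_trans _ _ (\sum_(i < n - 2 ^ k) (2 ^ k)%:R^-1)).
  by apply: ler_sum => i _; rewrite lef_pV2 ?posrE ?ltr0n ?addn_gt0 ?expn_gt0 // ler_nat leq_addr.
rewrite sumr_const card_ord -[X in X <= _]mulr_natl ler_pdivrMr // mul1r ler_nat.
by move: hn; rewrite expnS mul2n -addnn => ?; rewrite leq_subLR.
Qed.

(** The sum of [1 / b] is logarithmic and costs one more factor [D]. *)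
Lemma atmost_lines_small (N G D Dd D2 g : nat) :
  (0 < G)%N -> (0 < Dd)%N -> (0 < D2)%N -> (0 < g)%N -> (0 < N)%N ->
  (forall n, 0 < n -> n <= N -> size (divisors n) <= D)%N ->
  atmost (fun x : nat * (int * int) => [/\ (0 < x.1)%N, (2 * D2 ^ 3 * (g ^ 2 * x.1) <= N)%N,
       rich_line x.1 N x.2 & ~ tiny_line N Dd D2 g x.1 x.2])
    (lines_const G D Dd D2 g * N%:R ^+ 2 * D%:R).
Proof.
move=> G0 Dd0 D20 g0 N0 hD.
have L0 : 0 <= lines_const G D Dd D2 g * N%:R ^+ 2 :> R.
  rewrite /lines_const /count_const /split_const.
  by do ![apply: mulr_ge0 => // | apply: addr_ge0 => // | apply: exprn_ge0 => // | rewrite invr_ge0 //].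
pose n := N.+1.
apply: (@atmost_le _ _ _ (\sum_(b < n) lines_const G D Dd D2 g * N%:R ^+ 2 * b%:R^-1)).
  rewrite -mulr_sumr ler_wpM2l //; apply: le_trans (harmonic_le (k := (trunc_log 2 N).+1) _) _.
    by have /andP[] := trunc_log_bounds (isT : (1 < 2)%N) N0.
  rewrite ler_nat; apply: leq_trans (size_divisors_exp2 _) _; apply: hD; rewrite ?expn_gt0 //.
  by have /andP[] := trunc_log_bounds (isT : (1 < 2)%N) N0.
apply: (@atmost_sum _ _ fst (fun b => lines_const G D Dd D2 g * N%:R ^+ 2 * b%:R^-1)) => [[b w] [b0 hb _ _]|b _] /=.
  rewrite ltnS; apply: leq_trans hb; rewrite mulnA leq_pmull //.
  by rewrite muln_gt0 muln_gt0 !expn_gt0 D20 g0.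
have [b0|b0] := posnP b.
  by apply: atmost0; [rewrite mulr_ge0 ?invr_ge0|move=> [b' w] [[/= h _ _ _] e]; move: h; rewrite e b0].
have [hb|hb] := leqP (2 * D2 ^ 3 * (g ^ 2 * b)) N; last first.
  by apply: atmost0; [rewrite mulr_ge0 ?invr_ge0|move=> [b' w] [[/= _ h _ _] e]; move: h; rewrite e; lia].
apply: (atmost_inj (f := snd)) (atmost_lines_b b0 G0 Dd0 D20 g0 hb hD).
  by move=> [b' w] [[/= _ _ h1 h2] <-].
by move=> [b1 w1] [b2 w2] [_ /= ->] [_ /= ->] ->.
Qed.

Lemma coprimez_dvd_sqr (b A x : int) : coprimez A b -> (b ^+ 2 %| A * x)%Z -> (b ^+ 2 %| x)%Z.
Proof. by move=> c; rewrite Gauss_dvdzr // coprimez_sym coprimezXr. Qed.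

(** [t i] is [(A + A' - y - y') / b ^ 2], an integer because [b ^ 2 * (d i * e i) = A (A + A' - y -
    y')] with [A] coprime to [b]. It is nonzero and injective in [i] since two factorizations of [K]
    with the same sum coincide. *)
Lemma rich_three_sols (b N T : nat) (w : int * int) : (0 < b)%N -> (2 * N <= b * T)%N -> rich_line b N w ->
  exists2 j, w.1 - w.2 = b%:Z * j & three_sols N T (b%:Z, w.1, j).
Proof.
move=> b0 hT [y [K [[K0 hy hc hd hn] e1 e2]]].
have b1 : b%:Z != 0 by rewrite eqz_nat -lt0n.
have dz i c j d : (i < 5)%N -> (j < 5)%N ->
    y i c - y j d = b%:Z * ((y i c - y j d)%R %/ b%:Z)%Z /\ `|((y i c - y j d)%R %/ b%:Z)%Z| <= N%:Z.
  move=> hi hj; have [h1 h2] := hd i j c d hi hj.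
  have e : y i c - y j d = b%:Z * ((y i c - y j d)%R %/ b%:Z)%Z by rewrite mulrC divzK.
  split => //; move: h2; rewrite {1}e abszM /= leq_pmul2l //; clear; move: (divz _ _); lia.
have A0 : w.1 != 0 by have := K0; rewrite -(hy 0%N isT) e1 mulf_eq0 negb_or => /andP[].
have A'0 : w.2 != 0 by have := K0; rewrite -(hy 0%N isT) e2 mulf_eq0 negb_or => /andP[].
have [ej _] := dz 0%N false 0%N true isT isT.
rewrite e1 e2 in ej; move: ((w.1 - w.2)%R %/ b%:Z)%Z ej => j ej.
exists j => //; split => //.
  by move=> h; case/eqP: A'0; rewrite -[w.2](subKr w.1) ej -h subrr.
have i5 (i : 'I_3) : (i.+1 < 5)%N by case: i => i /= hi; apply: leq_trans (_ : (i.+2 <= 4)%N) _.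
have [d hdi] : exists d : 'I_3 -> int, forall i : 'I_3, w.1 - y i.+1 false = b%:Z * d i /\ `|d i| <= N%:Z.
  by exists (fun i : 'I_3 => ((y 0%N false - y i.+1 false)%R %/ b%:Z)%Z) => i; rewrite -e1; apply: dz.
have [e hei] : exists e : 'I_3 -> int, forall i : 'I_3, w.1 - y i.+1 true = b%:Z * e i /\ `|e i| <= N%:Z.
  by exists (fun i : 'I_3 => ((y 0%N false - y i.+1 true)%R %/ b%:Z)%Z) => i; rewrite -e1; apply: dz.
have hK (i : 'I_3) : y i.+1 false * y i.+1 true = w.1 * w.2 by rewrite hy // -e1 -e2 hy.
have id (i : 'I_3) : b%:Z ^+ 2 * (d i * e i) = w.1 * (w.1 + w.2 - y i.+1 false - y i.+1 true).
  have -> : b%:Z ^+ 2 * (d i * e i) = (b%:Z * d i) * (b%:Z * e i) by ring.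
  rewrite -(hdi i).1 -(hei i).1.
  have -> : (w.1 - y i.+1 false) * (w.1 - y i.+1 true) = w.1 * (w.1 - y i.+1 false - y i.+1 true) + y i.+1 false * y i.+1 true by ring.
  by rewrite hK; ring.
have cA : coprimez w.1 b%:Z by rewrite -e1; exact: hc.
pose t (i : 'I_3) := ((w.1 + w.2 - y i.+1 false - y i.+1 true)%R %/ b%:Z ^+ 2)%Z.
have ht (i : 'I_3) : w.1 + w.2 - y i.+1 false - y i.+1 true = b%:Z ^+ 2 * t i.
  by rewrite mulrC divzK //; apply: (coprimez_dvd_sqr cA); rewrite -id dvdz_mulr.
have b2 : b%:Z ^+ 2 != 0 by rewrite expf_neq0.
have dist i k (c : bool) : (i < 5)%N -> (k < 5)%N -> i != k -> y i false + y i true <> y k false + y k true.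
  move=> hi hk ik es.
  have : (y i c - y k false) * (y i c - y k true) = 0.
    have -> : (y i c - y k false) * (y i c - y k true) = y i c * (y i c - (y k false + y k true)) + y k false * y k true by ring.
    by rewrite -es hy // -(hy i hi); clear; case: c; ring.
  move/eqP; rewrite mulf_eq0 !subr_eq0 => /orP[] /eqP h.
    by have := hn i k c false hi hk ik; rewrite h eqxx.
  by have := hn i k c true hi hk ik; rewrite h eqxx.
exists d, e, t; split.
- by move=> i; apply: (mulfI b2); rewrite id ht; ring.
- move=> i; apply: (mulfI b1); rewrite mulrDr -(hdi i).1 -(hei i).1 mulrDr -ej.
  by rewrite mulrA -expr2 -ht; ring.
- move=> i k eik; apply/eqP; apply: contraT => nik.
  case: (dist i.+1 k.+1 false (i5 i) (i5 k)); first by rewrite eqSS.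
  have := ht i; rewrite eik -ht; clear; move: (y _ _) (y _ _) (y _ _) (y _ _); lia.
- move=> i; split.
    apply/eqP => t0; case: (dist 0%N i.+1 false isT (i5 i)) => //.
    by have := ht i; rewrite t0 mulr0 e1 e2; clear; move: (y _ _) (y _ _); lia.
  have [h1 _] := hdi i.
  have [_ h2] := hd 0%N i.+1 false false isT (i5 i); have [_ h3] := hd 0%N i.+1 true true isT (i5 i).
  have h4 : (absz (b%:Z ^+ 2 * t i)%R <= 2 * (b * N))%N.
    rewrite -ht; rewrite e1 in h2; rewrite e2 in h3; clear -h2 h3.
    by move: (y _ _) (y _ _) h2 h3; lia.
  have : (`|t i| <= T)%N.
    rewrite -(leq_pmul2l (_ : 0 < b ^ 2)%N) ?expn_gt0 ?b0 //.
    move: h4; rewrite abszM abszX /= => h4; apply: leq_trans h4 _.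
    rewrite mulnCA -[(b ^ 2)%N]mulnn -mulnA leq_pmul2l //.
  by clear; lia.
move=> i; split; [exact: (hdi i).2|exact: (hei i).2].
Qed.

Lemma atmost_lines_large (N T Y D : nat) : (N ^ 7 <= Y ^ 4)%N ->
  (forall n, 0 < n -> n <= Y * T -> size (divisors n) <= D)%N ->
  atmost (fun x : nat * (int * int) => [/\ (0 < x.1)%N, (2 * N <= x.1 * T)%N & rich_line x.1 N x.2])
    ((Y.*2.+1)%:R * (T.*2.+1)%:R ^+ 3 * (D%:R * 2) ^+ 3 : R).
Proof.
move=> hY hD.
apply: (atmost_inj (f := fun x : nat * (int * int) => (x.1%:Z, x.2.1, ((x.2.1 - x.2.2) %/ x.1%:Z)%Z)))
  (@atmost_three_sols R N T Y D hY hD).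
  move=> [b w] /= [b0 hT hr]; have [j ej h] := rich_three_sols b0 hT hr.
  have -> : ((w.1 - w.2) %/ b%:Z)%Z = j by rewrite ej mulKz // eqz_nat -lt0n.
  exact: h.
move=> [b w] [b' w'] /= [b0 hT hr] [b0' hT' hr'] [eb ew ej]; subst b'.
have [j e h] := rich_three_sols b0 hT hr; have [j' e' h'] := rich_three_sols b0 hT' hr'.
have b1 : b%:Z != 0 by rewrite eqz_nat -lt0n.
move: ej; rewrite e e' !mulKz // => jj; congr (_, _).
rewrite (surjective_pairing w) (surjective_pairing w') ew; congr (_, _).
by apply: oppr_inj; apply: (@addrI _ w'.1); rewrite -{1}ew e e' jj.
Qed.

End Lines.

(* Thresholds with [z << G << Dd << D2 << g], each absorbing the losses caused by the
   preceding ones. *)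
Definition par_G (z : nat) : nat := (z ^ 28)%N.
Definition par_Dd (z : nat) : nat := (par_G z ^ 3)%N.
Definition par_D2 (z : nat) : nat := (par_Dd z ^ 3)%N.
Definition par_g (z : nat) : nat := (par_D2 z ^ 4)%N.

Lemma root4 (N : nat) : exists M, (M ^ 4 <= N < M.+1 ^ 4)%N.
Proof.
have h0 : exists M, (M ^ 4 <= N)%N by exists 0%N.
have hb M : (M ^ 4 <= N)%N -> (M <= N)%N by apply: leq_trans; case: M => // M; rewrite -{1}[M.+1]expn1 leq_pexp2l.
have [M hM hmax] := ex_maxnP h0 hb; exists M; rewrite hM /= ltnNge; apply/negP => /hmax; by rewrite ltnn.
Qed.

Section Lines.
Variable R : realFieldType.

Lemma div_le_const (x y u w k : R) : 0 < y -> 0 < w -> 0 <= k -> x <= k * u -> u * w <= y -> x / y <= k / w.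
Proof.
move=> y0 w0 k0 hx hy; rewrite ler_pdivrMr // mulrAC ler_pdivlMr //.
apply: le_trans (_ : k * u * w <= _); first by rewrite ler_pM2r.
by rewrite -mulrA ler_wpM2l.
Qed.

(** [28 = 23 + 5] makes [D ^ 23 / G] of size [z ^ -5]. The exponents 3, 3 and 4 of the later
    thresholds absorb the numerators [G ^ 2], [G ^ 2 Dd ^ 2] and [G ^ 3 D2 ^ 2 Dd ^ 2]. *)
Lemma lines_const_le (Kc z D : nat) : (0 < z)%N -> (D <= Kc * z)%N ->
  lines_const R (par_G z) D (par_Dd z) (par_D2 z) (par_g z) * D%:R <=
  (480 * 32 ^+ 2 * 4 * Kc%:R ^+ 23 + 480 * 32 ^+ 2 * 2 * Kc%:R ^+ 19 + 480 * 32 ^+ 2 * 2 ^+ 8 * 8 * Kc%:R ^+ 19 +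
   120 * 2 ^+ 14 * 32 ^+ 3 * 250 * 2 * Kc%:R ^+ 31) / z%:R ^+ 5.
Proof.
move=> z0 hD; have z1 : 1 <= z%:R :> R by rewrite ler1n.
have zp n : 1 <= z%:R ^+ n :> R by rewrite exprn_ege1.
pose G : R := (par_G z)%:R; pose Dd : R := (par_Dd z)%:R; pose D2 : R := (par_D2 z)%:R; pose g : R := (par_g z)%:R.
have eG : G = z%:R ^+ 28 by rewrite /G natrX.
have eDd : Dd = G ^+ 3 by rewrite /Dd natrX.
have eD2 : D2 = Dd ^+ 3 by rewrite /D2 natrX.
have eg : g = D2 ^+ 4 by rewrite /g natrX.
have G1 : 1 <= G by rewrite eG.
have Dd1 : 1 <= Dd by rewrite eDd exprn_ege1.
have D21 : 1 <= D2 by rewrite eD2 exprn_ege1.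
have g1 : 1 <= g by rewrite eg exprn_ege1.
have hDr n : D%:R ^+ n <= Kc%:R ^+ n * z%:R ^+ n :> R.
  by rewrite -exprMn -natrM; apply: lerXn2r; rewrite ?nnegrE ?ler0n // ler_nat.
have K0 n : 0 <= Kc%:R ^+ n :> R by rewrite exprn_ge0.
have w0 : 0 < z%:R ^+ 5 :> R by apply: lt_le_trans (zp 5).
have P0 x : 1 <= x -> 0 < x :> R by apply: lt_le_trans.
have GG n : 1 <= G ^+ n by rewrite exprn_ege1.
have t1 : D%:R ^+ 23 / G <= Kc%:R ^+ 23 / z%:R ^+ 5.
  by apply: div_le_const (P0 _ G1) w0 (K0 _) (hDr _) _; rewrite -exprD eG.
have Q0 x : 1 <= x -> 0 <= x :> R by move=> h; rewrite ltW ?P0.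
have GD n : 1 <= Dd ^+ n by rewrite exprn_ege1.
have GD2 n : 1 <= D2 ^+ n by rewrite exprn_ege1.
have t2 : D%:R ^+ 19 * G ^+ 2 / Dd <= Kc%:R ^+ 19 / z%:R ^+ 5.
  apply: (@div_le_const _ _ (z%:R ^+ 19 * G ^+ 2)) (P0 _ Dd1) w0 (K0 _) _ _.
    by rewrite mulrA; apply: (ler_wpM2r (Q0 _ (GG 2))); exact: hDr.
  rewrite mulrAC -exprD eDd [G ^+ 3]exprS; apply: (ler_wpM2r (Q0 _ (GG 2))).
  by rewrite eG ler_weXn2l.
have t3 : D%:R ^+ 19 * G ^+ 2 * Dd ^+ 2 / D2 <= Kc%:R ^+ 19 / z%:R ^+ 5.
  apply: (@div_le_const _ _ (z%:R ^+ 19 * G ^+ 2 * Dd ^+ 2)) (P0 _ D21) w0 (K0 _) _ _.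
    rewrite 2!(mulrA (Kc%:R ^+ 19)); apply: (ler_wpM2r (Q0 _ (GD 2))); apply: (ler_wpM2r (Q0 _ (GG 2))); exact: hDr.
  rewrite mulrAC eD2 [Dd ^+ 3]exprS; apply: (ler_wpM2r (Q0 _ (GD 2))).
  rewrite mulrAC -exprD eDd [G ^+ 3]exprS; apply: (ler_wpM2r (Q0 _ (GG 2))).
  by rewrite eG ler_weXn2l.
have t4 : D%:R ^+ 31 * G ^+ 3 * D2 ^+ 2 * Dd ^+ 2 / g <= Kc%:R ^+ 31 / z%:R ^+ 5.
  apply: (@div_le_const _ _ (z%:R ^+ 31 * G ^+ 3 * D2 ^+ 2 * Dd ^+ 2)) (P0 _ g1) w0 (K0 _) _ _.
    rewrite 3!(mulrA (Kc%:R ^+ 31)); apply: (ler_wpM2r (Q0 _ (GD 2))); apply: (ler_wpM2r (Q0 _ (GD2 2))).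
    by apply: (ler_wpM2r (Q0 _ (GG 3))); exact: hDr.
  rewrite eg (exprD D2 2 2) [_ * Dd ^+ 2 * _](_ : _ = z%:R ^+ 31 * z%:R ^+ 5 * G ^+ 3 * Dd ^+ 2 * D2 ^+ 2); last by ring.
  apply: (ler_wpM2r (Q0 _ (GD2 2))).
  rewrite eD2 -exprM (exprD Dd 4 2); apply: (ler_wpM2r (Q0 _ (GD 2))).
  rewrite eDd -exprM (exprD G 9 3); apply: (ler_wpM2r (Q0 _ (GG 3))).
  by rewrite -exprD eG -exprM ler_weXn2l.
set c1 := 480 * 32 ^+ 2.
have -> : lines_const R (par_G z) D (par_Dd z) (par_D2 z) (par_g z) * D%:R =
  c1 * 4 * (D%:R ^+ 23 / G) + c1 * 2 * (D%:R ^+ 19 * G ^+ 2 / Dd) + c1 * 2 ^+ 8 * 8 * (D%:R ^+ 19 * G ^+ 2 * Dd ^+ 2 / D2) +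
  120 * 2 ^+ 14 * 32 ^+ 3 * 250 * 2 * (D%:R ^+ 31 * G ^+ 3 * D2 ^+ 2 * Dd ^+ 2 / g).
  have e2 : (2 * par_D2 z ^ 2)%:R = 2 * D2 ^+ 2 :> R by rewrite natrM (natrX _ (par_D2 z)).
  rewrite /lines_const /count_const /split_const e2 -/G -/Dd -/D2 -/g /c1 expr1n mulr1.
  have := And4 (lt0r_neq0 (P0 _ G1)) (lt0r_neq0 (P0 _ Dd1)) (lt0r_neq0 (P0 _ D21)) (lt0r_neq0 (P0 _ g1)).
  by move=> [n1 n2 n3 n4]; field; rewrite n1 n2 n3 n4.
have c0 : 0 <= c1 by rewrite /c1 mulr_ge0 ?exprn_ge0.
pose c2 : R := 120 * 2 ^+ 14 * 32 ^+ 3 * 250 * 2.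
have c20 : 0 <= c2 by rewrite /c2; do ![apply: mulr_ge0 => // | apply: exprn_ge0 => //].
have c80 : 0 <= 2 ^+ 8 :> R by rewrite exprn_ge0.
rewrite -/c2 [X in _ <= X](_ : _ = c1 * 4 * (Kc%:R ^+ 23 / z%:R ^+ 5) + c1 * 2 * (Kc%:R ^+ 19 / z%:R ^+ 5) +
  c1 * 2 ^+ 8 * 8 * (Kc%:R ^+ 19 / z%:R ^+ 5) + c2 * (Kc%:R ^+ 31 / z%:R ^+ 5)); last first.
  by field; rewrite gt_eqF // (lt_le_trans ltr01).
by do !apply: lerD; apply: ler_wpM2l => //; do ![apply: mulr_ge0 => //].
Qed.

(** For [b] near [N] the count [Y T ^ 3 D ^ 3] has [Y] about [N ^ (7/4)], a saving of [N ^ (1/4)].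
    It has to cover [D2 ^ 41]: 33 from [T ^ 3], 3 from [D ^ 3] and 5 from [z ^ 5]. Hence the
    exponent [164 = 4 * 41]. *)
Lemma rich_lines (Kc : nat) : exists2 C : R, 0 <= C & forall z N D : nat,
  (0 < z)%N -> (D <= Kc * z)%N -> (forall n, 0 < n -> n <= 512 * N ^ 2 -> size (divisors n) <= D)%N ->
  (par_D2 z ^ 164 <= N)%N ->
  atmost (fun x : nat * (int * int) => (0 < x.1)%N /\ (rich_line x.1 N x.2 /\
      ~ tiny_line N (par_Dd z) (par_D2 z) (par_g z) x.1 x.2))
    (C * N%:R ^+ 2 / z%:R ^+ 5).
Proof.
set C1 : R := 480 * 32 ^+ 2 * 4 * Kc%:R ^+ 23 + 480 * 32 ^+ 2 * 2 * Kc%:R ^+ 19 + 480 * 32 ^+ 2 * 2 ^+ 8 * 8 * Kc%:R ^+ 19 +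
   120 * 2 ^+ 14 * 32 ^+ 3 * 250 * 2 * Kc%:R ^+ 31.
pose C2 : R := 384 * 9 ^+ 3 * 8 * Kc%:R ^+ 3.
have C10 : 0 <= C1.
  by rewrite /C1; do ![apply: mulr_ge0 => // | apply: addr_ge0 => // | apply: exprn_ge0 => //].
have C20 : 0 <= C2.
  by rewrite /C2; do ![apply: mulr_ge0 => // | apply: exprn_ge0 => //].
exists (C1 + C2); first exact: addr_ge0.
move=> z N D z0 hDz hD hN.
set G := par_G z; set Dd := par_Dd z; set D2 := par_D2 z; set g := par_g z.
have G0 : (0 < G)%N by rewrite expn_gt0 z0.
have Dd0 : (0 < Dd)%N by rewrite expn_gt0 G0.
have D20 : (0 < D2)%N by rewrite expn_gt0 Dd0.
have g0 : (0 < g)%N by rewrite expn_gt0 D20.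
have N0 : (0 < N)%N by apply: leq_trans hN; rewrite expn_gt0 D20.
have zD2 : (z <= D2)%N.
  have up x k : (0 < x)%N -> (0 < k)%N -> (x <= x ^ k)%N by move=> x0 k0; rewrite -{1}[x]expn1 leq_pexp2l.
  by apply: leq_trans (up _ 28 z0 isT) _; apply: leq_trans (up _ 3 G0 isT) _; apply: up.
have hD1 n : (0 < n -> n <= N -> size (divisors n) <= D)%N.
  by move=> n0 hn; apply: hD => //; apply: leq_trans hn _; rewrite -mulnn mulnA leq_pmull // muln_gt0 N0.
have [M /andP[M1 M2]] := root4 N.
have DM : (D2 ^ 41 <= M)%N.
  have := leq_ltn_trans hN M2; rewrite (_ : 164 = 41 * 4)%N // expnM ltn_exp2r //.
have M0 : (0 < M)%N by apply: leq_trans DM; rewrite expn_gt0 D20.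
(* [T] is chosen so that [2 N <= b T] when [2 D2 ^ 3 g ^ 2 b > N], with [g = D2 ^ 4]. *)
pose Y := (M.+1 ^ 7)%N; pose T := (4 * D2 ^ 11)%N.
have Y1 : (Y <= 128 * M ^ 7)%N.
  apply: leq_trans (_ : (2 * M) ^ 7 <= _)%N; first by rewrite leq_exp2r // mul2n -addnn -addn1 leq_add2l.
  by rewrite expnMn.
have Y0 : (0 < Y)%N by rewrite expn_gt0.
have DD n : (n <= 41)%N -> (D2 ^ n <= M)%N by move=> hn; apply: leq_trans DM; rewrite leq_pexp2l.
have M8 : (M ^ 8 <= N ^ 2)%N by rewrite (_ : 8 = 4 * 2)%N // expnM leq_exp2r.
have hNY : (N ^ 7 <= Y ^ 4)%N.
  by rewrite /Y -expnM mulnC expnM leq_exp2r // ltnW.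
have hYT n : (0 < n -> n <= Y * T -> size (divisors n) <= D)%N.
  move=> n0 hn; apply: hD => //; apply: leq_trans hn _.
  apply: leq_trans (leq_mul Y1 (leq_mul (leqnn 4) (DD 11%N isT))) _.
  apply: leq_trans (leq_mul (leqnn 512) M8); apply: eq_leq.
  by rewrite (expnSr M 7); ring.
have c1 := atmost_lines_small R G0 Dd0 D20 g0 N0 hD1.
have c2 := @atmost_lines_large R N T Y D hNY hYT.
have zr : 0 < z%:R ^+ 5 :> R by rewrite exprn_gt0 // ltr0n.
have b1 : lines_const R G D Dd D2 g * N%:R ^+ 2 * D%:R <= C1 * N%:R ^+ 2 / z%:R ^+ 5.
  rewrite mulrAC [X in _ <= X]mulrAC; apply: ler_wpM2r; first exact: sqr_ge0.
  exact: lines_const_le.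
have b2 : (Y.*2.+1)%:R * (T.*2.+1)%:R ^+ 3 * (D%:R * 2) ^+ 3 <= C2 * N%:R ^+ 2 / z%:R ^+ 5.
  rewrite ler_pdivlMr // /C2 -!natrX -!natrM -!natrX -!natrM ler_nat.
  have k1 : (Y.*2.+1 <= 384 * M ^ 7)%N by clear -Y1 Y0; move: (M ^ 7)%N Y1; lia.
  have k2 : (T.*2.+1 <= 9 * D2 ^ 11)%N.
    by have := expn_gt0 D2 11; rewrite D20 /T; clear; move: (D2 ^ 11)%N; lia.
  have k3 : (D * 2 <= Kc * D2 * 2)%N by rewrite leq_mul2r (leq_trans hDz) // leq_mul2l zD2 orbT.
  apply: leq_trans (leq_mul (leq_mul (leq_mul k1 (_ : _ <= (9 * D2 ^ 11) ^ 3)%N) (_ : _ <= (Kc * D2 * 2) ^ 3)%N) (_ : _ <= D2 ^ 5)%N) _.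
  - by rewrite leq_exp2r.
  - by rewrite leq_exp2r.
  - by rewrite leq_exp2r.
  apply: leq_trans (_ : (384 * 9 ^ 3 * 8 * Kc ^ 3) * M ^ 8 <= _)%N; last by rewrite leq_mul2l M8 orbT.
  rewrite (expnSr M 7) mulnA; apply: leq_trans (leq_mul (leqnn _) DM).
  apply: eq_leq; rewrite (_ : 41 = 11 * 3 + 3 + 5)%N // !expnD expnM !expnMn.
  move: (M ^ 7)%N (D2 ^ 11)%N => m d; ring.
clearbody C1 C2.
have e12 : (C1 + C2) * N%:R ^+ 2 / z%:R ^+ 5 = C1 * N%:R ^+ 2 / z%:R ^+ 5 + C2 * N%:R ^+ 2 / z%:R ^+ 5.
  by rewrite mulrDl mulrDl.
rewrite e12; have c3 := atmost_le (lerD b1 b2) (atmost_or c1 c2).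
apply: atmost_sub c3 => -[b w] /= [h0 [h1 h2]].
have [h|h] := leqP (2 * D2 ^ 3 * (g ^ 2 * b)) N; [left; split => //|right; split => //].
rewrite /T (_ : 4 * D2 ^ 11 = 2 * (2 * D2 ^ 3 * g ^ 2))%N.
  by apply: leq_trans (leq_mul (leqnn 2) (ltnW h)) _; apply: eq_leq; ring.
by rewrite /g /par_g -/D2 -expnM (_ : 11 = 3 + 4 * 2)%N // expnD; ring.
Qed.

End Lines.

(** * Short intervals *)

Lemma Fp_int_eq0 (p : nat) (z : int) : prime p -> ((z%:~R : 'F_p) == 0) = (p%:Z %| z)%Z.
Proof.
move=> pp; have h n : ((n%:R : 'F_p) == 0) = (p %| n)%N by rewrite (dvdn_pcharf (pchar_Fp pp)).
by case: z => n; rewrite dvdzE /=; [exact: h|rewrite NegzE rmorphN oppr_eq0; exact: h].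
Qed.

Lemma Fp_int_eq (p : nat) (x y : int) : prime p -> ((x%:~R : 'F_p) == y%:~R) = (p%:Z %| x - y)%Z.
Proof. by move=> pp; rewrite -Fp_int_eq0 // rmorphB subr_eq0. Qed.

(** Pigeonhole: the residues of [i t] for [0 <= i <= B] are sorted into [B] intervals of length
    [p / B]. Dividing [b] and [a] by their gcd preserves the congruence because the gcd is at most
    [B < p]. *)
Lemma dirichlet (p B : nat) (t : int) : prime p -> (0 < B < p)%N ->
  exists b a, [/\ (0 < b <= B)%N, (`|a| * B <= p)%N, coprimez a b%:Z & (p%:Z %| b%:Z * t - a)%Z].
Proof.
move=> pp /andP[B0 Bp]; have p0 := prime_gt0 pp.
pose r (i : nat) : nat := absz (i%:Z * t %% p%:Z)%Z.
have pz : p%:Z != 0 by rewrite eqz_nat -lt0n.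
have er i : (r i)%:Z = (i%:Z * t %% p%:Z)%Z by rewrite /r gez0_abs // modz_ge0.
have rp i : (r i < p)%N by rewrite -ltz_nat er ltz_pmod.
have [i [j [ij iB hij]]] : exists i j, [/\ (i < j)%N, (j <= B)%N & (r i * B %/ p = r j * B %/ p)%N].
  have hf (k : 'I_B.+1) : (r k * B %/ p < B)%N by rewrite ltn_divLR // mulnC ltn_mul2l B0 rp.
  pose f (k : 'I_B.+1) := Ordinal (hf k).
  have /injectivePn[k [l kl fkl]] : ~~ injectiveb f.
    apply/negP => /injectiveP/leq_card; by rewrite !card_ord ltnn.
  have e : (r k * B %/ p = r l * B %/ p)%N by have := congr1 val fkl.
  have [h|h|h] := ltngtP k l.
  - by exists k, l; split => //; rewrite -ltnS.
  - by exists l, k; split => //; rewrite -ltnS.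
  by case/eqP: kl; apply: val_inj.
pose b0 := (j - i)%N; pose a0 : int := (r j)%:Z - (r i)%:Z.
have b00 : (0 < b0)%N by rewrite subn_gt0.
have a0B : (`|a0| * B < p)%N.
  have h1 := leq_trunc_div (r i * B) p; have h2 := ltn_ceil (r i * B) p0.
  have h3 := leq_trunc_div (r j * B) p; have h4 := ltn_ceil (r j * B) p0.
  rewrite -hij in h3 h4; rewrite mulSn in h2 h4.
  rewrite -[B]/(`|B%:Z|%N) -abszM /a0 mulrBl -!PoszM; clear -h1 h2 h3 h4.
  by move: (r i * B)%N (r j * B)%N h1 h2 h3 h4 => x y; move: (_ %/ _ * _)%N => w; lia.
have dv : (p%:Z %| b0%:Z * t - a0)%Z.
  rewrite /b0 -subzn 1?ltnW // /a0 !er.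
  have h (k : nat) : (p%:Z %| k%:Z * t - (k%:Z * t %% p%:Z)%Z)%Z.
    by rewrite {1}(divz_eq (k%:Z * t) p%:Z) addrK dvdz_mull.
  have -> : (j%:Z - i%:Z) * t - ((j%:Z * t %% p%:Z)%Z - (i%:Z * t %% p%:Z)%Z) =
     (j%:Z * t - (j%:Z * t %% p%:Z)%Z) - (i%:Z * t - (i%:Z * t %% p%:Z)%Z) by ring.
  by apply: rpredB.
pose g := gcdz a0 b0%:Z.
have g0 : g != 0 by rewrite gcdz_eq0 negb_and orbC eqz_nat -lt0n b00.
have eb : b0%:Z = (b0%:Z %/ g)%Z * g by rewrite divzK // dvdz_gcdr.
have ea : a0 = (a0 %/ g)%Z * g by rewrite divzK // dvdz_gcdl.
have gp : (0 < g)%R by rewrite lt_neqAle eq_sym g0.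
set b1 := (b0%:Z %/ g)%Z in eb; set a1 := (a0 %/ g)%Z in ea.
have b1p : 0 < b1 by rewrite -(pmulr_lgt0 _ gp) -eb.
have g1 : (0 < `|g|)%N by rewrite absz_gt0.
have eb1 : (`|b1|)%:Z = b1 by rewrite gtz0_abs.
have b1B : (`|b1| <= b0)%N.
  by rewrite -[b0]/(`|b0%:Z|%N) eb abszM leq_pmulr.
exists `|b1|%N, a1; split.
- by rewrite absz_gt0 gt_eqF //= (leq_trans b1B) // /b0 leq_subLR (leq_trans iB) // leq_addl.
- apply: leq_trans (ltnW a0B); rewrite leq_mul2r; apply/orP; right.
  by rewrite {1}ea abszM leq_pmulr.
- rewrite eb1 /coprimez -(inj_eq (mulIf g0)) mul1r.
  have -> : gcdz a1 b1 * g = gcdz (a1 * g) (b1 * g) by rewrite -mulz_gcdl // gtz0_abs.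
  by rewrite -ea -eb.
rewrite eb1; have : (p%:Z %| (b1 * t - a1) * g)%Z.
  by have -> : (b1 * t - a1) * g = b0%:Z * t - a0 by rewrite eb ea; ring.
rewrite Gauss_dvdzl //.
have gB : (`|g| <= B)%N.
  have : (`|g| <= b0)%N by rewrite -[b0]/(`|b0%:Z|%N) eb abszM leq_pmull // absz_gt0 gt_eqF.
  by move=> h; apply: leq_trans h _; rewrite /b0 leq_subLR (leq_trans iB) // leq_addl.
rewrite /coprimez /gcdz /= eqz_nat -/(coprime p `|g|) prime_coprime //.
by apply/negP => /dvdn_leq h; have := leq_trans (h g1) gB; rewrite leqNgt Bp.
Qed.

Lemma atmost_residue (R : realFieldType) (L p : nat) (c0 : int) : (0 < p)%N ->
  atmost (fun x : int => (`|x| <= L)%N /\ (p%:Z %| x - c0)%Z) (((2 * L %/ p)%N.+1)%:R : R).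
Proof.
move=> p0; have pz : p%:Z != 0 by rewrite eqz_nat -lt0n.
refine (@atmost_inj R _ _ _ (fun k : nat => (k < (2 * L %/ p).+1)%N) (fun x : int => (absz (x + L%:Z)%R %/ p)%N) _ _ _ (@atmost_nat R _)).
  by move=> x [hx _]; rewrite ltnS; apply: leq_div2r; lia.
move=> x y [hx dx] [hy dy] e.
have dxy : (p%:Z %| (x + L%:Z) - (y + L%:Z))%Z.
  have -> : (x + L%:Z) - (y + L%:Z) = (x - c0) - (y - c0) by ring.
  by apply: rpredB.
have hx0 : x + L%:Z = (absz (x + L%:Z))%:Z by clear -hx; lia.
have hy0 : y + L%:Z = (absz (y + L%:Z))%:Z by clear -hy; lia.
move: e dxy; rewrite hx0 hy0; move: (absz (x + L%:Z)) (absz (y + L%:Z)) hx0 hy0 => u v hx0 hy0 e dxy.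
suff : u = v by clear -hx0 hy0; lia.
rewrite (divn_eq u p) (divn_eq v p) e; congr (_ + _)%N; apply/eqP.
wlog vu : u v e dxy {hx0 hy0} / (v <= u)%N.
  move=> h; have [le|le] := leqP v u; first exact: (h u v).
  by rewrite eq_sym; apply: h => //; [rewrite -rpredN opprB|exact: ltnW].
by rewrite eqn_mod_dvd //; move: dxy; rewrite subzn.
Qed.

Lemma sqr_sum_le (I : Type) (r : seq I) (f : I -> nat) :
  ((\sum_(i <- r) f i) ^ 2 <= size r * \sum_(i <- r) f i ^ 2)%N.
Proof.
elim: r => [|x r IH]; first by rewrite !big_nil.
rewrite !big_cons /=.
have h : (2 * (f x * \sum_(i <- r) f i) <= size r * f x ^ 2 + \sum_(i <- r) f i ^ 2)%N.
  elim: r {IH} => [|y r IH]; first by rewrite !big_nil muln0.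
  have h : (2 * (f x * f y) <= f x ^ 2 + f y ^ 2)%N by case: (nat_Cauchy (f x) (f y)).
  rewrite !big_cons /= mulnDr mulnDr mulSn.
  apply: leq_trans (leq_add h IH) _; apply: eq_leq; ring.
apply: leq_trans (_ : f x ^ 2 + (2 * (f x * \sum_(i <- r) f i) + (\sum_(i <- r) f i) ^ 2) <= _)%N.
  by apply: eq_leq; ring.
apply: leq_trans (leq_add (leqnn _) (leq_add h IH)) _; apply: eq_leq; ring.
Qed.

(** Cauchy-Schwarz over the values of [key]; the sum on the right is that of the squares of the
    fibre sizes. *)
Lemma card_sqr_fibers (T : finType) (K : eqType) (key : T -> K) (A : {set T}) (Z : nat) :
  (size (undup (map key (enum A))) <= Z)%N ->
  (#|A| ^ 2 <= Z * \sum_(s in A) #|[set t in A | key t == key s]|)%N.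
Proof.
set L := undup _ => hL.
have part (F : T -> nat) : (\sum_(s in A) F s = \sum_(k <- L) \sum_(s in A | key s == k) F s)%N.
  rewrite (exchange_big_dep (fun s => s \in A)) /=; last by move=> k s _ /andP[].
  apply: eq_bigr => s sA.
  rewrite -big_filter; have -> : [seq k <- L | (s \in A) && (key s == k)] = [:: key s].
    have u : uniq L by apply: undup_uniq.
    have kL : key s \in L by rewrite mem_undup map_f // mem_enum.
    rewrite sA /= (@eq_filter _ _ (pred1 (key s))); last by move=> k /=; rewrite eq_sym.
    by rewrite filter_pred1_uniq.
  by rewrite big_seq1.
have e1 : #|A| = (\sum_(k <- L) #|[set t in A | key t == k]|)%N.
  rewrite -sum1_card part; apply: eq_bigr => k _; rewrite -sum1_card; apply: eq_bigl => t; by rewrite !inE.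
rewrite part {1}e1; apply: leq_trans (sqr_sum_le _ _) _; apply: leq_mul => //.
apply: leq_sum => k _; rewrite (eq_bigr (fun=> #|[set t in A | key t == k]|)); last first.
  by move=> s /andP[_ /eqP ->].
rewrite sum_nat_const -mulnn leq_mul2r; apply/orP; right.
by rewrite cardsE; apply: eq_leq; apply: eq_card.
Qed.

(** * The energy of a short interval and its rich pairs *)

Section Energy.
Variables (p : nat) (pp : prime p) (M : int) (N B : nat).
Hypotheses (Np : (N <= p)%N) (B_gt0 : (0 < B)%N) (Bp : (B < p)%N).

Definition pt (u : 'I_N) : 'F_p := (M + u.+1%:Z)%:~R.
Hypothesis pt_neq0 : forall u, pt u != 0.
Let T := ('I_N * 'I_N)%type.
Definition lam (s : T) : 'F_p := (pt s.1)^-1 + (pt s.2)^-1.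

Variables (bb : 'F_p -> nat) (aa : 'F_p -> int).
Hypothesis hba : forall l, l != 0 -> [/\ (0 < bb l <= B)%N, (`|aa l| * B <= p)%N, coprimez (aa l) (bb l)%:Z &
  (bb l)%:R * (l^-1 - M%:~R) = (aa l)%:~R :> 'F_p].

(* [1 / x1 + 1 / x2 = l] is turned into the factorization [yy_prod] of an integer. *)
Definition yy (l : 'F_p) (u : 'I_N) : int := (bb l)%:Z * (u.+1)%:Z - aa l.
Definition cc (s : T) : int :=
  let l := lam s in (bb l)%:Z * ((s.1.+1)%:Z * (s.2.+1)%:Z) - aa l * ((s.1.+1)%:Z + (s.2.+1)%:Z).
Definition same (s t : T) : bool := (lam t == lam s) && (cc t == cc s).
Definition is_rich (s : T) : bool := (lam s != 0) && (8 < #|[set t | same s t]|)%N.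
Definition cc_bound : nat := (B * N ^ 2 + 2 * N * (p %/ B))%N.

Lemma ptB u v : pt u = pt v -> u = v.
Proof.
move/eqP; rewrite Fp_int_eq // => /dvdzP[q eq]; apply/val_inj.
have h1 := ltn_ord u; have h2 := ltn_ord v.
have : (u : nat)%:Z - (v : nat)%:Z = q * p%:Z by rewrite -eq; clear; lia.
have [q0|q0] := eqVneq q 0; first by rewrite q0 mul0r => /eqP; rewrite subr_eq0 => /eqP[].
move/(congr1 absz); rewrite abszM /= => e.
have : (p <= `|q| * p)%N by rewrite leq_pmull // absz_gt0.
rewrite -e => h3; exfalso; move: h1 h2 h3 Np; clear; move: (nat_of_ord u) (nat_of_ord v) => a c h1 h2 h3 h4; lia.
Qed.

Lemma bb_gt0 l : l != 0 -> (0 < bb l)%N.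
Proof. by move=> /hba[/andP[]]. Qed.

Lemma bb_neq0 l : l != 0 -> (bb l)%:R != 0 :> 'F_p.
Proof.
move=> l0; have [/andP[b0 bB] _ _ _] := hba l0.
rewrite -(dvdn_pcharf (pchar_Fp pp)); apply/negP => /dvdn_leq h.
by have := leq_ltn_trans (leq_trans (h b0) bB) Bp; rewrite ltnn.
Qed.

Lemma yy_pt l u : l != 0 -> (yy l u)%:~R = (bb l)%:R * (pt u - l^-1) :> 'F_p.
Proof.
move=> l0; have [_ _ _ e] := hba l0.
rewrite /yy /pt rmorphB rmorphM rmorphD /= -e; ring.
Qed.

Lemma lam_prod s : lam s != 0 -> (pt s.1 - (lam s)^-1) * (pt s.2 - (lam s)^-1) = ((lam s)^-1) ^+ 2.
Proof.
move=> l0; have h1 := pt_neq0 s.1; have h2 := pt_neq0 s.2.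
have e : pt s.1 * pt s.2 = (lam s)^-1 * (pt s.1 + pt s.2).
  by apply: (mulfI l0); rewrite mulVKf // /lam; move: (pt s.1) (pt s.2) h1 h2 => x y h1 h2; field; rewrite h1 h2.
have -> : (pt s.1 - (lam s)^-1) * (pt s.2 - (lam s)^-1) = pt s.1 * pt s.2 - (lam s)^-1 * (pt s.1 + pt s.2) + (lam s)^-1 ^+ 2 by ring.
by rewrite e subrr add0r.
Qed.

Lemma yy_prod s : yy (lam s) s.1 * yy (lam s) s.2 = aa (lam s) ^+ 2 + (bb (lam s))%:Z * cc s.
Proof. by rewrite /yy /cc; ring. Qed.

Lemma yy_prod_mod s : lam s != 0 -> (yy (lam s) s.1 * yy (lam s) s.2)%:~R = ((bb (lam s))%:R * (lam s)^-1) ^+ 2 :> 'F_p.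
Proof. by move=> l0; rewrite rmorphM /= !yy_pt // mulrACA lam_prod // exprMn expr2. Qed.

Lemma yy_prod_neq0 s : lam s != 0 -> yy (lam s) s.1 * yy (lam s) s.2 != 0.
Proof.
move=> l0; apply/eqP => e; have := yy_prod_mod l0; rewrite e => /esym/eqP.
by rewrite expf_eq0 /= mulf_eq0 (negPf (bb_neq0 l0)) invr_eq0 (negPf l0).
Qed.

Lemma cc_mod s t : lam s != 0 -> lam t = lam s -> (p%:Z %| cc t - cc s)%Z.
Proof.
move=> l0 e; rewrite -Fp_int_eq // ; apply/eqP; apply: (mulfI (bb_neq0 l0)).
apply: (addrI ((aa (lam s) ^+ 2)%:~R)).
have h u : lam u = lam s -> (aa (lam s) ^+ 2)%:~R + (bb (lam s))%:R * (cc u)%:~R = ((bb (lam s))%:R * (lam s)^-1) ^+ 2 :> 'F_p.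
  move=> eu; have lu : lam u != 0 by rewrite eu.
  rewrite -eu.
  have -> : (aa (lam u) ^+ 2)%:~R + (bb (lam u))%:R * (cc u)%:~R = (aa (lam u) ^+ 2 + (bb (lam u))%:Z * cc u)%:~R :> 'F_p.
    by move: (cc u) (aa _ ^+ 2) => c a; rewrite intrD intrM -pmulrn.
  by rewrite -yy_prod yy_prod_mod.
by rewrite !h.
Qed.

Lemma cc_le s : lam s != 0 -> (`|cc s| <= cc_bound)%N.
Proof.
move=> l0; have [/andP[_ bB] aB _ _] := hba l0; rewrite /cc /cc_bound.
have hu (u : 'I_N) : (u.+1 <= N)%N by exact: ltn_ord.
have a1 : (`|aa (lam s)| <= p %/ B)%N by rewrite leq_divRL.
have h1 : (bb (lam s) * (s.1.+1 * s.2.+1) <= B * N ^ 2)%N by rewrite -mulnn !leq_mul.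
have h2 : (`|aa (lam s)| * (s.1.+1 + s.2.+1) <= (p %/ B) * (2 * N))%N.
  by rewrite leq_mul // mul2n -addnn leq_add.
have e1 : absz ((bb (lam s))%:Z * ((s.1.+1)%:Z * (s.2.+1)%:Z)) = (bb (lam s) * (s.1.+1 * s.2.+1))%N.
  by rewrite !abszM.
have e2 : absz (aa (lam s) * ((s.1.+1)%:Z + (s.2.+1)%:Z)) = (`|aa (lam s)| * (s.1.+1 + s.2.+1))%N.
  by rewrite abszM -PoszD.
rewrite -e1 in h1; rewrite -e2 in h2; rewrite [(2 * N * _)%N]mulnC.
by move: h1 h2; move: (_ * (_ * _)) (aa _ * _) (_ * N ^ 2)%N (_ * (2 * N))%N; clear; lia.
Qed.

Lemma same_refl s : same s s.
Proof. by rewrite /same !eqxx. Qed.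

Lemma same_swap s t : same s t -> same s (t.2, t.1).
Proof.
have e : lam (t.2, t.1) = lam t by rewrite /lam /= addrC.
have e2 : cc (t.2, t.1) = cc t by rewrite /cc e /=; ring.
by rewrite /same e e2.
Qed.

Lemma yy_inj l u v : l != 0 -> yy l u = yy l v -> u = v.
Proof.
move=> l0 /addIr e; have b0 := bb_gt0 l0; apply: val_inj.
have : (bb l)%:Z != 0 by rewrite eqz_nat -lt0n.
by move/mulfI => /(_ _ _ e) []; apply.
Qed.

Lemma same_prod s t : lam s != 0 -> same s t -> yy (lam s) t.1 * yy (lam s) t.2 = yy (lam s) s.1 * yy (lam s) s.2.
Proof. by move=> l0 /andP[/eqP e1 /eqP e2]; rewrite -{1 2}e1 !yy_prod e1 e2. Qed.

Lemma same_snd s t t' : lam s != 0 -> same s t -> same s t' -> t.1 = t'.1 -> t = t'.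
Proof.
move=> l0 h h' e; rewrite [t]surjective_pairing [t']surjective_pairing e; congr (_, _).
have := same_prod l0 h; rewrite -(same_prod l0 h') e => /mulfI h2; apply: (yy_inj l0); apply: h2.
have := yy_prod_neq0 l0; rewrite -(same_prod l0 h') mulf_eq0 negb_or => /andP[] //.
Qed.

(* An involution-closed set of nine pairs contains five disjoint ones. *)
Lemma five_pairs s : is_rich s -> exists f : nat -> T, [/\ f 0%N = s, forall i, (i < 5)%N -> same s (f i) &
  forall i j (c d : bool), (i < 5)%N -> (j < 5)%N -> i != j ->
    (if c then (f i).2 else (f i).1) != (if d then (f j).2 else (f j).1)].
Proof.
move=> /andP[l0 h9].
suff : forall n, (n <= 4)%N -> exists f : nat -> T, [/\ f 0%N = s, forall i, (i < n.+1)%N -> same s (f i) &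
  forall i j (c d : bool), (i < n.+1)%N -> (j < n.+1)%N -> i != j ->
    (if c then (f i).2 else (f i).1) != (if d then (f j).2 else (f j).1)] by exact.
elim=> [|n IH] hn.
  exists (fun=> s); split => // [i _|[|i] [|j]] //; exact: same_refl.
have [f [f0 f1 f2]] := IH (ltnW hn).
pose used := [seq (f i).1 | i <- iota 0 n.+1] ++ [seq (f i).2 | i <- iota 0 n.+1].
have us : (size used <= 8)%N.
  by rewrite size_cat !size_map !size_iota; clear -hn; lia.
have [t [ht nt]] : exists t, same s t /\ t.1 \notin used.
  apply: contrapT => none.
  have : (#|[set t | same s t]| <= size used)%N.
    rewrite -(@card_in_imset _ _ (fun t : T => t.1)); last first.
      by move=> t t'; rewrite !inE => h h'; exact: (same_snd l0 h h').
    rewrite cardE; apply: uniq_leq_size; first exact: enum_uniq.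
    move=> u; rewrite mem_enum => /imsetP[t]; rewrite inE => ht ->.
    by apply: contrapT => /negP h; apply: none; exists t.
  by move=> h; have := leq_trans h9 (leq_trans h us); rewrite ltnn.
have nt2 : t.2 \notin used.
  apply/negP; rewrite mem_cat => /orP[] /mapP[i]; rewrite mem_iota add0n /= => hi e.
    have := same_snd l0 (same_swap ht) (f1 i hi) e => e2.
    move/negP: nt; apply; rewrite mem_cat; apply/orP; right.
    by apply/mapP; exists i; rewrite ?mem_iota // -e2.
  have e' : (t.2, t.1).1 = ((f i).2, (f i).1).1 by [].
  have := same_snd l0 (same_swap ht) (same_swap (f1 i hi)) e' => -[_ e2].
  move/negP: nt; apply; rewrite mem_cat; apply/orP; left.
  by apply/mapP; exists i; rewrite ?mem_iota.
have fresh i (c d : bool) : (i < n.+1)%N -> (if c then t.2 else t.1) != (if d then (f i).2 else (f i).1).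
  move=> hi; have : (if d then (f i).2 else (f i).1) \in used.
    by rewrite mem_cat; case: d; apply/orP; [right|left]; apply/mapP; exists i; rewrite ?mem_iota.
  by move=> hu; apply/eqP => e; case: c e hu nt nt2 => -> hu; rewrite hu.
exists (fun i => if i == n.+1 then t else f i); split => //.
- by move=> i; rewrite ltnS leq_eqVlt => /orP[/eqP->|hi]; rewrite ?eqxx // ltn_eqF //; exact: f1.
move=> i j c d; rewrite ltnS [(i <= _)%N]leq_eqVlt [(j < _)%N]ltnS [(j <= _)%N]leq_eqVlt.
move=> /orP[/eqP->|hi] /orP[/eqP->|hj]; rewrite ?eqxx //.
- by move=> _; rewrite (ltn_eqF hj); exact: fresh.
- by move=> _; rewrite (ltn_eqF hi) eq_sym; exact: fresh.
by rewrite (ltn_eqF hi) (ltn_eqF hj); exact: f2.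
Qed.

Lemma rich_pair_line s : is_rich s -> rich_line (bb (lam s)) N (yy (lam s) s.1, yy (lam s) s.2).
Proof.
move=> hs; have [f [f0 f1 f2]] := five_pairs hs; have /andP[l0 _] := hs.
have [/andP[b0 bB] aB cop _] := hba l0.
exists (fun i c => yy (lam s) (if c then (f i).2 else (f i).1)), (yy (lam s) s.1 * yy (lam s) s.2).
split; rewrite ?f0 //; split.
- exact: yy_prod_neq0.
- by move=> i hi; apply: same_prod => //; exact: f1.
- move=> i c _; rewrite /yy; move: (_.+1)%:Z => x.
  have -> : (bb (lam s))%:Z * x - aa (lam s) = x * (bb (lam s))%:Z + - aa (lam s) by ring.
  by rewrite coprimez_sym /coprimez gcdzMDl gcdzN gcdzC.
- move=> i j c d _ _; set u := if c then _ else _; set v := if d then _ else _.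
  have -> : yy (lam s) u - yy (lam s) v = (bb (lam s))%:Z * ((u : nat)%:Z - (v : nat)%:Z).
    by rewrite /yy !intS; ring.
  split; first exact: dvdz_mulr.
  rewrite abszM /= leq_mul2l; apply/orP; right.
  by have := ltn_ord u; have := ltn_ord v; clear; move: (nat_of_ord u) (nat_of_ord v); lia.
move=> i j c d hi hj ij; apply/eqP => /(yy_inj l0) e.
by have := f2 i j c d hi hj ij; rewrite e eqxx.
Qed.

Lemma rich_swap s : is_rich s -> is_rich (s.2, s.1).
Proof.
have e : lam (s.2, s.1) = lam s by rewrite /lam /= addrC.
have e2 : cc (s.2, s.1) = cc s by rewrite /cc e /=; ring.
by rewrite /is_rich e /same e e2.
Qed.

(** [A t = d e] with [t] a nonzero integer and [d], [e] at most [N]; [T = 2 N] is admissible for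
    every [b]. *)
Lemma rich_fst_le s : is_rich s -> (`|yy (lam s) s.1| <= N ^ 2)%N.
Proof.
move=> hs; have /andP[l0 _] := hs; have b0 := bb_gt0 l0.
have [j _] := @rich_three_sols (bb (lam s)) N (2 * N) _ b0 (leq_pmull _ b0) (rich_pair_line hs).
move=> [_ _ [d [e [t [h1 _ _ h2 h3]]]]]; have := h1 0; have [t0 _] := h2 0; have [] := h3 0.
rewrite -!lez_nat !abszE => d1 e1 /(congr1 absz); rewrite !abszM -mulnn PoszM => e2.
rewrite -PoszM lez_nat; apply: leq_trans (_ : `|yy (lam s) s.1| * `|t 0%R| <= _)%N.
  by rewrite leq_pmulr // absz_gt0.
by rewrite -e2; apply: leq_mul; rewrite -lez_nat abszE.
Qed.

(** A member of the class is determined by the factor of its first entry, a divisor of [K]; and [K]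
    is at most [N ^ 4]. *)
Lemma rich_card s D : (forall n, 0 < n -> n <= N ^ 4 -> size (divisors n) <= D)%N -> is_rich s ->
  (#|[set t | same s t]| <= D * 2)%N.
Proof.
move=> hD hs; have /andP[l0 _] := hs.
have K0 := yy_prod_neq0 l0; set K := _ * _ in K0.
have hK : (`|K| <= N ^ 4)%N.
  rewrite /K abszM (_ : 4 = 2 + 2)%N // expnD; apply: leq_mul; first exact: rich_fst_le.
  by have := rich_fst_le (rich_swap hs); rewrite /lam /= addrC.
have hd := hD `|K|%N; rewrite absz_gt0 K0 hK in hd.
have := @atmost_divz rat _ K0 (map (fun t : T => yy (lam s) t.1) (enum [set t | same s t])).
rewrite size_map -cardE => h; rewrite -(ler_nat rat) natrM; apply: le_trans (h _ _) _.
- rewrite map_inj_in_uniq ?enum_uniq // => t t'; rewrite !mem_enum !inE => h1 h2 e.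
  by apply: (same_snd l0 h1 h2); exact: (yy_inj l0 e).
- move=> x /mapP[t]; rewrite mem_enum inE => ht ->.
  by rewrite /K -(same_prod l0 ht) dvdz_mulr.
by rewrite ler_pM2r // ler_nat; exact: hd.
Qed.

Variable R : realFieldType.

(** The difference of the two factors fixes [x1 - x2]. Since [A (x1 + x2) = b x1 ^ 2] in the field,
    [x1] is then a root of a quadratic with leading coefficient [b]. *)
Lemma atmost_line_fiber (w : nat * (int * int)) :
  atmost (fun s => lam s != 0 /\ (bb (lam s), (yy (lam s) s.1, yy (lam s) s.2)) = w) (2%:R : R).
Proof.
have [[s0 [l0 e0]]|none] := pselect (exists s, lam s != 0 /\ (bb (lam s), (yy (lam s) s.1, yy (lam s) s.2)) = w); last first.
  by apply: atmost0 => // s hs; apply: none; exists s.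
case: w e0 => b [A A'] /= [eb eA eA'].
have b0 : (b%:R : 'F_p) != 0 by rewrite -eb; exact: bb_neq0.
have bz : b%:Z != 0 by rewrite -eb eqz_nat -lt0n bb_gt0.
have diff s : bb (lam s) = b -> yy (lam s) s.1 = A -> yy (lam s) s.2 = A' -> A - A' = b%:Z * ((s.1 : nat)%:Z - (s.2 : nat)%:Z).
  by move=> <- <- <-; rewrite /yy !intS; ring.
have quad s : lam s != 0 -> bb (lam s) = b -> yy (lam s) s.1 = A -> A%:~R * (pt s.1 + pt s.2) = b%:R * pt s.1 ^+ 2 :> 'F_p.
  move=> ls <- <-; rewrite yy_pt //.
  have e : pt s.1 * pt s.2 = (lam s)^-1 * (pt s.1 + pt s.2).
    have := lam_prod ls; move: (pt s.1) (pt s.2) (lam s)^-1 => x y m h.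
    have -> : x * y = (x - m) * (y - m) + m * (x + y) - m ^+ 2 by ring.
    by rewrite h; ring.
  have -> : (bb (lam s))%:R * (pt s.1 - (lam s)^-1) * (pt s.1 + pt s.2) =
    (bb (lam s))%:R * (pt s.1 ^+ 2 + (pt s.1 * pt s.2 - (lam s)^-1 * (pt s.1 + pt s.2))) by ring.
  by rewrite e subrr addr0.
have ptd (u v : 'I_N) : pt u - pt v = ((u : nat)%:Z - (v : nat)%:Z)%:~R.
  by rewrite /pt -rmorphB /=; congr (_%:~R); rewrite !intS; ring.
(* The sum of the two roots is [2 A / b]. *)
pose x1 := 2%:R * A%:~R / b%:R - pt s0.1.
apply: (@atmost_inj R _ _ _ (fun x : 'F_p => x \in [:: pt s0.1; x1]) (fun s => pt s.1)).
- move=> s [ls [es eAs eAs']]; rewrite !inE; case: eqP => [//|/eqP ne] /=.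
  have q := quad s ls es eAs; have q0 := quad s0 l0 eb eA.
  have ej : pt s.1 - pt s.2 = pt s0.1 - pt s0.2.
    rewrite !ptd; congr (_%:~R); apply: (mulfI bz).
    by rewrite -(diff s es eAs eAs') -(diff s0 eb eA eA').
  have h : (pt s.1 - pt s0.1) * (b%:R * (pt s.1 + pt s0.1) - 2%:R * A%:~R) = 0.
    have e2 : pt s.2 = pt s.1 - (pt s0.1 - pt s0.2) by rewrite -ej; ring.
    rewrite e2 in q.
    have -> : (pt s.1 - pt s0.1) * (b%:R * (pt s.1 + pt s0.1) - 2%:R * A%:~R) =
      (b%:R * pt s.1 ^+ 2 - A%:~R * (pt s.1 + (pt s.1 - (pt s0.1 - pt s0.2)))) -
      (b%:R * pt s0.1 ^+ 2 - A%:~R * (pt s0.1 + pt s0.2)) by ring.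
    by rewrite q q0; ring.
  move/eqP: h; rewrite mulf_eq0 subr_eq0 (negPf ne) /= subr_eq0 => /eqP h.
  by rewrite /x1 -h [b%:R * _]mulrC mulfK // addrK.
- move=> s t [ls [es eAs eAs']] [lt [et eAt eAt']] /ptB e1.
  rewrite [s]surjective_pairing [t]surjective_pairing e1; congr (_, _); apply: val_inj.
  have := diff s es eAs eAs'; rewrite (diff t et eAt eAt') e1 => /(mulfI bz).
  by move/addrI/oppr_inj => [].
exact: (@atmost_seq R _ [:: pt s0.1; x1]).
Qed.

Lemma atmost_class_cc l (L D : nat) : l != 0 -> (forall n, 0 < n -> n <= N ^ 4 -> size (divisors n) <= D)%N ->
  atmost (fun s => lam s = l /\ (is_rich s /\ (`|cc s| <= L)%N)) (((2 * L %/ p)%N.+1)%:R * (D * 2)%:R : R).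
Proof.
move=> l0 hD.
have [[s0 [e0 _]]|none] := pselect (exists s, lam s = l /\ (is_rich s /\ (`|cc s| <= L)%N)); last first.
  by apply: atmost0 => [|s hs]; [rewrite mulr_ge0|apply: none; exists s].
apply: (atmost_fiber (f := cc) (Q := fun x : int => (`|x| <= L)%N /\ (p%:Z %| x - cc s0)%Z)) => //.
- by move=> s [es [_ h]]; split => //; apply: cc_mod; rewrite ?e0.
- by apply: atmost_residue; exact: prime_gt0.
move=> y _ r ur hr; case: r ur hr => [|s r] // ur hr.
rewrite ler_nat; have [[es [rs _]] ey] := hr s (mem_head _ _).
apply: leq_trans (rich_card hD rs); rewrite cardE; apply: uniq_leq_size => // t ht.
by rewrite mem_enum inE /same; have [[et _] ety] := hr t ht; rewrite et es ety ey !eqxx.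
Qed.

(** The bounds for [b] and for the factor give [|a| <= W], and [(b, a)] determines [l] by
    [1 / l = M + a / b]. For each [l] the integer [cc] is at most [L] and lies in one residue class
    modulo [p]. *)
Lemma atmost_tiny (B1 W L D : nat) : (forall n, 0 < n -> n <= N ^ 4 -> size (divisors n) <= D)%N ->
  (B1 * N ^ 2 + 2 * N * W <= L)%N ->
  atmost (fun s => is_rich s /\ ((bb (lam s) < B1)%N /\ (B1 * N + `|yy (lam s) s.1| <= W)%N))
    (B1%:R * (W.*2.+1)%:R * (((2 * L %/ p)%N.+1)%:R * (D * 2)%:R) : R).
Proof.
move=> hD hL.
have hu (u : 'I_N) : (u.+1 <= N)%N by exact: ltn_ord.
have aW s : lam s != 0 -> (bb (lam s) < B1)%N -> (B1 * N + `|yy (lam s) s.1| <= W)%N -> (`|aa (lam s)| <= W)%N.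
  move=> ls hb hW; apply: leq_trans hW.
  have h1 : (bb (lam s) * s.1.+1 <= B1 * N)%N by rewrite leq_mul // ltnW.
  apply: leq_trans (leq_add h1 (leqnn _)); rewrite /yy.
  have -> : (bb (lam s) * s.1.+1)%N = absz ((bb (lam s))%:Z * (s.1.+1)%:Z) by rewrite abszM.
  by move: (_ * _) (aa _); clear; lia.
apply: (atmost_fiber (f := fun s => (bb (lam s), aa (lam s)))
   (Q := fun x : nat * int => (x.1 < B1)%N /\ (fun _ a => `|a| <= W%:Z) x.1 x.2)).
- by rewrite mulr_ge0.
- move=> s [hs [hb hW]]; have /andP[ls _] := hs; split => //=.
  by have := aW s ls hb hW; move: (aa _); clear; lia.
- apply: (@atmost_pair R _ _ (fun b => (b < B1)%N) (fun _ (a : int) => `|a| <= W%:Z)) => //; first exact: atmost_nat.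
  by move=> _ _; exact: atmost_int_abs.
move=> [b a] _.
have [[s0 [[r0 _] [eb ea]]]|none] := pselect (exists s, (is_rich s /\ ((bb (lam s) < B1)%N /\ (B1 * N + `|yy (lam s) s.1| <= W)%N)) /\ (bb (lam s), aa (lam s)) = (b, a)); last first.
  by apply: atmost0 => [|s hs]; [rewrite mulr_ge0|apply: none; exists s].
have /andP[l0 _] := r0.
have hc := @atmost_class_cc _ L D l0 hD; apply: atmost_sub hc => s [[rs [hb hW]] [es eas]].
have /andP[ls _] := rs; split.
  apply: invr_inj; apply: (@addIr _ (- M%:~R)); apply: (mulfI (bb_neq0 ls)).
  have [_ _ _ ->] := hba ls; rewrite es -eb; have [_ _ _ ->] := hba l0; by rewrite eas ea.
split => //; apply: leq_trans hL; rewrite /cc.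
have h1 : (bb (lam s) * (s.1.+1 * s.2.+1) <= B1 * N ^ 2)%N by rewrite -mulnn !leq_mul // ltnW.
have h2 : (`|aa (lam s)| * (s.1.+1 + s.2.+1) <= W * (2 * N))%N.
  by rewrite leq_mul //; [exact: aW|rewrite mul2n -addnn leq_add].
have e1 : absz ((bb (lam s))%:Z * ((s.1.+1)%:Z * (s.2.+1)%:Z)) = (bb (lam s) * (s.1.+1 * s.2.+1))%N.
  by rewrite !abszM.
have e2 : absz (aa (lam s) * ((s.1.+1)%:Z + (s.2.+1)%:Z)) = (`|aa (lam s)| * (s.1.+1 + s.2.+1))%N.
  by rewrite abszM -PoszD.
rewrite -e1 in h1; rewrite -e2 in h2; rewrite [(2 * N * _)%N]mulnC.
by move: h1 h2; move: (_ * (_ * _)) (aa _ * _) (_ * N ^ 2)%N (_ * (2 * N))%N; clear; lia.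
Qed.

Definition energy : nat := (\sum_(s : T) #|[set t : T | lam t == lam s]|)%N.

(** [N ^ 2] comes from [lam = 0], where one entry determines the other. Otherwise Cauchy-Schwarz
    passes from equal [lam] to the finer relation [same], and [8 N ^ 2] covers the classes that are
    not rich. *)
Lemma energy_le : (energy <= N ^ 2 + (2 * cc_bound %/ p).+1 *
   (8 * N ^ 2 + \sum_(s | is_rich s) #|[set t | same s t]|))%N.
Proof.
rewrite /energy (bigID (fun s => lam s == 0)) /=; apply: leq_add.
  pose A0 := [set s : T | lam s == 0].
  have hA : (#|A0| <= N)%N.
    rewrite -[X in (_ <= X)%N](card_ord N) -(@card_in_imset _ _ (fun s : T => s.1)).
      exact: max_card.
    move=> s t; rewrite !inE /lam => /eqP hs /eqP ht e.
    rewrite [s]surjective_pairing [t]surjective_pairing e; congr (_, _); apply: ptB.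
    by apply: invr_inj; apply: (@addrI _ (pt s.1)^-1); rewrite hs e ht.
  rewrite (eq_bigr (fun=> #|A0|)); last by move=> s /eqP ->.
  have -> : (\sum_(s : T | lam s == 0%R) #|A0| = #|A0| * #|A0|)%N.
    by rewrite sum_nat_const; congr (_ * _)%N; apply: eq_card => s; rewrite !inE.
  by rewrite -mulnn leq_mul.
apply: (@leq_trans ((2 * cc_bound %/ p).+1 * \sum_(s : T | lam s != 0%R) #|[set t | same s t]|)).
  rewrite (partition_big lam (fun l => l != 0)) // big_distrr /=.
  rewrite [X in (_ <= X)%N](partition_big lam (fun l => l != 0)) //=.
  apply: leq_sum => l l0; pose A := [set s : T | lam s == l].
  have -> : (\sum_(s | (lam s != 0%R) && (lam s == l)) #|[set t | lam t == lam s]| = #|A| ^ 2)%N.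
    rewrite (eq_bigr (fun=> #|A|)); last by move=> s /andP[_ /eqP ->].
    rewrite sum_nat_const -mulnn; congr (_ * _)%N; apply: eq_card => s; rewrite !inE.
    by rewrite unfold_in; case: (lam s =P l) => [->|]; rewrite ?l0 ?andbF.
  have hZ : (size (undup (map cc (enum A))) <= (2 * cc_bound %/ p).+1)%N.
    rewrite -(ler_nat rat).
    case eA : (enum A) => [|s0 r]; first by [].
    have s0A : s0 \in A by rewrite -mem_enum eA mem_head.
    apply: (@atmost_residue rat cc_bound p (cc s0) (prime_gt0 pp)); first exact: undup_uniq.
    move=> x; rewrite mem_undup => /mapP[t]; rewrite -eA mem_enum => tA ->.
    move: s0A tA; rewrite !inE => /eqP es /eqP et.
    by split; [apply: cc_le; rewrite et|apply: cc_mod; rewrite es].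
  apply: leq_trans (card_sqr_fibers hZ) _; rewrite big_distrr /=.
  rewrite [X in (X <= _)%N](eq_bigl (fun s => (lam s != 0) && (lam s == l))); last first.
    by move=> s; rewrite !inE; case: (lam s =P l) => [->|]; rewrite ?l0 ?andbF.
  apply: eq_leq; apply: eq_bigr => s /andP[_ /eqP es]; congr (_ * _)%N; apply: eq_card => t.
  by rewrite !inE /same es.
rewrite leq_mul2l; apply/orP; right.
apply: (@leq_trans (\sum_(s : T | lam s != 0%R) (8 + (if is_rich s then #|[set t | same s t]| else 0)))%N).
  apply: leq_sum => s ls; rewrite /is_rich ls /=; case: ltnP => h; rewrite ?leq_addl // addn0 //.
rewrite big_split /= leq_add //.
  rewrite sum_nat_const mulnC leq_mul2l /= -mulnn.
  by apply: leq_trans (max_card _) _; rewrite card_prod card_ord.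
rewrite -big_mkcondr; apply: eq_leq; apply: eq_bigl => s.
by rewrite /is_rich andbA andbb.
Qed.

End Energy.

Lemma nat_root (q N : nat) : (0 < q)%N -> exists M, (M ^ q <= N < M.+1 ^ q)%N.
Proof.
move=> q0; have h0 : exists M, (M ^ q <= N)%N by exists 0%N; rewrite exp0n.
have hb M : (M ^ q <= N)%N -> (M <= N)%N.
  by apply: leq_trans; case: M => // M; rewrite -{1}[M.+1]expn1 leq_pexp2l.
have [M hM hmax] := ex_maxnP h0 hb; exists M; rewrite hM /= ltnNge; apply/negP => /hmax; by rewrite ltnn.
Qed.

(** * Choice of the parameters for short intervals *)

Section Small.
Variable R : realFieldType.

(** The class of a rich pair has at most [2 D] elements. Lines that are not tiny gain [z ^ 5], more
    than the loss [D]; the tiny ones are few because [p >= N D2 ^ 100]. *)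
Lemma sum_rich_le (Kc : nat) : exists2 C : R, 0 <= C & forall (p : nat) (pp : prime p) (M : int) (N B z D : nat)
    (bb : 'F_p -> nat) (aa : 'F_p -> int),
  (N <= p)%N -> (0 < B)%N -> (B < p)%N -> (forall u : 'I_N, pt p M u != 0) ->
  (forall l, l != 0 -> [/\ (0 < bb l <= B)%N, (`|aa l| * B <= p)%N, coprimez (aa l) (bb l)%:Z &
     (bb l)%:R * (l^-1 - M%:~R) = (aa l)%:~R :> 'F_p]) ->
  (0 < z)%N -> (D <= Kc * z)%N -> (forall n, 0 < n -> n <= 512 * N ^ 4 -> size (divisors n) <= D)%N ->
  (par_D2 z ^ 164 <= N)%N -> (N * par_D2 z ^ 100 <= p)%N ->
  (\sum_(s | is_rich M bb aa s) #|[set t : 'I_N * 'I_N | same M bb aa s t]|)%:R <= C * N%:R ^+ 2.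
Proof.
have [C C0 hC] := rich_lines R Kc.
exists (2 * Kc%:R * (2 * C) + (82 * 160) * Kc%:R ^+ 2).
  by do ![apply: addr_ge0 => // | apply: mulr_ge0 => // | apply: exprn_ge0 => //].
move=> p pp M N B z D bb aa Np B0 Bp hpt hba z0 hDz hD hN hp.
have hD4 n : (0 < n -> n <= N ^ 4 -> size (divisors n) <= D)%N.
  by move=> n0 hn; apply: hD => //; apply: leq_trans hn _; rewrite leq_pmull.
have N0 : (0 < N)%N by apply: leq_trans hN; rewrite !expn_gt0 z0.
have hD2 n : (0 < n -> n <= 512 * N ^ 2 -> size (divisors n) <= D)%N.
  by move=> n0 hn; apply: hD => //; apply: leq_trans hn _; rewrite leq_mul2l leq_pexp2l // orbT.
have hl := hC z N D z0 hDz hD2 hN.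
set D2 := par_D2 z in hN hp hl; set Dd := par_Dd z in hl; set g := par_g z in hl.
pose T := ('I_N * 'I_N)%type.
pose rich s := is_rich M bb aa (s : T).
pose line (s : T) := (bb (lam p M s), (yy bb aa (lam p M s) s.1, yy bb aa (lam p M s) s.2)).
pose tiny (s : T) := tiny_line N Dd D2 g (bb (lam p M s)) (line s).2.
have c1 : atmost (fun s : T => rich s /\ ~ tiny s) (C * N%:R ^+ 2 / z%:R ^+ 5 * 2%:R).
  apply: (atmost_fiber (f := line)) hl _ => //.
    move=> s [hs ht]; have /andP[l0 _] := hs; split; first by apply: (bb_gt0 hba).
    by split => //; exact: (rich_pair_line pp Bp hpt hba hs).
  move=> w _; have hf : atmost (fun s : T => lam p M s != 0 /\ line s = w) (2%:R : R) by exact: (atmost_line_fiber pp Np Bp hpt hba R).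
  apply: atmost_sub hf => s [[hs _] e]; by have /andP[l0 _] := hs.
pose B1 := ((2 * D2 ^ 2) ^ 2 * g ^ 5)%N; pose V := (B1 * Dd ^ 2)%N.
have D20 : (0 < D2)%N by rewrite !expn_gt0 z0.
have Dd0 : (0 < Dd)%N by rewrite !expn_gt0 z0.
have B1V : (B1 <= V)%N by rewrite leq_pmulr // expn_gt0 Dd0.
have g0 : (0 < g)%N by rewrite /g /par_g expn_gt0 D20.
have V0 : (0 < V)%N.
  have px x k : (0 < x)%N -> (0 < x ^ k)%N by rewrite expn_gt0 => ->.
  by rewrite /V muln_gt0 (px _ 2 Dd0) andbT /B1 muln_gt0 (px _ 5 g0) andbT (px _ 2 _) // muln_gt0 (px _ 2 D20).
have VD : (V <= 4 * D2 ^ 25)%N.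
  have e1 : B1 = (4 * D2 ^ 24)%N by rewrite /B1 /g /par_g -/D2 -expnM; ring.
  have e2 : (Dd ^ 2 <= D2)%N by rewrite /D2 /par_D2 -/Dd leq_pexp2l.
  rewrite /V e1 (expnSr D2 24) mulnA leq_mul2l e2 orbT //.
(* A tiny line has [2 |A| <= N V], and also [B1 N <= N V]; together they fit under [W]. *)
pose W := (2 * N * V)%N; pose L := (5 * N ^ 2 * V)%N.
have hL : (B1 * N ^ 2 + 2 * N * W <= L)%N.
  apply: leq_trans (_ : V * N ^ 2 + 2 * N * W <= _)%N; first by rewrite leq_add2r leq_mul2r B1V orbT.
  by rewrite /W /L; apply: eq_leq; ring.
have c2 : atmost (fun s : T => rich s /\ ((bb (lam p M s) < B1)%N /\ (B1 * N + `|(line s).2.1| <= W)%N))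
    (B1%:R * (W.*2.+1)%:R * (((2 * L %/ p)%N.+1)%:R * (D * 2)%:R) : R).
  exact: (atmost_tiny pp Bp hpt hba R hD4 hL).
have c3 : atmost (fun s : T => rich s /\ tiny s) (B1%:R * (W.*2.+1)%:R * (((2 * L %/ p)%N.+1)%:R * (D * 2)%:R) : R).
  apply: atmost_sub c2 => s [hs [h1 h2]]; split => //; split => //=.
  have h3 : (N * (bb (lam p M s) * Dd ^ 2) <= N * V)%N.
    by rewrite leq_mul2l leq_mul2r (ltnW h1) !orbT.
  have h4 := leq_trans h2 h3.
  have h5 : (B1 * N <= N * V)%N by rewrite mulnC leq_mul2l B1V orbT.
  rewrite /W -mulnA; move: h4 h5; rewrite /line /=; move: (yy _ _ _ _) (B1 * N)%N (N * V)%N => y a c.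
  by clear; lia.
have c4 : (\sum_(s | is_rich M bb aa s) #|[set t : T | same M bb aa s t]| <= #|[set s | rich s]| * (D * 2))%N.
  rewrite (eq_bigl (fun s => s \in [set s | rich s])); last by move=> s; rewrite inE.
  rewrite -sum_nat_const; apply: leq_sum => s; rewrite inE => hs; exact: (rich_card pp Bp hpt hba hD4 hs).
have c5 : (#|[set s | rich s]|)%:R <= C * N%:R ^+ 2 / z%:R ^+ 5 * 2%:R + B1%:R * (W.*2.+1)%:R * (((2 * L %/ p)%N.+1)%:R * (D * 2)%:R) :> R.
  rewrite cardE; apply: (atmost_or c1 c3); first exact: enum_uniq.
  move=> s; rewrite mem_enum inE => hs.
  by have [ht|ht] := pselect (tiny s); [right|left].
have zz : 1 <= z%:R :> R by rewrite ler1n.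
have c6 : B1%:R * (W.*2.+1)%:R * (((2 * L %/ p)%N.+1)%:R * (D * 2)%:R) * (D * 2)%:R <= (82 * 160) * Kc%:R ^+ 2 * N%:R ^+ 2 :> R.
  rewrite -!natrM -!natrX -!natrM ler_nat.
  have k1 : (W.*2.+1 <= 5 * (N * V))%N.
    have := muln_gt0 N V; rewrite N0 V0 /W -mulnA; move: (N * V)%N; clear; lia.
  (* [V] consumes 25 of the 100 powers of [D2] between [N] and [p]; the remaining 75 outweigh the
     [D2 ^ 52] that comes from [V ^ 2 D ^ 2]. *)
  have k3 : ((2 * L %/ p).+1 * D2 ^ 75 <= 41 * N)%N.
    have k4 : (2 * L %/ p * D2 ^ 75 <= 40 * N)%N.
      have p0 := prime_gt0 pp; rewrite -(leq_pmul2r p0) mulnAC.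
      apply: leq_trans (leq_mul (leq_trunc_div (2 * L) p) (leqnn _)) _.
      apply: leq_trans (leq_mul (leqnn (40 * N)) hp).
      apply: leq_trans (_ : 2 * (5 * N ^ 2 * (4 * D2 ^ 25)) * D2 ^ 75 <= _)%N.
        by rewrite leq_mul2r /L leq_mul2l leq_mul2l VD !orbT.
      by rewrite (expnD D2 25 75); apply: eq_leq; ring.
    have k5 : (D2 ^ 75 <= N)%N by apply: leq_trans hN; rewrite leq_pexp2l.
    by rewrite mulSn (_ : 41 = 1 + 40)%N // mulnDl mul1n leq_add.
  have DD2 : (D <= Kc * D2)%N.
    apply: leq_trans hDz _; rewrite leq_mul2l; apply/orP; right.
    have up x k : (0 < x)%N -> (0 < k)%N -> (x <= x ^ k)%N by move=> x0 k0; rewrite -{1}[x]expn1 leq_pexp2l.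
    by rewrite /D2 /par_D2 /par_Dd /par_G; apply: leq_trans (up _ 28 z0 isT) _; apply: leq_trans (up _ 3 _ isT) _; rewrite ?expn_gt0 ?z0 //; apply: up; rewrite ?expn_gt0 ?z0.
  have DDz : (D ^ 2 <= Kc ^ 2 * D2 ^ 2)%N by rewrite -expnMn leq_exp2r.
  have pos : (0 < D2 ^ 75)%N by rewrite expn_gt0 D20.
  rewrite -(leq_pmul2r pos).
  apply: (@leq_trans (V * (5 * (N * V)) * ((41 * N) * (4 * D ^ 2)))%N).
    have -> : (B1 * W.*2.+1 * ((2 * L %/ p).+1 * (D * 2)) * (D * 2) * D2 ^ 75 =
       B1 * W.*2.+1 * (((2 * L %/ p).+1 * D2 ^ 75) * (4 * D ^ 2)))%N by ring.
    by apply: leq_mul; apply: leq_mul.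
  apply: (@leq_trans ((4 * D2 ^ 25) * (5 * (N * (4 * D2 ^ 25))) * ((41 * N) * (4 * (Kc ^ 2 * D2 ^ 2))))%N).
    by apply: leq_mul; [apply: leq_mul => //; rewrite leq_mul2l leq_mul2l VD !orbT|rewrite leq_mul2l leq_mul2l DDz !orbT].
  apply: leq_trans (_ : (82 * 160) * Kc ^ 2 * N ^ 2 * D2 ^ 52 <= _)%N.
    by rewrite (expnD D2 25 27) (expnD D2 25 2); apply: eq_leq; ring.
  by rewrite leq_mul2l leq_pexp2l // orbT.
have c7 : C * N%:R ^+ 2 / z%:R ^+ 5 * 2%:R * (D * 2)%:R <= 2 * Kc%:R * (2 * C) * N%:R ^+ 2 :> R.
  have k1 : (D * 2)%:R <= 2 * Kc%:R * z%:R :> R.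
    by rewrite -!natrM ler_nat mulnC -mulnA leq_mul2l hDz.
  have k2 : z%:R <= z%:R ^+ 5 :> R by rewrite -[X in X <= _]expr1 ler_weXn2l.
  have z5 : 0 < z%:R ^+ 5 :> R by rewrite exprn_gt0 // (lt_le_trans ltr01).
  have k3 : 0 <= 2 * C * N%:R ^+ 2 :> R by rewrite !mulr_ge0 // sqr_ge0.
  rewrite [X in X <= _](_ : _ = 2 * C * N%:R ^+ 2 * ((D * 2)%:R / z%:R ^+ 5)); last first.
    by move: (z%:R ^+ 5)^-1 (D * 2)%:R (N%:R ^+ 2) => x y w; ring.
  rewrite [X in _ <= X](_ : _ = 2 * C * N%:R ^+ 2 * (2 * Kc%:R)); last by ring.
  apply: ler_wpM2l => //; rewrite ler_pdivrMr //; apply: le_trans k1 _.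
  by apply: ler_wpM2l => //; rewrite mulr_ge0.
apply: (@le_trans _ _ ((#|[set s | rich s]| * (D * 2))%:R)); first by rewrite ler_nat.
rewrite natrM; have := ler_wpM2r (ler0n R (D * 2)) c5.
by rewrite mulrDl => h; apply: le_trans h _; rewrite [X in _ <= X]mulrDl; exact: lerD.
Qed.

(** [z] is the integral root of [N] with [(D2 ^ 100) ^ 100 = z ^ q <= N]. Then
    [(N D2 ^ 100) ^ 100 <= N ^ 101 <= p ^ 100], which is the room that the tiny lines require. *)
Lemma energy_small : exists2 C : R, 0 <= C & forall (p : nat) (pp : prime p) (M : int) (N : nat),
  (0 < N <= p)%N -> (N ^ 101 <= p ^ 100)%N -> (forall u : 'I_N, pt p M u != 0) ->
  (energy p M N)%:R ^+ 2 <= C * N%:R ^+ 4 * (N%:R ^+ 3 / p%:R + 1) :> R.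
Proof.
have [q q0 hq] : exists2 q : nat, (0 < q)%N & forall z, ((par_D2 z ^ 100) ^ 100 = z ^ q)%N.
  have e a b c d e : (0 < a)%N -> (0 < b)%N -> (0 < c)%N -> (0 < d)%N -> (0 < e)%N ->
      exists2 q : nat, (0 < q)%N & forall z, (((((z ^ a) ^ b) ^ c) ^ d) ^ e = z ^ q)%N.
    move=> a0 b0 c0 d0 e0; exists (a * b * c * d * e)%N; first by rewrite !muln_gt0 a0 b0 c0 d0 e0.
    by move=> z; rewrite !expnM.
  by exact: (e 28 3 3 100 100 isT isT isT isT isT)%N.
have q4 : (0 < 4 * q)%N by rewrite muln_gt0.
have [Kc hKc] := divisor_bound_root (512 * 2 ^ (4 * q)) q4.
have [C C0 hC] := sum_rich_le Kc.
pose K : R := 1 + 18 * (8 + C).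
exists (2 * K ^+ 2); first by rewrite mulr_ge0 // sqr_ge0.
move=> p pp M N /andP[N0 Np] hNp hpt.
have p0 := prime_gt0 pp.
have [z /andP[zN Nz]] := nat_root N q0.
have z0 : (0 < z)%N.
  by rewrite lt0n; apply/eqP => z0; move: Nz; rewrite z0 exp1n ltnS leqn0 -[_ == _]negbK -lt0n N0.
have D20 : (0 < par_D2 z)%N by rewrite !expn_gt0 z0.
have h164 : (par_D2 z ^ 164 <= N)%N.
  by apply: leq_trans zN; rewrite -hq -expnM leq_pexp2l.
have h100 : (N * par_D2 z ^ 100 <= p)%N.
  rewrite -(@leq_exp2r _ _ 100) // expnMn hq; apply: leq_trans hNp.
  by rewrite (expnSr N 100) leq_mul2l zN orbT.
have hD n : (0 < n -> n <= 512 * N ^ 4 -> size (divisors n) <= Kc * z)%N.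
  move=> n0 hn; apply: hKc => //; apply: leq_trans hn _.
  rewrite -mulnA leq_mul2l; apply/orP; right.
  rewrite -expnMn (mulnC 4 q) expnM leq_exp2r //; apply: ltnW; apply: leq_trans Nz _.
  by rewrite leq_exp2r // mul2n -addnn -addn1 leq_add2l.
(* [B] about [(p / N) ^ (1/2)] balances the two terms of [cc_bound]. *)
have [B /andP[hB1 hB2]] := nat_root (p %/ N) (isT : (0 < 2)%N).
have B0 : (0 < B)%N.
  rewrite lt0n; apply/eqP => e; move: hB2; rewrite e exp1n ltnS leqn0 -[_ == _]negbK -lt0n divn_gt0 //.
  by rewrite Np.
have hB : (B ^ 2 * N <= p)%N by apply: leq_trans (leq_trunc_div p N); rewrite leq_mul2r hB1 orbT.
have Bp : (B < p)%N.
  rewrite ltnNge; apply/negP => h.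
  have : (p ^ 2 * 1 <= p)%N by apply: leq_trans hB; apply: leq_mul => //; rewrite leq_exp2r.
  by rewrite muln1 -mulnn -{3}[p]muln1 leq_pmul2l // leqNgt prime_gt1.
have pB : (p <= 4 * B ^ 2 * N)%N.
  have h := ltn_ceil p N0; apply: leq_trans (ltnW h) _; rewrite leq_mul2r; apply/orP; right.
  apply: leq_trans hB2 _; rewrite (_ : 4 = 2 ^ 2)%N // -expnMn leq_exp2r // mul2n -addnn -addn1.
  by rewrite leq_add2l.
have hp l : exists w : nat * int, l != 0 -> [/\ (0 < w.1 <= B)%N, (`|w.2| * B <= p)%N, coprimez w.2 w.1%:Z &
     (w.1)%:R * (l^-1 - M%:~R) = (w.2)%:~R :> 'F_p].
  have [b [a [h1 h2 h3 h4]]] := @dirichlet p B (((l^-1 : 'F_p) : nat)%:Z - M) pp (introT andP (conj B0 Bp)).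
  exists (b, a) => _; split => //=.
  move: h4; rewrite -Fp_int_eq // => /eqP <-; rewrite rmorphM rmorphB /=; congr (_ * (_ - _)).
  by rewrite -[in LHS](natr_Zp (l^-1)).
have {hp}[w hw] := choice hp.
have hs := hC p pp M N B z (Kc * z)%N (fun l => (w l).1) (fun l => (w l).2) Np B0 Bp hpt hw z0 (leqnn _) hD h164 h100.
have he := energy_le pp Np B0 Bp hpt hw.
set cc := cc_bound p N B in he; set S := (\sum_(s | is_rich _ _ _ _) _)%N in hs he.
have hcc : (cc <= 9 * (B * N ^ 2))%N.
  have h : (p %/ B <= 4 * B * N)%N.
    have e : (4 * B ^ 2 * N = 4 * B * N * B)%N by ring.
    by apply: leq_trans (leq_div2r B pB) _; rewrite e mulnK.
  rewrite /cc /cc_bound; apply: leq_trans (leq_add (leqnn _) (leq_mul (leqnn (2 * N)) h)) _.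
  by apply: eq_leq; ring.
(* As [r ^ 2 <= N ^ 3 / p], a bound of order [(r + 1) N ^ 2] for the energy has the required
   square. *)
pose r : R := B%:R * N%:R ^+ 2 / p%:R.
have r0 : 0 <= r by rewrite /r !mulr_ge0 // ?sqr_ge0 // invr_ge0.
have pR : 0 < p%:R :> R by rewrite ltr0n.
have hr2 : r ^+ 2 <= N%:R ^+ 3 / p%:R.
  have -> : r ^+ 2 = (B%:R ^+ 2 * N%:R) * (N%:R ^+ 3 / p%:R ^+ 2) by rewrite /r; field; rewrite gt_eqF.
  have -> : N%:R ^+ 3 / p%:R = p%:R * (N%:R ^+ 3 / p%:R ^+ 2) :> R by field; rewrite gt_eqF.
  by apply: ler_wpM2r; [rewrite divr_ge0 // exprn_ge0|rewrite -natrX -natrM ler_nat].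
have hZ : ((2 * cc %/ p).+1)%:R <= 18 * r + 1 :> R.
  rewrite -natr1 lerD2r.
  have -> : 18 * r = (18 * (B * N ^ 2))%N%:R / p%:R by rewrite /r -natrX -natrM mulrA -natrM.
  rewrite ler_pdivlMr // -natrM ler_nat; apply: leq_trans (leq_trunc_div _ _) _.
  by rewrite (_ : 18 = 2 * 9)%N // -mulnA leq_mul2l hcc.
have N2 : 0 <= N%:R ^+ 2 :> R by apply: sqr_ge0.
have hE : (energy p M N)%:R <= K * (r + 1) * N%:R ^+ 2 :> R.
  apply: le_trans (_ : (N ^ 2 + (2 * cc %/ p).+1 * (8 * N ^ 2 + S))%N%:R <= _); first by rewrite ler_nat.
  rewrite natrD natrM (natrD _ (8 * _)%N) (natrM _ 8 (N ^ 2)) natrX.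
  have h1 : 8 * N%:R ^+ 2 + S%:R <= (8 + C) * N%:R ^+ 2 by rewrite [X in _ <= X]mulrDl lerD2l.
  have h2 : ((2 * cc %/ p).+1)%:R * (8 * N%:R ^+ 2 + S%:R) <= (18 * r + 1) * ((8 + C) * N%:R ^+ 2).
    apply: ler_pM => //; by rewrite addr_ge0 // mulr_ge0.
  apply: le_trans (lerD (lexx _) h2) _; rewrite /K; move: (N%:R ^+ 2) N2 C0 r0 => n n0 C0 r0.
  have h3 : 0 <= C * n by exact: mulr_ge0.
  have h4 : 0 <= r * n by exact: mulr_ge0.
  have -> : (1 + 18 * (8 + C)) * (r + 1) * n = n + (18 * r + 1) * ((8 + C) * n) + (r * n + 17 * (8 + C) * n) by ring.
  by rewrite lerDl; nra.
apply: le_trans (_ : (K * (r + 1) * N%:R ^+ 2) ^+ 2 <= _).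
  by rewrite ler_sqr ?nnegrE // (le_trans _ hE).
have -> : (K * (r + 1) * N%:R ^+ 2) ^+ 2 = (K ^+ 2 * N%:R ^+ 4) * (r + 1) ^+ 2 by ring.
have -> : 2 * K ^+ 2 * N%:R ^+ 4 * (N%:R ^+ 3 / p%:R + 1) = (K ^+ 2 * N%:R ^+ 4) * (2 * (N%:R ^+ 3 / p%:R + 1)) by ring.
apply: ler_wpM2l; first by rewrite mulr_ge0 // ?sqr_ge0 // exprn_ge0.
by move: (_ / _) hr2 => n hr2; have := sqr_ge0 (r - 1); nra.
Qed.

End Small.

(** * Additive characters *)

Section CauchySchwarz.
Variable C : numClosedFieldType.

(** Lagrange's identity: twice the difference is the sum of the squares of
    [a i * b j - a j * b i]. *)
Lemma sum_mul_sqr_le (T : finType) (a b : T -> C) : (forall i, 0 <= a i) -> (forall i, 0 <= b i) ->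
  (\sum_i a i * b i) ^+ 2 <= (\sum_i a i ^+ 2) * (\sum_i b i ^+ 2).
Proof.
move=> a0 b0; have two : 0 < 2%:R :> C by rewrite ltr0n.
rewrite -(ler_pM2l two) expr2 !big_distrlr /=.
have -> : 2%:R * (\sum_i \sum_j a i ^+ 2 * b j ^+ 2) = \sum_i \sum_j (a i ^+ 2 * b j ^+ 2 + a j ^+ 2 * b i ^+ 2).
  rewrite mulr2n mulrDl mul1r [X in X + _ = _]exchange_big /= -big_split; apply: eq_bigr => i _.
  by rewrite -big_split; apply: eq_bigr => j _; rewrite addrC.
rewrite mulr_sumr; apply: ler_sum => i _; rewrite mulr_sumr; apply: ler_sum => j _.
rewrite -subr_ge0.
have -> : a i ^+ 2 * b j ^+ 2 + a j ^+ 2 * b i ^+ 2 - 2%:R * (a i * b i * (a j * b j)) = (a i * b j - a j * b i) ^+ 2 by ring.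
by rewrite real_exprn_even_ge0 // rpredB // ger0_real // mulr_ge0.
Qed.

Lemma norm_sum_sqr_le (T : finType) (f : T -> C) : `|\sum_i f i| ^+ 2 <= #|T|%:R * \sum_i `|f i| ^+ 2.
Proof.
have h := @sum_mul_sqr_le T (fun=> 1) (fun i => `|f i|) (fun=> ler01) (fun i => normr_ge0 _).
have e : \sum_(i : T) (1 : C) ^+ 2 = #|T|%:R by rewrite expr1n sumr_const.
rewrite e (eq_bigr (fun i => `|f i|)) in h; last by move=> i _; rewrite mul1r.
apply: le_trans h; rewrite ler_sqr ?nnegrE ?sumr_ge0 //; exact: ler_norm_sum.
Qed.

Lemma norm_sum_expr4_le (T : finType) (f : T -> C) : `|\sum_i f i| ^+ 4 <= #|T|%:R ^+ 3 * \sum_i `|f i| ^+ 4.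
Proof.
have h := norm_sum_sqr_le f.
have s0 : 0 <= \sum_i `|f i| ^+ 2 by apply: sumr_ge0 => i _; rewrite exprn_ge0.
have h2 : `|\sum_i f i| ^+ 4 <= (#|T|%:R * \sum_i `|f i| ^+ 2) ^+ 2.
  by rewrite (exprM _ 2 2) ler_sqr ?nnegrE ?mulr_ge0 ?exprn_ge0.
apply: le_trans h2 _; rewrite exprMn (exprSr _ 2) -mulrA; apply: ler_wpM2l; first by rewrite exprn_ge0.
have h3 := norm_sum_sqr_le (fun i => `|f i| ^+ 2).
rewrite ger0_norm // in h3.
apply: le_trans h3 _; rewrite le_eqVlt; apply/orP; left; apply/eqP; congr (_ * _); apply: eq_bigr => i _.
by rewrite normrX normr_id -exprM.
Qed.

End CauchySchwarz.

Definition add_energy (V : zmodType) (T : finType) (g : T -> V) : nat :=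
  #|[set s : (T * T) * (T * T) | g s.1.1 + g s.1.2 == g s.2.1 + g s.2.2]|.

Section Character.
Variables (C : numClosedFieldType) (p : nat) (pp : prime p) (psi : 'F_p -> C).
Hypotheses (psiD : forall u v, psi (u + v) = psi u * psi v) (psi_norm : forall u, `|psi u| = 1) (psi1 : psi 1 != 1).

Lemma psi_neq0 u : psi u != 0.
Proof. by rewrite -normr_eq0 psi_norm oner_eq0. Qed.

Lemma psi_0 : psi 0 = 1.
Proof. by apply: (mulfI (psi_neq0 0)); rewrite -psiD addr0 mulr1. Qed.

Lemma psi_conj u : (psi u)^* = psi (- u).
Proof.
apply: (mulfI (psi_neq0 u)); by rewrite -normCK psi_norm expr1n -psiD subrr psi_0.
Qed.

Lemma psi_orth u : \sum_t psi (t * u) = if u == 0 then p%:R else 0.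
Proof.
case: eqVneq => [->|u0].
  by rewrite (eq_bigr (fun=> 1)) => [|t _]; [rewrite sumr_const card_Fp|rewrite mulr0 psi_0].
have -> : \sum_t psi (t * u) = \sum_t psi t.
  rewrite [RHS](reindex_onto (fun t => t * u) (fun t => t / u)) /=; last by move=> t _; rewrite mulfVK.
  by apply: eq_bigl => t; rewrite mulfK ?eqxx.
apply/eqP; have : (psi 1 - 1) * (\sum_t psi t) = 0.
  rewrite mulrBl mul1r mulr_sumr; apply/eqP; rewrite subr_eq0; apply/eqP.
  rewrite [RHS](reindex_onto (fun t => 1 + t) (fun t => t - 1)) /=; last by move=> t _; ring.
  rewrite [RHS](eq_bigl (fun=> true)); last by move=> t; apply/eqP; ring.
  by apply: eq_bigr => t _; rewrite psiD.
by move/eqP; rewrite mulf_eq0 subr_eq0 (negPf psi1).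
Qed.

Lemma psi_parseval (T : finType) (g : T -> 'F_p) :
  \sum_t `|\sum_i psi (t * g i)| ^+ 2 = (p * #|[set s : T * T | g s.1 == g s.2]|)%:R.
Proof.
transitivity (\sum_t \sum_(s : T * T) psi (t * (g s.1 - g s.2))).
  apply: eq_bigr => t _; rewrite normCK rmorph_sum big_distrlr /= pair_big /=; apply: eq_bigr => s _.
  by rewrite psi_conj -psiD mulrBr.
rewrite exchange_big /= (eq_bigr (fun s : T * T => if g s.1 == g s.2 then p%:R else 0)); last first.
  by move=> s _; rewrite psi_orth subr_eq0.
rewrite -big_mkcond sumr_const /= natrM mulr_natr; congr (_ *+ _).
by rewrite cardsE; apply: eq_card => s.
Qed.

Lemma psi_sum_sqr (T : finType) (g : T -> 'F_p) t :
  (\sum_i psi (t * g i)) ^+ 2 = \sum_(s : T * T) psi (t * (g s.1 + g s.2)).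
Proof.
rewrite expr2 big_distrlr /= pair_big; apply: eq_bigr => s _; by rewrite mulrDr psiD.
Qed.

Lemma psi_fourth_moment (T : finType) (g : T -> 'F_p) :
  \sum_t `|\sum_i psi (t * g i)| ^+ 4 = (p * add_energy g)%:R.
Proof.
rewrite -(psi_parseval (fun s : T * T => g s.1 + g s.2)); apply: eq_bigr => t _.
by rewrite (exprM _ 2 2) -normrX psi_sum_sqr.
Qed.

(** Moving one term across the equation on each side permutes the four variables. *)
Lemma add_energy_sub (T : finType) (g : T -> 'F_p) :
  #|[set s : (T * T) * (T * T) | g s.1.1 - g s.1.2 == g s.2.1 - g s.2.2]| = add_energy g.
Proof.
pose f (s : (T * T) * (T * T)) := ((s.1.1, s.2.2), (s.2.1, s.1.2)).
have fK : involutive f by case=> [[a b] [c d]].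
rewrite /add_energy -(card_imset _ (inv_inj fK)); apply: eq_card => s.
apply/imsetP/idP => [[r]|].
  rewrite !inE /f => h -> /=; move: h; rewrite -subr_eq0 => /eqP h; rewrite -subr_eq0 -h; apply/eqP; ring.
rewrite inE => h; exists (f s); last by rewrite fK.
rewrite inE /f /=; move: h; rewrite -subr_eq0 => /eqP h; rewrite -subr_eq0 -h; apply/eqP; ring.
Qed.

(* Cauchy-Schwarz in the first variable, then over the differences of the second, then
   against the number of representations of each difference. *)
Lemma bilinear_le (T1 T2 : finType) (g1 : T1 -> 'F_p) (g2 : T2 -> 'F_p) (a1 : T1 -> C) (a2 : T2 -> C) (a : 'F_p) :
  (forall i, `|a1 i| <= 1) -> (forall j, `|a2 j| <= 1) -> a != 0 ->
  `|\sum_i \sum_j a1 i * a2 j * psi (a * g1 i * g2 j)| ^+ 8 <=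
    (#|T1| ^ 4 * #|T2| ^ 4 * p * add_energy g1 * add_energy g2)%:R.
Proof.
move=> ha1 ha2 a0.
set S := \sum_i _; pose B i := \sum_j a2 j * psi (a * g1 i * g2 j).
pose P (u : 'F_p) := \sum_i psi (u * g1 i).
have h1 : `|S| <= \sum_i `|B i|.
  apply: le_trans (ler_norm_sum _ _ _) _; apply: ler_sum => i _.
  have -> : \sum_j a1 i * a2 j * psi (a * g1 i * g2 j) = a1 i * B i.
    by rewrite /B mulr_sumr; apply: eq_bigr => j _; rewrite mulrA.
  by rewrite normrM ler_piMl.
have h2 : \sum_i `|B i| ^+ 2 <= \sum_(s : T2 * T2) `|P (a * (g2 s.1 - g2 s.2))|.
  have e : \sum_i `|B i| ^+ 2 = \sum_(s : T2 * T2) (a2 s.1 * (a2 s.2)^*) * P (a * (g2 s.1 - g2 s.2)).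
    rewrite /P (eq_bigr (fun i => \sum_(s : T2 * T2) a2 s.1 * (a2 s.2)^* * psi (a * (g2 s.1 - g2 s.2) * g1 i))); last first.
      move=> i _; rewrite normCK rmorph_sum big_distrlr /= pair_big /=; apply: eq_bigr => s _.
      rewrite rmorphM /= psi_conj mulrACA -psiD; congr (_ * psi _); ring.
    by rewrite exchange_big; apply: eq_bigr => s _; rewrite mulr_sumr.
  rewrite -[X in X <= _]ger0_norm; last by apply: sumr_ge0 => i _; rewrite exprn_ge0.
  rewrite e; apply: le_trans (ler_norm_sum _ _ _) _; apply: ler_sum => s _.
  by rewrite !normrM norm_conjC ler_piMl // -[X in _ <= X]mulr1 ler_pM.
set Q := \sum_(s : T2 * T2) _ in h2.
have Q0 : 0 <= Q by apply: sumr_ge0.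
have h3 : `|S| ^+ 2 <= #|T1|%:R * Q.
  apply: le_trans (_ : (\sum_i `|B i|) ^+ 2 <= _); first by rewrite ler_sqr ?nnegrE // sumr_ge0.
  have := norm_sum_sqr_le (fun i => `|B i|); rewrite ger0_norm ?sumr_ge0 // => h; apply: le_trans h _.
  apply: ler_wpM2l => //; apply: le_trans h2; apply: ler_sum => i _; by rewrite normr_id.
pose W := \sum_(s : T2 * T2) `|P (a * (g2 s.1 - g2 s.2))| ^+ 2.
have W0 : 0 <= W by apply: sumr_ge0 => s _; rewrite exprn_ge0.
have h4 : Q ^+ 2 <= #|T2|%:R ^+ 2 * W.
  have := norm_sum_sqr_le (fun s : T2 * T2 => `|P (a * (g2 s.1 - g2 s.2))|); rewrite ger0_norm // => h.
  apply: le_trans h _; rewrite card_prod natrM -expr2; apply: ler_wpM2l; first by rewrite exprn_ge0.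
  by apply: ler_sum => s _; rewrite normr_id.
have h5 : W ^+ 2 <= (p * add_energy g1 * add_energy g2)%:R.
  pose rho u := #|[set s : T2 * T2 | g2 s.1 - g2 s.2 == u]|.
  have -> : W = \sum_u (rho u)%:R * `|P (a * u)| ^+ 2.
    rewrite /W (partition_big (fun s : T2 * T2 => g2 s.1 - g2 s.2) xpredT) //=; apply: eq_bigr => u _.
    rewrite (eq_bigr (fun=> `|P (a * u)| ^+ 2)); last by move=> s /eqP ->.
    by rewrite sumr_const mulr_natl; congr (_ *+ _); apply: eq_card => s; rewrite !inE.
  apply: le_trans (sum_mul_sqr_le _ _) _; rewrite ?ler0n //; first by move=> u; rewrite exprn_ge0.
  rewrite natrM mulrC; apply: ler_pM.
  - by apply: sumr_ge0 => u _; rewrite !exprn_ge0.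
  - by apply: sumr_ge0 => u _; rewrite exprn_ge0.
  - rewrite -psi_fourth_moment [X in _ <= X](reindex_onto (fun u => a * u) (fun u => u / a)) /=; last first.
      by move=> u _; rewrite mulrC mulfVK.
    rewrite [X in _ <= X](eq_bigl (fun=> true)); last by move=> u; rewrite mulrAC divff // mul1r eqxx.
    by apply: ler_sum => u _; rewrite -exprM.
  have -> : \sum_u (rho u)%:R ^+ 2 = (\sum_u rho u ^ 2)%N%:R :> C.
    by rewrite natr_sum; apply: eq_bigr => u _; rewrite natrX.
  rewrite -add_energy_sub ler_nat -[X in (_ <= X)%N]sum1_card.
  rewrite (partition_big (fun s : (T2 * T2) * (T2 * T2) => g2 s.1.1 - g2 s.1.2) xpredT) //=; apply: leq_sum => u _.
  rewrite sum1_card -mulnn /rho -cardsX; apply: subset_leq_card; apply/fintype.subsetP => s.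
  by rewrite inE !inE unfold_in /= inE => /andP[/eqP -> /eqP ->]; rewrite !eqxx.
have -> : `|S| ^+ 8 = (`|S| ^+ 2) ^+ 4 by rewrite -exprM.
apply: le_trans (_ : (#|T1|%:R * Q) ^+ 4 <= _).
  by rewrite lerXn2r ?nnegrE ?exprn_ge0 // mulr_ge0.
rewrite exprMn (exprM Q 2 2).
apply: le_trans (_ : #|T1|%:R ^+ 4 * (#|T2|%:R ^+ 2 * W) ^+ 2 <= _).
  by rewrite ler_wpM2l ?exprn_ge0 // lerXn2r ?nnegrE ?exprn_ge0 // mulr_ge0 // exprn_ge0.
rewrite exprMn -exprM mulrA -(mulnA _ (add_energy g1)) -(mulnA _ p) (mulnA p).
rewrite (natrM _ (#|T1| ^ 4 * #|T2| ^ 4)) (natrM _ (#|T1| ^ 4)) !natrX.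
by apply: ler_wpM2l => //; rewrite mulr_ge0 // exprn_ge0.
Qed.

End Character.

(** * Long intervals *)

Lemma ler_sum_fibers (C : numDomainType) (T U : finType) (f : T -> U) (H : U -> C) (m : nat) :
  (forall u, 0 <= H u) -> (forall u, #|[set t | f t == u]| <= m)%N -> \sum_t H (f t) <= m%:R * \sum_u H u.
Proof.
move=> H0 hm; rewrite (partition_big f xpredT) //= mulr_sumr; apply: ler_sum => u _.
rewrite (eq_bigr (fun=> H u)); last by move=> t /eqP ->.
rewrite sumr_const -[X in X <= _]mulr_natl; apply: ler_wpM2r => //; rewrite ler_nat.
by apply: leq_trans (hm u); apply: eq_leq; apply: eq_card => t; rewrite !inE.
Qed.

(** Clearing denominators leaves a polynomial of degree at most 2. If it vanished, both pairs would
    have the same sum and, 2 being invertible, the same product, and so would coincide. The four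
    additional roots [- z_i] account for the convention [0^-1 = 0]. *)
Lemma recip_eq_card (F : finFieldType) (z1 z2 z3 z4 : F) : 2%:R != 0 :> F ->
  z1 != z3 \/ z2 != z4 -> z1 != z4 \/ z2 != z3 ->
  (#|[set w : F | ((w + z1)^-1 + (w + z2)^-1 == (w + z3)^-1 + (w + z4)^-1)%R]| <= 6)%N.
Proof.
move=> h2 ne1 ne2.
pose s := z1 + z2; pose t := z3 + z4; pose q := z1 * z2; pose r := z3 * z4.
pose P := Poly [:: s * r - t * q; 2%:R * (r - q); t - s].
have P0 : P != 0.
  apply/eqP => e; have e0 : s * r - t * q = 0 by have := congr1 (fun u : {poly F} => u`_0) e; rewrite coef_Poly coef0.
  have e1 : 2%:R * (r - q) = 0 by have := congr1 (fun u : {poly F} => u`_1) e; rewrite coef_Poly coef0.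
  have e2 : t - s = 0 by have := congr1 (fun u : {poly F} => u`_2) e; rewrite coef_Poly coef0.
  move/eqP: e1; rewrite mulf_eq0 (negPf h2) /= => /eqP e1.
  have : (z1 - z3) * (z1 - z4) = 0.
    have -> : (z1 - z3) * (z1 - z4) = (r - q) - z1 * (t - s) by rewrite /r /q /t /s; ring.
    by rewrite e1 e2 mulr0 subrr.
  move/eqP; rewrite mulf_eq0 !subr_eq0 => /orP[] /eqP e3.
    have e4 : z2 = z4 by apply/eqP; rewrite -subr_eq0 -[z2 - z4]opprK oppr_eq0 -e2 /t /s e3; apply/eqP; ring.
    by case: ne1; rewrite ?e3 ?e4 eqxx.
  have e4 : z2 = z3 by apply/eqP; rewrite -subr_eq0 -[z2 - z3]opprK oppr_eq0 -e2 /t /s e3; apply/eqP; ring.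
  by case: ne2; rewrite ?e3 ?e4 eqxx.
pose Q := ('X + z1%:P) * (('X + z2%:P) * (('X + z3%:P) * (('X + z4%:P) * P))).
have X0 z : 'X + z%:P != 0 :> {poly F} by rewrite -size_poly_eq0 size_XaddC.
have Q0 : Q != 0 by rewrite !mulf_neq0.
have sQ : (size Q <= 7)%N.
  have h n (z : F) (U : {poly F}) : (size U <= n)%N -> (size (('X + z%:P) * U)%R <= n.+1)%N.
    by move=> hU; apply: leq_trans (size_polyMleq _ _) _; rewrite size_XaddC.
  have h3 : (size P <= 3)%N by apply: size_Poly.
  exact: (h _ _ _ (h _ _ _ (h _ _ _ (h _ _ _ h3)))).
rewrite -ltnS; apply: leq_trans sQ; rewrite cardE; apply: max_poly_roots => //; last exact: enum_uniq.
apply/allP => w; rewrite mem_enum inE => /eqP hw; rewrite /root /Q !hornerM !hornerD !hornerX !hornerC.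
rewrite !mulf_eq0; have [//|n1] := boolP (w + z1 == 0); have [//|n2] := boolP (w + z2 == 0).
have [//|n3] := boolP (w + z3 == 0); have [//|n4] := boolP (w + z4 == 0); rewrite /=.
rewrite /P horner_Poly /= !mul0r !add0r.
have : (w + z1) * (w + z2) * (w + z3) * (w + z4) * ((w + z1)^-1 + (w + z2)^-1 - ((w + z3)^-1 + (w + z4)^-1)) = 0.
  by rewrite hw subrr mulr0.
have -> : (w + z1) * (w + z2) * (w + z3) * (w + z4) * ((w + z1)^-1 + (w + z2)^-1 - ((w + z3)^-1 + (w + z4)^-1)) =
   (w + z1 + (w + z2)) * ((w + z3) * (w + z4)) - (w + z3 + (w + z4)) * ((w + z1) * (w + z2)).
  by field; rewrite n1 n2 n3 n4.
by move=> h; rewrite -h /s /t /q /r; apply/eqP; ring.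
Qed.

Section Shift.
Variables (C : numClosedFieldType) (p : nat) (pp : prime p) (psi : 'F_p -> C).
Hypotheses (psiD : forall u v, psi (u + v) = psi u * psi v) (psi_norm : forall u, `|psi u| = 1) (psi1 : psi 1 != 1).
Hypothesis p2 : (2 < p)%N.

Lemma Fp_nat_inj (i j : nat) : (i < p)%N -> (j < p)%N -> i%:R = j%:R :> 'F_p -> i = j.
Proof.
move=> ip jp /(congr1 (fun x : 'F_p => x : nat)); rewrite !val_Fp_nat // !modn_small //.
Qed.

(** For fixed [z]'s one counts [w]: all [p] values for the at most [2 Z ^ 2] diagonal quadruples, at
    most 6 for each of the others. *)
Lemma sum_recip_energy (Z : nat) : (Z <= p)%N ->
  (\sum_(w : 'F_p) add_energy (fun z : 'I_Z => ((w + z%:R)^-1)%R) <= 2 * Z ^ 2 * p + 6 * Z ^ 4)%N.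
Proof.
move=> Zp; pose T := ('I_Z * 'I_Z)%type; pose S := (T * T)%type.
pose ev (w : 'F_p) (s : S) := (w + s.1.1%:R)^-1 + (w + s.1.2%:R)^-1 == (w + s.2.1%:R)^-1 + (w + s.2.2%:R)^-1.
have -> : (\sum_(w : 'F_p) add_energy (fun z : 'I_Z => ((w + z%:R)^-1)%R) = \sum_(s : S) #|[set w | ev w s]|)%N.
  transitivity (\sum_(w : 'F_p) \sum_(s : S) ev w s)%N.
    by apply: eq_bigr => w _; rewrite /add_energy -sum1_card big_mkcond /=; apply: eq_bigr => s _; rewrite inE /ev; case: eqP.
  rewrite exchange_big /=; apply: eq_bigr => s _.
  by rewrite -sum1_card [RHS]big_mkcond /=; apply: eq_bigr => w _; rewrite inE; case: ev.
pose diag (s : S) := (s.2 == s.1) || (s.2 == (s.1.2, s.1.1)).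
rewrite (bigID diag) /=; apply: leq_add.
  apply: (@leq_trans (\sum_(s : S | diag s) p)).
    by apply: leq_sum => s _; apply: leq_trans (max_card _) _; rewrite card_Fp.
  rewrite sum_nat_const leq_mul2r; apply/orP; right.
  have hd : [set s | diag s] \subset [set (t, t) | t : T] :|: [set (t, (t.2, t.1)) | t : T].
    apply/subsetP => -[t u]; rewrite !inE /diag /= => /orP[] /eqP ->; apply/orP; [left|right]; by apply/imsetP; exists t.
  have -> : #|[pred s | diag s]| = #|[set s | diag s]| by apply: eq_card => s; rewrite !inE.
  apply: leq_trans (subset_leq_card hd) _; apply: leq_trans (leq_card_setU _ _) _.
  rewrite mul2n -addnn; apply: leq_add; apply: leq_trans (leq_imset_card _ _) _; by rewrite card_prod !card_ord.
apply: (@leq_trans (\sum_(s : S | ~~ diag s) 6)); last first.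
  rewrite sum_nat_const mulnC leq_mul2l /=; apply: leq_trans (max_card _) _.
  by rewrite !card_prod !card_ord; apply: eq_leq; ring.
apply: leq_sum => -[[z1 z2] [z3 z4]]; rewrite /diag negb_or /= => /andP[d1 d2].
have inj (i j : 'I_Z) : i%:R = j%:R :> 'F_p -> i = j.
  by move=> e; apply: val_inj; apply: Fp_nat_inj e; apply: leq_trans (ltn_ord _) Zp.
have hn (i j : 'I_Z) : i != j -> (i%:R : 'F_p) != j%:R by apply: contraNneq => /inj ->.
apply: recip_eq_card.
- by rewrite -(dvdn_pcharf (pchar_Fp pp)); apply/negP => /dvdn_leq h; by have := h isT; rewrite leqNgt p2.
- have [e|ne] := eqVneq z1 z3; last by left; apply: hn.
  right; apply: hn; apply: contraNneq d1 => /= e2; by rewrite e e2.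
- have [e|ne] := eqVneq z1 z4; last by left; apply: hn.
  right; apply: hn; apply: contraNneq d2 => /= e2; by rewrite e e2.
Qed.

Variables (M : int) (N Y Z : nat).
Hypotheses (Np : (N < p)%N) (Y_gt0 : (0 < Y)%N) (Z_gt0 : (0 < Z)%N) (YZ : (Y * Z <= N)%N).

Lemma YN : (Y <= N)%N. Proof. by apply: leq_trans YZ; rewrite leq_pmulr. Qed.
Lemma ZN : (Z <= N)%N. Proof. by apply: leq_trans YZ; rewrite leq_pmull. Qed.

(* Every element of the interval is [base k + y * z] with [k < 2 N], for each choice of [y <= Y] and [z < Z]. *)
Definition base (k : 'I_(N + N)) : 'F_p := (M + k.+1%:Z - N%:Z)%:~R.
Definition shifted (t : 'I_(N + N) * 'I_Y * 'I_Z) : 'F_p := (base t.1.1 + t.1.2.+1%:R * t.2%:R)^-1.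
Definition shift_sum (xi : 'F_p) : C := \sum_t psi (xi * shifted t).

(** The [2 N] consecutive integers may wrap around modulo [p]; each half has only [N < p] of
    them. *)
Lemma base_inj (k l : 'I_(N + N)) : (k < N)%N = (l < N)%N -> base k = base l -> k = l.
Proof.
move=> h /eqP; rewrite Fp_int_eq //.
have -> : (M + k.+1%:Z - N%:Z) - (M + l.+1%:Z - N%:Z) = (k : nat)%:Z - (l : nat)%:Z by rewrite !intS; ring.
move=> d; apply: val_inj => /=; move: h (ltn_ord k) (ltn_ord l) d; move: (nat_of_ord k) (nat_of_ord l) => a b h ha hb.
case: (eqVneq (a%:Z - b%:Z) 0) => [/eqP|ne]; first by rewrite subr_eq0 => /eqP[].
rewrite dvdzE => /dvdn_leq hd; have : (p <= `|(a%:Z - b%:Z)%R|)%N by apply: hd; rewrite absz_gt0.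
move: h ha hb Np; clear; have [h1|h1] := ltnP a N; have [h2|h2] := ltnP b N => // _; lia.
Qed.

Lemma succ_neq0 (y : 'I_Y) : (y.+1%:R : 'F_p) != 0.
Proof.
rewrite -(dvdn_pcharf (pchar_Fp pp)); apply/negP => /dvdn_leq h.
have := leq_trans (h isT) (ltn_ord y); rewrite leqNgt (leq_ltn_trans YN) //.
Qed.

(** [nu] gives [y], and then [w] gives [base k], which leaves one [k] in each half. *)
Lemma shift_fibers (xi nu w : 'F_p) : xi != 0 ->
  (#|[set t : 'I_(N + N) * 'I_Y | (xi / t.2.+1%:R, base t.1 / t.2.+1%:R) == (nu, w)]| <= 2)%N.
Proof.
move=> xi0; rewrite -card_bool -(@card_in_imset _ _ (fun t : 'I_(N + N) * 'I_Y => (t.1 < N)%N)); first exact: max_card.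
have yp (y : 'I_Y) : (y.+1 < p)%N by apply: leq_ltn_trans Np; apply: leq_trans (ltn_ord y) YN.
move=> [k y] [k' y']; rewrite !inE => /eqP[e1 e2] /eqP[e3 e4] /= hk.
have ey : y = y'.
  have e : (y.+1%:R : 'F_p) = y'.+1%:R by apply: invr_inj; apply: (mulfI xi0); rewrite e1 e3.
  by apply: val_inj; apply: succn_inj; exact: (Fp_nat_inj (yp y) (yp y') e).
rewrite -ey in e4 *; congr (_, _); apply: base_inj => //.
by apply: (mulIf (invr_neq0 (succ_neq0 y))); rewrite e2 e4.
Qed.

(** As [xi / (base + y z) = (xi / y) / (base / y + z)], the pair [(k, y)] enters only through
    [(nu, w)]. Each value of the latter occurs at most twice, so the sum of fourth powers can be
    completed to all [nu] and [w]. *)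
Lemma shift_sum_le (xi : 'F_p) : xi != 0 ->
  `|shift_sum xi| ^+ 4 <= (((N + N) * Y) ^ 3 * (2 * (p * (2 * Z ^ 2 * p + 6 * Z ^ 4))))%:R.
Proof.
move=> xi0; pose g (w : 'F_p) (z : 'I_Z) := (w + z%:R)^-1.
pose H (u : 'F_p * 'F_p) := `|\sum_z psi (u.1 * g u.2 z)| ^+ 4.
pose f (t : 'I_(N + N) * 'I_Y) := (xi / t.2.+1%:R : 'F_p, base t.1 / t.2.+1%:R : 'F_p).
have -> : shift_sum xi = \sum_t \sum_z psi ((f t).1 * g (f t).2 z).
  rewrite /shift_sum pair_bigA /=; apply: eq_bigr => -[[k y] z] _; congr (psi _).
  rewrite /shifted /g /f /=; have y0 := succ_neq0 y; rewrite -mulrA -invfM mulrDr; congr (_ * (_ + _)^-1).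
  by rewrite mulrC divfK.
apply: le_trans (norm_sum_expr4_le _) _; rewrite card_prod !card_ord -natrX [X in _ <= X]natrM; apply: ler_wpM2l => //.
have h : \sum_t H (f t) <= 2%:R * \sum_u H u.
  apply: ler_sum_fibers => [u|[nu w]]; first by rewrite exprn_ge0.
  exact: shift_fibers.
apply: le_trans h _; rewrite natrM; apply: ler_wpM2l => //.
have -> : \sum_u H u = \sum_(w : 'F_p) \sum_(nu : 'F_p) H (nu, w).
  by rewrite exchange_big pair_bigA; apply: eq_bigr => -[nu w] _.
rewrite (eq_bigr (fun w : 'F_p => (p * add_energy (g w))%:R)); last first.
  by move=> w _; exact: (psi_fourth_moment pp psiD psi_norm psi1 (g w)).
rewrite -natr_sum ler_nat -big_distrr /= leq_mul2l; apply/orP; right; apply: sum_recip_energy.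
by apply: leq_trans ZN (ltnW Np).
Qed.

Lemma energy_card : energy p M N = #|[set q : ('I_N * 'I_N) * ('I_N * 'I_N) | lam p M q.2 == lam p M q.1]|.
Proof.
transitivity (\sum_(s : 'I_N * 'I_N) \sum_(t : 'I_N * 'I_N) (lam p M t == lam p M s))%N.
  apply: eq_bigr => s _; rewrite -sum1_card big_mkcond; apply: eq_bigr => t _; by rewrite inE; case: eqP.
rewrite pair_bigA -sum1_card [RHS]big_mkcond; apply: eq_bigr => q _; by rewrite inE; case: eqP.
Qed.

(** Each point of the interval has [Y Z] representations, so a solution of the energy equation
    yields [(Y Z) ^ 2] solutions with one shifted reciprocal on each side; Parseval's identity
    counts these. *)
Lemma energy_shift_le :
  (p * ((Y * Z) ^ 2 * energy p M N))%:R <= \sum_(xi : 'F_p) `|shift_sum xi| ^+ 2 * `|\sum_(u : 'I_N) psi (xi * (pt p M u)^-1)| ^+ 2 :> C.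
Proof.
pose T := ('I_(N + N) * 'I_Y * 'I_Z * 'I_N)%type.
pose h (t : T) := shifted t.1 + (pt p M t.2)^-1.
have -> : \sum_(xi : 'F_p) `|shift_sum xi| ^+ 2 * `|\sum_(u : 'I_N) psi (xi * (pt p M u)^-1)| ^+ 2 =
    (p * #|[set s : T * T | h s.1 == h s.2]|)%:R.
  rewrite -(psi_parseval pp psiD psi_norm psi1 h); apply: eq_bigr => xi _.
  rewrite -exprMn -normrM big_distrlr /= pair_bigA /=; congr (`|_| ^+ 2); apply: eq_bigr => s _.
  by rewrite -psiD -mulrDr.
rewrite ler_nat leq_mul2l energy_card; apply/orP; right.
pose K := ('I_Y * 'I_Z)%type.
have hk (u : 'I_N) (a : K) : (u + N - a.1.+1 * a.2 < N + N)%N.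
  by apply: leq_ltn_trans (leq_subr _ _) _; rewrite ltn_add2r ltn_ord.
have hm (a : K) : (a.1.+1 * a.2 <= N)%N.
  by apply: leq_trans YZ; apply: leq_mul; [exact: ltn_ord|exact: ltnW (ltn_ord _)].
pose k (u : 'I_N) (a : K) : 'I_(N + N) := Ordinal (hk u a).
have base_k u a : base (k u a) + a.1.+1%:R * a.2%:R = pt p M u.
  rewrite /base /pt /= -natrM -[(_ * _)%:R]/(((a.1.+1 * a.2)%N%:Z)%:~R) -rmorphD /=; congr (_%:~R).
  by have := hm a; move: (a.1.+1 * a.2)%N => m; clear; lia.
pose f (d : (K * K) * (('I_N * 'I_N) * ('I_N * 'I_N))) : T * T :=
  ((((k d.2.1.1 d.1.1, d.1.1.1), d.1.1.2), d.2.1.2), (((k d.2.2.1 d.1.2, d.1.2.1), d.1.2.2), d.2.2.2)).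
pose D := finset.setX [set: K * K] [set q : ('I_N * 'I_N) * ('I_N * 'I_N) | lam p M q.2 == lam p M q.1].
have -> : ((Y * Z) ^ 2 * #|[set q : ('I_N * 'I_N) * ('I_N * 'I_N) | lam p M q.2 == lam p M q.1]| = #|D|)%N.
  by rewrite cardsX cardsT !card_prod !card_ord mulnn.
rewrite -(@card_in_imset _ _ f).
  apply: subset_leq_card; apply/subsetP => s /imsetP[d]; rewrite !inE /= => /eqP hd ->.
  rewrite /h /shifted /f /= !base_k eq_sym; apply/eqP; exact: hd.
move=> [[[y1 z1] [y2 z2]] [[u1 u2] [u3 u4]]] [[[y1' z1'] [y2' z2']] [[v1 v2] [v3 v4]]] _ _ [].
have kinj (u v : 'I_N) (y : 'I_Y) (z : 'I_Z) : (u + N - y.+1 * z = v + N - y.+1 * z)%N -> u = v.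
  by move=> e; apply: val_inj; have := hm (y, z); move: e => /=; move: (y.+1 * z)%N => m; lia.
move=> e1 ey1 ez1 -> e2 ey2 ez2 ->; rewrite -ey1 -ez1 in e1 *; rewrite -ey2 -ez2 in e2 *.
by rewrite (kinj _ _ _ _ e1) (kinj _ _ _ _ e2).
Qed.

(** Frequency 0 gives the first term. For the others the shifted sum is bounded uniformly by
    [shift_sum_le], and Parseval's identity is applied to the sum over the interval. The factors 2
    come from squaring the sum of the two terms. *)
Lemma energy_large_nat :
  ((p * ((Y * Z) ^ 2 * energy p M N)) ^ 2 <= 2 * ((N + N) * Y * Z * N) ^ 4 +
     2 * (((N + N) * Y) ^ 3 * (2 * (p * (2 * Z ^ 2 * p + 6 * Z ^ 4))) * (p * N) ^ 2))%N.
Proof.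
set A4 := (((N + N) * Y) ^ 3 * _)%N.
pose a : C := sqrtC A4%:R; have a0 : 0 <= a by rewrite sqrtC_ge0.
have a2 : a ^+ 2 = A4%:R by rewrite sqrtCK.
pose F xi := \sum_(u : 'I_N) psi (xi * (pt p M u)^-1).
have hX : (p * ((Y * Z) ^ 2 * energy p M N))%:R <= (((N + N) * Y * Z * N) ^ 2)%:R + a * (p * N)%:R :> C.
  apply: le_trans energy_shift_le _; rewrite (bigD1 0) //=; apply: lerD.
    rewrite /shift_sum (eq_bigr (fun=> 1)) => [|t _]; last by rewrite mul0r (psi_0 psiD psi_norm).
    rewrite [X in _ * `|X| ^+ 2](eq_bigr (fun=> 1)) => [|t _]; last by rewrite mul0r (psi_0 psiD psi_norm).
    by rewrite !sumr_const !normr_nat -exprMn -natrM -natrX !card_prod !card_ord.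
  apply: (@le_trans _ _ (\sum_(xi : 'F_p) a * `|F xi| ^+ 2)).
    rewrite [X in _ <= X](bigD1 0) //= -[X in X <= _]add0r; apply: lerD; first by rewrite mulr_ge0 // exprn_ge0.
    apply: ler_sum => xi xi0; apply: ler_wpM2r; first by rewrite exprn_ge0.
    rewrite -ler_sqr ?nnegrE ?exprn_ge0 // a2 -exprM; exact: shift_sum_le.
  rewrite -mulr_sumr (psi_parseval pp psiD psi_norm psi1 (fun u : 'I_N => (pt p M u)^-1)); apply: ler_wpM2l => //.
  rewrite ler_nat leq_mul2l; apply/orP; right.
  rewrite -[X in (_ <= X)%N](card_ord N) -(@card_in_imset _ _ (fun s : 'I_N * 'I_N => s.1)); first exact: max_card.
  move=> [u v] [u' v']; rewrite !inE /= => /eqP/invr_inj/(ptB pp (ltnW Np)) -> /eqP/invr_inj/(ptB pp (ltnW Np)) -> -> //.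
rewrite -(ler_nat C) natrX; apply: le_trans (_ : ((((N + N) * Y * Z * N) ^ 2)%:R + a * (p * N)%:R) ^+ 2 <= _).
  by rewrite ler_sqr ?nnegrE ?addr_ge0 // mulr_ge0.
rewrite natrD (natrM _ 2) (natrM _ 2) (natrM _ A4) -a2 (natrX _ (p * N)) (_ : 4 = 2 * 2)%N // (expnM _ 2 2) (natrX _ (_ ^ 2)).
move: (((N + N) * Y * Z * N) ^ 2)%N (p * N)%N => B D; rewrite -subr_ge0.
have -> : 2%:R * B%:R ^+ 2 + 2%:R * (a ^+ 2 * D%:R ^+ 2) - (B%:R + a * D%:R) ^+ 2 = (B%:R - a * D%:R) ^+ 2 by ring.
by rewrite real_exprn_even_ge0 // rpredB // ger0_real // mulr_ge0.
Qed.

End Shift.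

(** * The exponential sum *)

From mathcomp Require Import all_classical all_reals all_analysis.
From mathcomp Require Import complex.

Local Open Scope complex_scope.

Section Exponential.
Variables (R : realType) (p : nat) (pp : prime p).

Let ang (n : nat) : R := 2 * pi * n%:R / p%:R.
Let cis (n : nat) : R[i] := cos (ang n) +i* sin (ang n).

Let cisD (m n : nat) : cis (m + n) = cis m * cis n.
Proof.
have e : ang (m + n) = ang m + ang n by rewrite /ang natrD mulrDr mulrDl.
by rewrite /cis e cosD sinD; apply/eqP; rewrite eq_complex /= eqxx addrC [cos (ang m) * sin _]mulrC mulrC eqxx.
Qed.

Let cis_mod (n : nat) : cis (n %% p) = cis n.
Proof.
have p0 : p%:R != 0 :> R by rewrite pnatr_eq0 -lt0n prime_gt0.
rewrite [in RHS](divn_eq n p) addnC; set k := (n %/ p)%N; set m := (n %% p)%N.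
have e : ang (m + k * p) = ang m + pi *+ 2 *+ k.
  have -> : pi *+ 2 *+ k = 2 * k%:R * pi :> R by rewrite -mulrnA -(mulr_natl pi) natrM.
  by rewrite /ang natrD natrM; field.
by rewrite /cis e (periodicn (@cosD2pi R)) (periodicn (@sinD2pi R)).
Qed.

Lemma e_pD (u v : 'F_p) : e_p R (u + v) = e_p R u * e_p R v.
Proof.
have -> : u + v = ((u + v)%N)%:R by rewrite natrD !natr_Zp.
by rewrite -[LHS]/(cis _) val_Fp_nat // cis_mod cisD.
Qed.

Lemma norm_e_p (u : 'F_p) : `|e_p R u| = 1.
Proof. by rewrite normc_def /= cos2Dsin2 sqrtr1. Qed.

(** The angle [2 pi / p] is positive and at most pi, where the cosine is 1 only at 0. *)
Lemma e_p1 : e_p R (1 : 'F_p) != 1.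
Proof.
have pR : 0 < p%:R :> R by rewrite ltr0n prime_gt0.
have e1 : ((1%:R : 'F_p) : nat) = 1%N by rewrite val_Fp_nat // modn_small // prime_gt1.
rewrite /e_p e1 eq_complex /= negb_and; apply/orP; left; apply/eqP => h.
have x0 : 0 < 2 * pi * 1%:R / p%:R :> R by rewrite !mulr_gt0 ?invr_gt0 ?pi_gt0.
have xpi : 2 * pi * 1%:R / p%:R <= pi :> R.
  rewrite mulr1 ler_pdivrMr // mulrC ler_wpM2l ?pi_ge0 // ler_nat prime_gt1 //.
have := @cos_inj R (2 * pi * 1%:R / p%:R) 0; rewrite !in_itv /= (ltW x0) xpi lexx pi_ge0 cos0 => /(_ isT isT h) e.
by rewrite e ltxx in x0.
Qed.

End Exponential.

Lemma pt_neq0_lt (p : nat) (pp : prime p) (M : int) (N : nat) : (forall u : 'I_N, pt p M u != 0) -> (N < p)%N.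
Proof.
move=> h; have p0 := prime_gt0 pp; rewrite ltnNge; apply/negP => pN.
pose r := absz ((- M - 1) %% p%:Z)%Z.
have pz : p%:Z != 0 by rewrite eqz_nat -lt0n.
have er : r%:Z = ((- M - 1) %% p%:Z)%Z by rewrite /r gez0_abs // modz_ge0.
have rN : (r < N)%N by apply: leq_trans pN; rewrite -ltz_nat er ltz_pmod.
have /negP := h (Ordinal rN); apply; rewrite /pt Fp_int_eq0 //=.
have -> : M + r.+1%:Z = (- (((- M - 1) %/ p%:Z)%Z)) * p%:Z.
  have := divz_eq (- M - 1) p%:Z; rewrite -er mulNr; move: ((_ %/ _)%Z * _) => x; clear; lia.
by rewrite dvdz_mull.
Qed.

(** Up to constants, [Z = (p / N) ^ 3] is the least choice for which the diagonal term [2 Z ^ 2 p]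
    of the fourth moment is admissible. The other term then needs [p ^ 2 Z << N ^ 3], that is
    [p ^ 5 << N ^ 6], which the range of [N] provides. *)
Lemma energy_large (R : realType) (p : nat) (pp : prime p) (M : int) (N : nat) :
  (16 <= N)%N -> (N < p)%N -> (p ^ 100 < N ^ 101)%N -> (energy p M N ^ 2 * p <= (32 * 101) * N ^ 7)%N.
Proof.
move=> N16 Np hpN; have p0 := prime_gt0 pp; have N0 : (0 < N)%N by apply: leq_trans N16.
have p2 : (2 < p)%N by apply: leq_ltn_trans Np; apply: leq_trans N16.
have h5 : (p ^ 5 <= N ^ 6)%N.
  rewrite -(@leq_exp2r _ _ 20) // -!expnM; apply: leq_trans (ltnW hpN) _; by rewrite leq_pexp2l.
(* This will give [Z <= N]. The factor 8 is absorbed by [8 ^ 100 <= 16 ^ 97 <= N ^ 97], the rest by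
   [p ^ 300 <= N ^ 303]. *)
have h3 : (8 * p ^ 3 <= N ^ 4)%N.
  suff h c : c = 8%N -> (c * p ^ 3 <= N ^ 4)%N by exact: h.
  move=> c8.
  have g x y a b : (2 ^ 4 <= x)%N -> (y = 2 ^ 3)%N -> (3 * a <= 4 * b)%N -> (y ^ a <= x ^ b)%N.
    move=> hx -> ab; rewrite -expnM; apply: (@leq_trans (2 ^ (4 * b))); first by rewrite leq_pexp2l.
    by rewrite expnM; case: b {ab} => // b; rewrite leq_exp2r.
  have h97 := (g N c 100 97 N16 c8 isT)%N.
  rewrite -(@leq_exp2r _ _ 100) // expnMn.
  apply: (@leq_trans (N ^ 97 * (p ^ 3) ^ 100)%N); first exact: leq_mul.
  apply: (@leq_trans (N ^ 97 * (N ^ 101) ^ 3)%N); last by rewrite -!expnM -expnD.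
  by rewrite leq_mul2l -expnM (mulnC 3) expnM leq_exp2r // (ltnW hpN) orbT.
pose t := (p %/ N).+1; pose Z := (t ^ 3)%N; pose Y := (N %/ Z)%N.
have tN : (p <= t * N)%N by apply: ltnW; apply: ltn_ceil.
have tN2 : (t * N <= 2 * p)%N.
  by rewrite [leqLHS]mulSn mul2n -addnn; apply: leq_add; [exact: ltnW|exact: leq_trunc_div].
have Z0 : (0 < Z)%N by rewrite expn_gt0.
have ZN3 : (p ^ 3 <= Z * N ^ 3)%N by rewrite -expnMn leq_exp2r.
have ZN3' : (Z * N ^ 3 <= 8 * p ^ 3)%N by rewrite -expnMn (_ : 8 = 2 ^ 3)%N // -expnMn leq_exp2r.
have ZN : (Z <= N)%N.
  have n3 : (0 < N ^ 3)%N by rewrite expn_gt0 N0.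
  by rewrite -(leq_pmul2r n3) -expnS; apply: leq_trans ZN3' h3.
have Y0 : (0 < Y)%N by rewrite divn_gt0.
have YZ : (Y * Z <= N)%N by apply: leq_trunc_div.
have YZ2 : (N <= 2 * (Y * Z))%N.
  have h := ltn_ceil N Z0; apply: ltnW; apply: leq_trans h _; rewrite [leqLHS]mulSn mul2n -addnn leq_add2r.
  by rewrite leq_pmull.
have pZ : (p ^ 2 * Z <= 8 * N ^ 3)%N.
  have n3 : (0 < N ^ 3)%N by rewrite expn_gt0 N0.
  rewrite -(leq_pmul2r n3) -mulnA; apply: leq_trans (leq_mul (leqnn _) ZN3') _.
  rewrite mulnCA -mulnA leq_mul2l /= -expnD -expnD; exact: h5.
have := energy_large_nat pp (@e_pD R p pp) (@norm_e_p R p) (@e_p1 R p pp) p2 M Np Y0 Z0 YZ.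
move: (energy p M N) => E hE.
have pos : (0 < p ^ 2 * (Y * Z) ^ 4)%N by rewrite muln_gt0 !expn_gt0 muln_gt0 p0 Y0 Z0.
rewrite -(leq_pmul2r pos).
apply: (@leq_trans (p * (p * ((Y * Z) ^ 2 * E)) ^ 2)); first by apply: eq_leq; ring.
apply: leq_trans (leq_mul (leqnn p) hE) _; rewrite mulnDr.
apply: (@leq_trans (32 * N ^ 7 * (p ^ 2 * (Y * Z) ^ 4) + 32 * 100 * N ^ 7 * (p ^ 2 * (Y * Z) ^ 4))); last first.
  by apply: eq_leq; ring.
apply: leq_add.
  have -> : (p * (2 * ((N + N) * Y * Z * N) ^ 4) = (32 * N ^ 7 * (p * (Y * Z) ^ 4)) * N)%N by ring.
  have -> : (32 * N ^ 7 * (p ^ 2 * (Y * Z) ^ 4) = (32 * N ^ 7 * (p * (Y * Z) ^ 4)) * p)%N by ring.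
  by rewrite leq_mul2l (ltnW Np) orbT.
have -> : (p * (2 * (((N + N) * Y) ^ 3 * (2 * (p * (2 * Z ^ 2 * p + 6 * Z ^ 4))) * (p * N) ^ 2)) =
  (32 * p ^ 2 * (N ^ 5 * Y ^ 3 * Z ^ 2)) * (2 * p ^ 3 + 6 * (p ^ 2 * Z) * Z))%N by ring.
have -> : (32 * 100 * N ^ 7 * (p ^ 2 * (Y * Z) ^ 4) =
  (32 * p ^ 2 * (N ^ 5 * Y ^ 3 * Z ^ 2)) * (100 * (N ^ 2 * (Y * Z)) * Z))%N by ring.
rewrite leq_mul2l; apply/orP; right.
apply: (@leq_trans (50 * (N ^ 3 * Z))).
  apply: leq_trans (leq_add (leq_mul (leqnn 2) ZN3) (leq_mul (leq_mul (leqnn 6) pZ) (leqnn Z))) _.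
  by apply: eq_leq; ring.
rewrite mulnA leq_mul2r; apply/orP; right.
have -> : (100 * (N ^ 2 * (Y * Z)) = 50 * N ^ 2 * (2 * (Y * Z)))%N by ring.
by rewrite expnSr mulnA leq_mul2l YZ2 !orbT.
Qed.

(** * The energy bound for all intervals and the final estimate *)

Section Bound.
Variable R : realType.

Lemma energy_bound : exists2 C : R, 0 <= C & forall (p : nat) (pp : prime p) (M : int) (N : nat),
  (forall u : 'I_N, pt p M u != 0) ->
  (energy p M N)%:R ^+ 2 <= C * (N%:R ^+ 4 * (N%:R ^+ 3 / p%:R + 1)) :> R.
Proof.
have [C1 C10 h1] := energy_small R.
have [C2 C20 eC2] : exists2 C : R, 0 <= C & C = (32 * 101)%N%:R by exists (32 * 101)%N%:R; [exact: ler0n|].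
have [C3 C30 eC3] : exists2 C : R, 0 <= C & C = 16 ^+ 4 by exists (16 ^+ 4); [exact: exprn_ge0|].
exists (C1 + C2 + C3); first by rewrite !addr_ge0.
move=> p pp M N hpt; have Np := pt_neq0_lt pp hpt.
set E := energy p M N; pose X : R := N%:R ^+ 4 * (N%:R ^+ 3 / p%:R + 1).
have pR : 0 < p%:R :> R by rewrite ltr0n prime_gt0.
have r0 : 0 <= N%:R ^+ 3 / p%:R :> R by rewrite divr_ge0 // exprn_ge0.
have X0 : 0 <= X by rewrite mulr_ge0 ?exprn_ge0 // addr_ge0.
have suf (C : R) : C <= C1 + C2 + C3 -> E%:R ^+ 2 <= C * X -> E%:R ^+ 2 <= (C1 + C2 + C3) * X.
  by move=> hC h; apply: le_trans h _; apply: ler_wpM2r.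
have [N0|N0] := posnP N.
  apply: (suf 0); first by rewrite !addr_ge0.
  by rewrite mul0r /E N0 /energy big1 ?expr0n // => -[[]].
have [h|h] := leqP (N ^ 101) (p ^ 100).
  apply: (suf C1); first by rewrite -addrA lerDl addr_ge0.
  by rewrite /X mulrA; apply: h1 => //; rewrite N0 ltnW.
(* For [N < 16] the trivial bound [E <= N ^ 4] suffices, with the constant [16 ^ 4]. *)
have [N16|N16] := ltnP N 16.
  apply: (suf C3); first by rewrite lerDr addr_ge0.
  have hE : (E <= N ^ 4)%N.
    apply: (@leq_trans (\sum_(s : 'I_N * 'I_N) N * N)%N).
      by apply: leq_sum => s _; apply: leq_trans (max_card _) _; rewrite card_prod card_ord.
    by rewrite sum_nat_const card_prod card_ord; apply: eq_leq; ring.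
  apply: le_trans (_ : (N%:R ^+ 4) ^+ 2 <= _).
    by rewrite ler_sqr ?nnegrE ?exprn_ge0 // -natrX ler_nat.
  rewrite /X expr2 [leRHS]mulrCA; apply: ler_wpM2l; first by rewrite exprn_ge0.
  apply: le_trans (_ : C3 * 1 <= _); last by apply: ler_wpM2l; rewrite // lerDr.
  by rewrite mulr1 eC3; apply: lerXn2r; rewrite ?nnegrE // ler_nat ltnW.
apply: (suf C2); first by rewrite -addrA addrCA lerDl addr_ge0.
have := energy_large R pp M N16 Np h; rewrite -(ler_nat R) -/E natrM natrX (natrM _ (32 * 101)) -eC2 => hE.
apply: le_trans (_ : C2 * (N%:R ^+ 7 / p%:R) <= _).
  by rewrite mulrA ler_pdivlMr // -[N%:R ^+ 7]natrX.
apply: ler_wpM2l => //; rewrite /X mulrDr mulr1 mulrA -exprD lerDl exprn_ge0 //.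
Qed.

Lemma add_energyE (p : nat) (M : int) (N : nat) : add_energy (fun u : 'I_N => (pt p M u)^-1) = energy p M N.
Proof. by rewrite energy_card; apply: eq_card => q; rewrite !inE eq_sym. Qed.

Lemma notin_pt (p : nat) (M : int) (N : nat) : 0 \notin Fp_interval p M N -> forall u : 'I_N, pt p M u != 0.
Proof. by move=> h u; apply: contraNneq h => <-; apply/imsetP; exists u. Qed.

Lemma sum_interval (V : nmodType) (p : nat) (pp : prime p) (M : int) (N : nat) (F : 'F_p -> V) :
  (N <= p)%N -> \sum_(x in Fp_interval p M N) F x = \sum_(u : 'I_N) F (pt p M u).
Proof.
by move=> Np; rewrite /Fp_interval big_imset //= => u v _ _ /(ptB pp Np).
Qed.

Lemma norm_bilinear_le (p : nat) (pp : prime p) (M1 M2 : int) (N1 N2 : nat) (alpha1 alpha2 : 'F_p -> R[i]) (a : int) :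
  0 \notin Fp_interval p M1 N1 -> 0 \notin Fp_interval p M2 N2 ->
  (forall x, x \in Fp_interval p M1 N1 -> `|alpha1 x| <= 1) ->
  (forall x, x \in Fp_interval p M2 N2 -> `|alpha2 x| <= 1) -> coprimez a p ->
  `|bilinear_sum (Fp_interval p M1 N1) (Fp_interval p M2 N2) alpha1 alpha2 a| ^+ 8 <=
    (N1 ^ 4 * N2 ^ 4 * p * energy p M1 N1 * energy p M2 N2)%:R.
Proof.
move=> /notin_pt h1 /notin_pt h2 ha1 ha2 ca.
have Np1 := ltnW (pt_neq0_lt pp h1); have Np2 := ltnW (pt_neq0_lt pp h2).
have in_int M N (u : 'I_N) : pt p M u \in Fp_interval p M N by apply/imsetP; exists u.
have a0 : (a%:~R : 'F_p) != 0.
  rewrite Fp_int_eq0 //; apply/negP => d; move: ca; rewrite /coprimez gcdzC (gcdz_idPl d) /=.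
  by rewrite eqz_nat => /eqP e; move: (prime_gt1 pp); rewrite e.
rewrite /bilinear_sum sum_interval // (eq_bigr (fun u : 'I_N1 => \sum_(v : 'I_N2)
    alpha1 (pt p M1 u) * alpha2 (pt p M2 v) * e_p R (a%:~R * (pt p M1 u)^-1 * (pt p M2 v)^-1))); last first.
  by move=> u _; rewrite sum_interval.
have := bilinear_le pp (@e_pD R p pp) (@norm_e_p R p) (@e_p1 R p pp)
  (fun u : 'I_N1 => (pt p M1 u)^-1) (fun v : 'I_N2 => (pt p M2 v)^-1)
  (fun u => ha1 _ (in_int M1 N1 u)) (fun v => ha2 _ (in_int M2 N2 v)) a0.
by rewrite !add_energyE !card_ord.
Qed.

(** The 16th powers are compared, which turns all exponents into integers; the constants satisfy
    [C ^ 2 <= (C + 1) ^ 16]. *)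
Lemma expr16_le_powR (C E1 E2 : R) (N1 N2 p : nat) (b1 b2 r : R) :
  0 <= C -> 0 <= E1 -> 0 <= E2 -> 0 <= b1 -> 0 <= b2 -> 0 <= r ->
  r ^+ 8 <= N1%:R ^+ 4 * N2%:R ^+ 4 * p%:R * E1 * E2 ->
  E1 ^+ 2 <= C * (N1%:R ^+ 4 * b1) -> E2 ^+ 2 <= C * (N2%:R ^+ 4 * b2) ->
  r <= (C + 1) * (p%:R `^ (1 / 8) * N1%:R `^ (3 / 4) * N2%:R `^ (3 / 4) * b1 `^ (1 / 16) * b2 `^ (1 / 16)).
Proof.
move=> C0 E10 E20 b10 b20 r0 hr h1 h2.
have pX (x : R) (c : R) (k : nat) : 0 <= x -> c * 16 = k%:R -> (x `^ c) ^+ 16 = x ^+ k.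
  by move=> x0 ck; rewrite -powR_mulrn ?powR_ge0 // -powRrM ck powR_mulrn.
have T0 : 0 <= (C + 1) * (p%:R `^ (1 / 8) * N1%:R `^ (3 / 4) * N2%:R `^ (3 / 4) * b1 `^ (1 / 16) * b2 `^ (1 / 16)).
  by rewrite !mulr_ge0 ?powR_ge0 // addr_ge0.
rewrite -(@ler_pXn2r _ 16) ?nnegrE // !exprMn.
rewrite !(pX _ (1 / 8) 2) ?(pX _ (3 / 4) 12) ?(pX _ (1 / 16) 1) ?expr1 //; try by field.
have n0 (n k : nat) : 0 <= n%:R ^+ k :> R by rewrite exprn_ge0.
apply: (@le_trans _ _ ((N1%:R ^+ 4 * N2%:R ^+ 4 * p%:R * E1 * E2) ^+ 2)).
  rewrite (exprM r 8 2) ler_sqr ?nnegrE ?exprn_ge0 //.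
  by rewrite !mulr_ge0.
have -> : (N1%:R ^+ 4 * N2%:R ^+ 4 * p%:R * E1 * E2) ^+ 2 = (N1%:R ^+ 4) ^+ 2 * (N2%:R ^+ 4) ^+ 2 * p%:R ^+ 2 * E1 ^+ 2 * E2 ^+ 2.
  by move: (N1%:R ^+ 4) (N2%:R ^+ 4) (p%:R : R) => x y z; ring.
apply: (@le_trans _ _ ((N1%:R ^+ 4) ^+ 2 * (N2%:R ^+ 4) ^+ 2 * p%:R ^+ 2 * (C * (N1%:R ^+ 4 * b1)) * (C * (N2%:R ^+ 4 * b2)))).
  apply: ler_pM => //; rewrite ?exprn_ge0 //; first by rewrite !mulr_ge0 // exprn_ge0.
  by apply: ler_wpM2l => //; rewrite !mulr_ge0 ?exprn_ge0.
have -> : (N1%:R ^+ 4) ^+ 2 * (N2%:R ^+ 4) ^+ 2 * p%:R ^+ 2 * (C * (N1%:R ^+ 4 * b1)) * (C * (N2%:R ^+ 4 * b2)) =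
  C ^+ 2 * (p%:R ^+ 2 * N1%:R ^+ 12 * N2%:R ^+ 12 * b1 * b2).
  by move: (N1%:R : R) (N2%:R : R) (p%:R : R) => x y z; ring.
apply: ler_wpM2r; first by rewrite !mulr_ge0.
apply: (@le_trans _ _ ((C + 1) ^+ 2)); first by rewrite ler_sqr ?nnegrE ?addr_ge0 // lerDl.
by apply: ler_weXn2l; rewrite // lerDr.
Qed.

End Bound.

Theorem theorem9 (R : realType) :
  exists2 C : R, 0 < C &
  exists p0 : nat, forall p : nat, prime p -> (p0 <= p)%N ->
  forall (M1 M2 : int) (N1 N2 : nat),
  0 \notin Fp_interval p M1 N1 -> 0 \notin Fp_interval p M2 N2 ->
  forall alpha1 alpha2 : 'F_p -> R[i],
  (forall x, x \in Fp_interval p M1 N1 -> `|alpha1 x| <= 1) ->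
  (forall x, x \in Fp_interval p M2 N2 -> `|alpha2 x| <= 1) ->
  forall a : int, coprimez a p ->
  `|bilinear_sum (Fp_interval p M1 N1) (Fp_interval p M2 N2) alpha1 alpha2 a| <=
  (C * (p%:R `^ (1 / 8) * N1%:R `^ (3 / 4) * N2%:R `^ (3 / 4)
     * (N1%:R ^+ 3 / p%:R + 1) `^ (1 / 16)
     * (N2%:R ^+ 3 / p%:R + 1) `^ (1 / 16)))%:C.
Proof.
have [C C0 hC] := energy_bound R.
exists (C + 1); first by rewrite ltr_wpDl.
exists 0%N => p pp _ M1 M2 N1 N2 h1 h2 alpha1 alpha2 ha1 ha2 a ca.
have := norm_bilinear_le pp h1 h2 ha1 ha2 ca.
set S := bilinear_sum _ _ _ _ _.
have [r r0 ->] : exists2 r : R, 0 <= r & `|S| = r%:C.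
  by exists (Num.sqrt ((complex.Re S) ^+ 2 + (complex.Im S) ^+ 2)); rewrite ?sqrtr_ge0 ?normc_def.
have e (n : nat) : n%:R = (n%:R : R)%:C by rewrite rmorph_nat.
rewrite e -rmorphXn !lecR /= => hr.
have b0 (N : nat) : 0 <= N%:R ^+ 3 / p%:R + 1 :> R by rewrite addr_ge0 // divr_ge0 // exprn_ge0.
apply: (expr16_le_powR C0 (ler0n R (energy p M1 N1)) (ler0n R (energy p M2 N2))) => //; first last.
- exact: hC (notin_pt h2).
- exact: hC (notin_pt h1).
by rewrite -!natrX -!natrM.
Qed.
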